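(* Fix $r\in\{0,1\}$, which fixes the corresponding normal ordering convention. Let $c\in\mathbb C\setminus\{1,-1\}$, let $\mathcal R=\mathbb C[t,t^{-1},u\mid u^2=t^4-2ct^2+1]$, put $P(z)=z^4-2cz^2+1$, and let $\hat{\mathfrak g}=(\mathfrak{sl}(2,\mathbb C)\otimes\mathcal R)\oplus\mathbb C\omega_0\oplus\mathbb C\omega_{-1}\oplus\mathbb C\omega_{-2}\oplus\mathbb C\omega_{-3}\oplus\mathbb C\omega_{-4}$ be the Date-Jimbo-Kashiwara-Miwa (DJKM) algebra. Let $\chi_0\in\mathbb C$, and let $\mathcal V$ be the two-dimensional space described in the context, with parameters $\lambda,\mu,\nu,\varkappa,\kappa_0\in\mathbb C$. Then, with the operators described in the context, the following defines a representation $\tau$ of $\hat{\mathfrak g}$ on $\mathbb C[\mathbf x]\otimes\mathbb C[\mathbf y]\otimes\mathcal V$: $$\tau(\omega_{-1})=\tau(\omega_{-2})=\tau(\omega_{-3})=\tau(\omega_{-4})=0,\qquad \tau(\omega_0)=\chi_0=\kappa_0+4\delta_{r,0},$$ $$\tau(f(z))=-\alpha(z),\qquad \tau(f^1(z))=-\alpha^1(z),$$ $$\tau(h(z))=2\left(:\alpha(z)\alpha^*(z):+:\alpha^1(z)\alpha^{1*}(z):\right)+\beta(z),$$ $$\tau(h^1(z))=2\left(:\alpha^1(z)\alpha^*(z):+P(z):\alpha(z)\alpha^{1*}(z):\right)+\beta^1(z),$$ $$\tau(e(z))=:\alpha(z)(\alpha^*(z))^2:+P(z):\alpha(z)(\alpha^{1*}(z))^2:+2:\alpha^1(z)\alpha^*(z)\alpha^{1*}(z):+\beta(z)\alpha^*(z)+\beta^1(z)\alpha^{1*}(z)+\chi_0\,\partial_z\alpha^*(z),$$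 $$\tau(e^1(z))=:\alpha^1(z)(\alpha^*(z))^2:+P(z)\left(:\alpha^1(z)(\alpha^{1*}(z))^2:+2:\alpha(z)\alpha^*(z)\alpha^{1*}(z):\right)+\beta^1(z)\alpha^*(z)+P(z)\beta(z)\alpha^{1*}(z)+\chi_0\left(P(z)\,\partial_z\alpha^{1*}(z)+\tfrac12(\partial_zP(z))\,\alpha^{1*}(z)\right).$$
   Context: **The algebra.** $\Omega^1_{\mathcal R}/d\mathcal R$ is the space of Kähler differentials of $\mathcal R$ modulo exact forms, and $\overline{\eta}$ is the class of $\eta$. It has basis $\omega_0=\overline{t^{-1}dt}$, $\omega_{-k}=\overline{t^{-k}u\,dt}$ for $k=1,2,3,4$. The universal central extension $\hat{\mathfrak g}=(\mathfrak{sl}(2,\mathbb C)\otimes\mathcal R)\oplus\Omega^1_{\mathcal R}/d\mathcal R$ has bracket $[x\otimes p,y\otimes q]=[x,y]\otimes pq+(x,y)\overline{p\,dq}$, with $\Omega^1_{\mathcal R}/d\mathcal R$ central. Here $(\cdot,\cdot)$ is the invariant form on $\mathfrak{sl}(2,\mathbb C)$ normalized by $(e,f)=1$, $(h,h)=2$, where $e,f,h$ is the standard basis. For $x\in\{e,f,h\}$ and $m\in\mathbb Z$ put $x_m=x\otimes t^m$, $x^1_m=x\otimes t^mu$, $x(z)=\sum_m x_mz^{-m-1}$, $x^1(z)=\sum_m x^1_mz^{-m-1}$. Formulas for $\tau$ of a generating series are read coefficientwise. **The $\beta$-$\gamma$ system.** $\mathbb C[\mathbf x]=\mathbb C[x_n,x^1_n\mid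 n\in\mathbb Z]$. For $r=0$: $a_m=\partial/\partial x_m$ if $m\ge0$ and $a_m=x_m$ (multiplication) if $m<0$; $a^*_m=x_{-m}$ if $m\le 0$ and $a^*_m=-\partial/\partial x_{-m}$ if $m>0$. For $r=1$: $a_m=x_m$ and $a_m^*=-\partial/\partial x_{-m}$ for all $m$. The operators $a^1_m$, $a^{1*}_m$ are defined in the same way with $x^1$ in place of $x$. Put $\alpha(z)=\sum a_nz^{-n-1}$, $\alpha^*(z)=\sum a^*_nz^{-n}$, $\alpha^1(z)=\sum a^1_nz^{-n-1}$, $\alpha^{1*}(z)=\sum a_n^{1*}z^{-n}$. **Normal ordering.** $:a(z)b(w):=a(z)_+b(w)+b(w)a(z)_-$, extended recursively by $:a^1\cdots a^k:=:a^1(:a^2(\cdots:a^{k-1}a^k:\cdots):):$. For $r=0$ (usual ordering): $\alpha(z)_-=\sum_{n\ge0}a_nz^{-n-1}$, $\alpha(z)_+=\sum_{n<0}a_nz^{-n-1}$, $\alpha^*(z)_-=\sum_{n\ge1}a^*_nz^{-n}$, $\alpha^*(z)_+=\sum_{n\le0}a^*_nz^{-n}$, and likewise for $\alpha^1,\alpha^{1*}$. For $r=1$ (natural ordering): $\alpha_+=\alpha$, $\alpha_-=0$, $\alpha^*_+=0$, $\alpha^*_-=\alpha^*$, and likewise for $\alpha^1,\alpha^{1*}$. **The space $\mathcal V$.** $\mathcal V=\mathbb C\mathbf v_0\oplus\mathbb C\mathbf v_1$, on which the zero modes $b_0,b_0^1$ and the central elements $\mathbf 1_0,\mathbf 1_{-1},\dots,\mathbf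 1_{-4}$ of the DJKM Heisenberg algebra act by $b_0\mathbf v_i=\lambda\mathbf v_i$, $b_0^1\mathbf v_0=\mu\mathbf v_0+\nu\mathbf v_1$, $b_0^1\mathbf v_1=\varkappa\mathbf v_0+\mu\mathbf v_1$, $\mathbf 1_0\mathbf v_i=\kappa_0\mathbf v_i$, $\mathbf 1_j\mathbf v_i=0$ for $j=-1,-2,-3,-4$ ($i=0,1$), and on which the positive modes $b_n,b_n^1$ ($n>0$) act by $0$. Let $B_0^1$ denote the operator on $\mathcal V$ given by this action of $b_0^1$. **The fields $\beta,\beta^1$.** $\mathbb C[\mathbf y]=\mathbb C[y_n,y^1_n\mid n\in\mathbb Z,\ n<0]$. On $\mathbb C[\mathbf y]\otimes\mathcal V$ the operators $b_n,b_n^1$ are: - $b_n=y_n$ for $n<0$; $b_0=\lambda$; $b_n=-2n\,\partial_{y_{-n}}\chi_0$ for $n>0$; - $b^1_n=y^1_n+\delta_{n,-1}\,\partial_{y^1_{-3}}\chi_0-\delta_{n,-3}\,\partial_{y^1_{-1}}\chi_0$ for $n<0$; - $b^1_0=4\,\partial_{y^1_{-4}}\chi_0-2c\,\partial_{y^1_{-2}}\chi_0+B^1_0$; - $b^1_n=2(n+2)\,\partial_{y^1_{-n-4}}\chi_0-4c(n+1)\,\partial_{y^1_{-n-2}}\chi_0+2n\,\partial_{y^1_{-n}}\chi_0$ for $n>0$. Put $\beta(z)=\sum_n b_nz^{-n-1}$, $\beta^1(z)=\sum_nb^1_nz^{-n-1}$. All operators are extended to $\mathbb C[\mathbf x]\otimes\mathbb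 C[\mathbf y]\otimes\mathcal V$ by the identity on the remaining factors.
   Formalization: The operators are corrected: in b_n (n>0) κ_0 replaces χ_0; in b^1_n every χ_0 becomes −κ_0, and the term −2cχ_0∂_{y^1_{-2}} of b^1_0 becomes +4cκ_0∂_{y^1_{-2}}. With the printed operators the brackets fail for r=0, and for r=1 unless χ_0=0. *)

(* Defs.v *)
From HB Require Import structures.
From mathcomp Require Import all_boot all_order all_algebra.
From mathcomp Require Import ring_quotient generic_quotient finmap complex.
From mathcomp Require Import boolp classical_sets functions cardinality fsbigop.
From mathcomp Require Import reals monalg ring.

Set Implicit Arguments.
Unset Strict Implicit.
Unset Printing Implicit Defensive.
Import GRing.Theory.
Local Open Scope ring_scope.

(* Quotient of a module by the submodule spanned by a set of relations. *)
Section ModuleQuotient.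
Variables (K : pzRingType) (V : lmodType K) (G : set V).

Definition mspan : {pred V} := fun v =>
  `[< exists s : seq (K * V),
        (forall p, p \in s -> G p.2) /\ v = \sum_(p <- s) p.1 *: p.2 >].

Lemma mspan_submod_closed : submod_closed mspan.
Proof.
split; first by apply/asboolP; by exists [::]; split=> //; rewrite ?big_nil.
move=> a u v /asboolP[s [sG ->]] /asboolP[s' [s'G ->]]; apply/asboolP.
exists ([seq (a * p.1, p.2) | p <- s] ++ s'); split.
  move=> p; rewrite mem_cat => /orP[/mapP[q qs ->]|]; [exact: (sG q)|exact: s'G].
rewrite big_cat big_map scaler_sumr; congr (_ + _).
by apply: eq_bigr => p _; rewrite scalerA.
Qed.

HB.instance Definition _ :=
  GRing.isSubmodClosed.Build K V mspan mspan_submod_closed.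

Definition mquot := Quotient.quot (mspan : zmodClosed V).
HB.instance Definition _ := GRing.Zmodule.on mquot.

Definition mpi (v : V) : mquot := (\pi_(Quotient.quot (mspan : zmodClosed V)) v)%qT.

Definition mquot_scale (a : K) (q : mquot) : mquot := mpi (a *: repr q).

Lemma mpiP u v : mpi u = mpi v <-> u - v \in mspan.
Proof.
rewrite (Quotient.idealrBE (mspan : zmodClosed V)).
by split=> [/eqP|/eqP].
Qed.

Lemma mpi_is_additive : {morph mpi : u v / u + v}.
Proof. by move=> u v; rewrite /mpi raddfD. Qed.

Lemma mpiK q : mpi (repr q) = q. Proof. exact: reprK. Qed.

Lemma mpiZ a v : mpi (a *: v) = mquot_scale a (mpi v).
Proof.
apply/mpiP; rewrite -scalerBr rpredZ //; apply/mpiP.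
by rewrite mpiK.
Qed.

Lemma mquot_scaleA a b v :
  mquot_scale a (mquot_scale b v) = mquot_scale (a * b) v.
Proof. by rewrite -[v]mpiK -!mpiZ scalerA. Qed.

Lemma mquot_scale1 : left_id 1 mquot_scale.
Proof. by move=> v; rewrite -[v]mpiK -mpiZ scale1r. Qed.

Lemma mquot_scaleDr : right_distributive mquot_scale +%R.
Proof.
move=> a u v; rewrite -[u]mpiK -[v]mpiK.
by rewrite -mpi_is_additive -!mpiZ -mpi_is_additive scalerDr.
Qed.

Lemma mquot_scaleDl v : {morph mquot_scale^~ v : a b / a + b}.
Proof.
by move=> a b; rewrite -[v]mpiK -!mpiZ -mpi_is_additive scalerDl.
Qed.

HB.instance Definition _ := GRing.Zmodule_isLmodule.Build K mquot
  mquot_scaleA mquot_scale1 mquot_scaleDr mquot_scaleDl.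

Lemma mpi_is_linear : linear mpi.
Proof. by move=> a u v; rewrite mpi_is_additive mpiZ. Qed.

HB.instance Definition _ := GRing.isLinear.Build K V mquot *:%R mpi mpi_is_linear.

End ModuleQuotient.

(* Restriction of scalars along K -> A. *)
Section RestrictScalars.
Variables (K : comNzRingType) (A : comAlgType K) (V : lmodType A).

Definition restr : Type := V.
HB.instance Definition _ := GRing.Zmodule.on restr.

Definition restr_scale (k : K) (v : restr) : restr := k%:A *: (v : V).

Lemma restr_scaleA a b v : restr_scale a (restr_scale b v) = restr_scale (a * b) v.
Proof. by rewrite /restr_scale scalerA -scalerAl mul1r scalerA. Qed.

Lemma restr_scale1 : left_id 1 restr_scale.
Proof. by move=> v; rewrite /restr_scale !scale1r. Qed.

Lemma restr_scaleDr : right_distributive restr_scale +%R.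
Proof. by move=> a u v; rewrite /restr_scale -scalerDr. Qed.

Lemma restr_scaleDl v : {morph restr_scale^~ v : a b / a + b}.
Proof. by move=> a b; rewrite /restr_scale scalerDl (scalerDl (v : V)). Qed.

HB.instance Definition _ := GRing.Zmodule_isLmodule.Build K restr
  restr_scaleA restr_scale1 restr_scaleDr restr_scaleDl.
End RestrictScalars.

(* Kaehler differentials of A over K: the free A-module on the symbols db,
   b in A, modulo additivity, the Leibniz rule and d(K) = 0. *)
Section Kahler.
Variables (K : comNzRingType) (A : comAlgType K).

Definition kahler_rel : set {malg A[A]} := [set v |
  [\/ exists a b : A, v = << a + b >> - << a >> - << b >>,
      exists a b : A, v = << a * b >> - a *: << b >> - b *: << a >>
    | exists k : K, v = << k%:A >> ]]%classic.

Definition kahler : Type := mquot kahler_rel.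
HB.instance Definition _ := GRing.Lmodule.on kahler.

Definition kd (a : A) : kahler := mpi kahler_rel << a >>.

Definition kahler_exact : set (restr kahler) := range kd.

Definition kahler_mod_exact : Type := mquot kahler_exact.
HB.instance Definition _ := GRing.Lmodule.on kahler_mod_exact.

(* the class of p dq *)
Definition kcls (p q : A) : kahler_mod_exact :=
  mpi kahler_exact (p *: kd q : kahler).
End Kahler.

(* Laurent polynomials, << n >> being t^n. *)
Section Laurent.
Variable K : comNzRingType.

Definition laurent : Type := {malg K[int]}.
HB.instance Definition _ := GRing.Lmodule.on laurent.
Implicit Types g : laurent.

Definition lmul g1 g2 : laurent :=
  \sum_(k1 <- msupp g1) \sum_(k2 <- msupp g2) << g1@_k1 * g2@_k2 *g k1 + k2 >>.

Lemma lmulw (d1 d2 : {fset int}) g1 g2 :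
  (msupp g1 `<=` d1)%fset -> (msupp g2 `<=` d2)%fset ->
  lmul g1 g2 =
    \sum_(k1 <- d1) \sum_(k2 <- d2) << g1@_k1 * g2@_k2 *g k1 + k2 >>.
Proof.
move=> le1 le2; rewrite /lmul (big_fset_incl _ le1) /=.
  apply/eq_bigr=> k1 _; apply/big_fset_incl => // k _ /mcoeff_outdom ->.
  by rewrite mulr0 monalgU0.
move=> k _ /mcoeff_outdom g1k.
by rewrite big1 => // k' _; rewrite g1k mul0r monalgU0.
Qed.

Lemma lmulC : commutative lmul.
Proof.
move=> g1 g2; rewrite /lmul exchange_big /=; apply/eq_bigr=> k2 _.
by apply/eq_bigr=> k1 _; rewrite mulrC addrC.
Qed.

Lemma lmulDl : left_distributive lmul +%R.
Proof.
move=> g1 g2 g.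
rewrite [in RHS](lmulw (fsubsetUl _ (msupp g2)) (fsubset_refl _)).
rewrite [in RHS](lmulw (fsubsetUr (msupp g1) _) (fsubset_refl _)).
rewrite (lmulw (msuppD_le _ _) (fsubset_refl _)).
rewrite -big_split /=; apply/eq_bigr=> k1 _.
rewrite -big_split /=; apply/eq_bigr=> k2 _.
by rewrite mcoeffD mulrDl monalgUD.
Qed.

Lemma lmulDr : right_distributive lmul +%R.
Proof. by move=> g g1 g2; rewrite lmulC lmulDl !(lmulC g). Qed.

Lemma lmul0 : left_zero 0 lmul.
Proof. by move=> g; rewrite /lmul msupp0 big_seq_fset0. Qed.

Lemma lmulr0 : right_zero 0 lmul.
Proof. by move=> g; rewrite lmulC lmul0. Qed.

Lemma lmulUU c1 c2 (k1 k2 : int) :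
  lmul << c1 *g k1 >> << c2 *g k2 >> = << c1 * c2 *g k1 + k2 >>.
Proof. by rewrite (lmulw msuppU_le msuppU_le) !big_seq_fset1 !mcoeffUU. Qed.

Lemma lmul_suml (I : Type) (s : seq I) (F : I -> laurent) g :
  lmul (\sum_(i <- s) F i) g = \sum_(i <- s) lmul (F i) g.
Proof. by rewrite (big_morph (lmul^~ g) (fun x y => lmulDl x y g) (lmul0 g)). Qed.

Lemma lmul_sumr (I : Type) (s : seq I) (F : I -> laurent) g :
  lmul g (\sum_(i <- s) F i) = \sum_(i <- s) lmul g (F i).
Proof. by rewrite (big_morph (lmul g) (lmulDr g) (lmulr0 g)). Qed.

Lemma lmulA : associative lmul.
Proof.
move=> g1 g2 g3; rewrite (monalgE g1).
rewrite (lmul_suml _ _ (lmul g2 g3)) (lmul_suml _ _ g2) (lmul_suml _ _ g3).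
apply: eq_bigr => k1 _; set U1 := << _ *g k1 >>; rewrite (monalgE g2).
rewrite (lmul_suml _ _ g3) !(lmul_sumr _ _ U1) (lmul_suml _ _ g3).
apply: eq_bigr => k2 _; set U2 := << _ *g k2 >>; rewrite (monalgE g3).
rewrite (lmul_sumr _ _ U2) (lmul_sumr _ _ U1) (lmul_sumr _ _ (lmul U1 U2)).
apply: eq_bigr => k3 _; rewrite {}/U1 {}/U2.
by rewrite !lmulUU mulrA addrA.
Qed.

Lemma lmul1 : left_id (<< 0 >> : laurent) lmul.
Proof.
move=> g; rewrite [in LHS](monalgE g) lmul_sumr [RHS]monalgE.
by apply/eq_bigr => k _; rewrite lmulUU mul1r add0r.
Qed.

Lemma laurent1_neq0 : (<< 0 >> : laurent) != 0.
Proof. by rewrite monalgU_eq0 oner_neq0. Qed.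

HB.instance Definition _ := GRing.Zmodule_isComNzRing.Build laurent
  lmulA lmulC lmul1 lmulDl laurent1_neq0.

Lemma lscaleE (c : K) g : c *: g = lmul << c *g 0 >> g.
Proof.
rewrite [in RHS](monalgE g) lmul_sumr [LHS]malgZ_def.
by apply: eq_bigr => k _; rewrite lmulUU add0r.
Qed.

Lemma lscaleAl (c : K) (g1 g2 : laurent) : c *: (g1 * g2) = (c *: g1) * g2.
Proof. by rewrite !lscaleE [LHS]lmulA. Qed.

HB.instance Definition _ := GRing.Lmodule_isLalgebra.Build K laurent lscaleAl.
HB.instance Definition _ := GRing.Lalgebra_isComAlgebra.Build K laurent.
End Laurent.

(* Stated over an abstract ring, where ring is fast. *)
Section QuadraticExtension.
Variables (L : comNzRingType) (P : L).
Let mul (x y : L * L) := (x.1 * y.1 + P * (x.2 * y.2), x.1 * y.2 + x.2 * y.1).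

Lemma quad_mulA : associative mul.
Proof. by move=> x y z; congr pair => /=; ring. Qed.
Lemma quad_mulC : commutative mul.
Proof. by move=> x y; congr pair => /=; ring. Qed.
Lemma quad_mul1 : left_id (1, 0) mul.
Proof. by case=> x y; congr pair => /=; ring. Qed.
Lemma quad_mulDl : left_distributive mul +%R.
Proof. by move=> x y z; congr pair => /=; ring. Qed.
End QuadraticExtension.

(* C[t,t^-1,u | u^2 = t^4 - 2 c t^2 + 1]; Djkm (p, q) is p + q u.  A record
   rather than a bare product, whose ring structure is the componentwise one. *)
Record djkm_ring (K : comNzRingType) (c : K) : predArgType :=
  Djkm { djkm_val : (laurent K * laurent K)%type }.
Arguments Djkm {K c} _.

Section DJKMRing.
Variables (K : comNzRingType) (c : K).
Local Notation djkm_ring := (djkm_ring c).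
Local Notation Djkm := (@Djkm K c).

Definition djkm_poly : {poly K} := 'X^4 - (2 * c) *: 'X^2 + 1.

Definition laurent_t : laurent K := << 1%:Z >>.
Definition laurent_P : laurent K :=
  laurent_t ^+ 4 - (2 * c) *: laurent_t ^+ 2 + 1.

HB.instance Definition _ := [isNew for @djkm_val K c].
HB.instance Definition _ := [Choice of djkm_ring by <:].
Implicit Types x y : djkm_ring.

Definition djkm_add x y := Djkm (djkm_val x + djkm_val y).
Definition djkm_opp x := Djkm (- djkm_val x).
Definition djkm_scale (k : K) x := Djkm (k *: djkm_val x).
Definition djkm_mul x y : djkm_ring :=
  let: (p, q) := djkm_val x in let: (p', q') := djkm_val y in
  Djkm (p * p' + laurent_P * (q * q'), p * q' + q * p').

Lemma djkm_mulE x y : djkm_mul x y =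
  Djkm ((djkm_val x).1 * (djkm_val y).1 +
          laurent_P * ((djkm_val x).2 * (djkm_val y).2),
        (djkm_val x).1 * (djkm_val y).2 + (djkm_val x).2 * (djkm_val y).1).
Proof. by case: x y => [[a b]] [[a' b']]. Qed.

Lemma djkm_addA : associative djkm_add.
Proof. by move=> x y z; rewrite /djkm_add addrA. Qed.
Lemma djkm_addC : commutative djkm_add.
Proof. by move=> x y; rewrite /djkm_add addrC. Qed.
Lemma djkm_add0 : left_id (Djkm 0) djkm_add.
Proof. by case=> x; rewrite /djkm_add add0r. Qed.
Lemma djkm_addN : left_inverse (Djkm 0) djkm_opp djkm_add.
Proof. by case=> x; rewrite /djkm_add addNr. Qed.

HB.instance Definition _ := GRing.isZmodule.Build djkm_ring
  djkm_addA djkm_addC djkm_add0 djkm_addN.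

Lemma djkm_scaleA a b x :
  djkm_scale a (djkm_scale b x) = djkm_scale (a * b) x.
Proof. by rewrite /djkm_scale scalerA. Qed.
Lemma djkm_scale1 : left_id 1 djkm_scale.
Proof. by case=> x; rewrite /djkm_scale scale1r. Qed.
Lemma djkm_scaleDr : right_distributive djkm_scale +%R.
Proof. by move=> a x y; rewrite /djkm_scale scalerDr. Qed.
Lemma djkm_scaleDl x : {morph djkm_scale^~ x : a b / a + b}.
Proof. by move=> a b; rewrite /djkm_scale scalerDl. Qed.

HB.instance Definition _ := GRing.Zmodule_isLmodule.Build K djkm_ring
  djkm_scaleA djkm_scale1 djkm_scaleDr djkm_scaleDl.

Lemma djkm_mulA : associative djkm_mul.
Proof. by move=> x y z; rewrite !djkm_mulE; congr Djkm; exact: quad_mulA. Qed.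
Lemma djkm_mulC : commutative djkm_mul.
Proof. by move=> x y; rewrite !djkm_mulE; congr Djkm; exact: quad_mulC. Qed.
Lemma djkm_mul1 : left_id (Djkm (1, 0)) djkm_mul.
Proof. by case=> [[a b]]; rewrite !djkm_mulE; congr Djkm; exact: quad_mul1. Qed.
Lemma djkm_mulDl : left_distributive djkm_mul +%R.
Proof. by move=> x y z; rewrite !djkm_mulE; congr Djkm; exact: quad_mulDl. Qed.
Lemma djkm_one_neq0 : Djkm (1, 0) != 0.
Proof.
by apply/eqP => /(congr1 (fun x => (djkm_val x).1)); apply/eqP/oner_neq0.
Qed.

HB.instance Definition _ := GRing.Zmodule_isComNzRing.Build djkm_ring
  djkm_mulA djkm_mulC djkm_mul1 djkm_mulDl djkm_one_neq0.

Lemma djkm_scaleAl (k : K) x y : k *: (x * y) = (k *: x) * y.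
Proof.
case: x y => [[a b]] [[a' b']]; congr (Djkm (_, _)).
  by rewrite scalerDr -!scalerAl -scalerAr.
by rewrite scalerDr -!scalerAl.
Qed.

HB.instance Definition _ := GRing.Lmodule_isLalgebra.Build K djkm_ring djkm_scaleAl.
HB.instance Definition _ := GRing.Lalgebra_isComAlgebra.Build K djkm_ring.

(* t^m u^s *)
Definition djkm_tu (s : bool) (m : int) : djkm_ring :=
  Djkm (if s then (0, << m >>) else (<< m >>, 0)).
End DJKMRing.

(* sl(2) tensor A, in coordinates: (a, b, d) is e (x) a + f (x) b + h (x) d. *)
Section SL2.
Variables (K : comNzRingType) (A : comAlgType K).

Definition sl2 : Type := (A * A * A)%type.
HB.instance Definition _ := GRing.Lmodule.on sl2.

Definition sl2_e (a : A) : sl2 := (a, 0, 0).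
Definition sl2_f (a : A) : sl2 := (0, a, 0).
Definition sl2_h (a : A) : sl2 := (0, 0, a).

Definition sl2_bracket (x y : sl2) : sl2 :=
  let: (a, b, d) := x in let: (a', b', d') := y in
  ((d * a' - a * d') *+ 2, (b * d' - d * b') *+ 2, a * b' - b * a').

(* the class of the sum of (x_i, y_j) p_i dq_j, where x = sum of x_i (x) p_i,
   y = sum of y_j (x) q_j, and (e,f) = 1, (h,h) = 2 *)
Definition sl2_cocycle (x y : sl2) : kahler_mod_exact A :=
  let: (a, b, d) := x in let: (a', b', d') := y in
  kcls a b' + kcls b a' + kcls d d' *+ 2.

Definition sl2_mx (x : sl2) : 'M[A]_2 :=
  let: (a, b, d) := x in
  \matrix_(i, j) (if i == 0 then (if j == 0 then d else a)
                  else (if j == 0 then b else - d)).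

Lemma sl2_bracket_mx x y :
  sl2_mx (sl2_bracket x y) = sl2_mx x *m sl2_mx y - sl2_mx y *m sl2_mx x.
Proof.
case: x => [[a b] d]; case: y => [[a' b'] d'].
apply/matrixP => i j; rewrite !mxE !big_ord_recl !big_ord0 !mxE.
by case: i => -[|[|//]] ?; case: j => -[|[|//]] ? /=; ring.
Qed.
End SL2.

(* (sl(2) (x) A) + Omega^1_A/dA *)
Section CentralExtension.
Variables (K : comNzRingType) (A : comAlgType K).

Definition sl2_uce : Type := (sl2 A * kahler_mod_exact A)%type.
HB.instance Definition _ := GRing.Lmodule.on sl2_uce.

Definition uce_bracket (x y : sl2_uce) : sl2_uce :=
  (sl2_bracket x.1 y.1, sl2_cocycle x.1 y.1).
End CentralExtension.

Section DJKMAlgebra.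
Variables (K : comNzRingType) (c : K).

Definition djkm : Type := sl2_uce (djkm_ring c).
HB.instance Definition _ := GRing.Lmodule.on djkm.

Definition djkm_bracket : djkm -> djkm -> djkm := @uce_bracket K (djkm_ring c).

(* s = false for x_m, s = true for x^1_m *)
Definition djkm_e (s : bool) (m : int) : djkm := (sl2_e (djkm_tu c s m), 0).
Definition djkm_f (s : bool) (m : int) : djkm := (sl2_f (djkm_tu c s m), 0).
Definition djkm_h (s : bool) (m : int) : djkm := (sl2_h (djkm_tu c s m), 0).

Let t := djkm_tu c false 1.
Definition omega0 : djkm := (0, kcls (djkm_tu c false (-1)) t).
(* omega_{-k} *)
Definition omegaN (k : nat) : djkm := (0, kcls (djkm_tu c true (- k%:Z)) t).
End DJKMAlgebra.

(* C[x] (x) C[y] (x) V *)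
Section Fock.
Variable K : comNzRingType.

(* inl (s, n) is x_n (s = false) or x^1_n (s = true);
   inr (s, k) is y_{-k-1} or y^1_{-k-1}. *)
Definition fvar : Type := ((bool * int) + (bool * nat))%type.
HB.instance Definition _ := Choice.on fvar.
Definition xvar (s : bool) (n : int) : fvar := inl (s, n).
(* for n < 0 only *)
Definition yvar (s : bool) (n : int) : fvar := inr (s, `|n|.-1%N).

Definition fpoly : Type := {malg K[{cmonom fvar}]}.
HB.instance Definition _ := GRing.ComAlgebra.on fpoly.

Definition fpX (i : fvar) : fpoly := << ucm i >>.
Definition fpder (i : fvar) (p : fpoly) : fpoly :=
  \sum_(m <- msupp p) << p@_m *+ m i *g divcm m (ucm i) >>.

(* (p, q) is p (x) v_0 + q (x) v_1. *)
Definition fock : Type := (fpoly * fpoly)%type.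
HB.instance Definition _ := GRing.Lmodule.on fock.

Definition fmulX (i : fvar) : fock -> fock := fun w => (fpX i * w.1, fpX i * w.2).
Definition fder (i : fvar) : fock -> fock := fun w => (fpder i w.1, fpder i w.2).

(* b v_0 = mu v_0 + nu v_1 and b v_1 = vk v_0 + mu v_1 *)
Definition fB (mu nu vk : K) : fock -> fock := fun w =>
  (mu *: w.1 + vk *: w.2, nu *: w.1 + mu *: w.2).
End Fock.

(* Formal series in z^{+-1} with operator coefficients: A k is the coefficient
   of z^k.  Sums and scalar multiples are the pointwise ones. *)
Section Fields.
Variables (K : comNzRingType) (W : lmodType K).

Definition opfield : Type := int -> W -> W.
HB.instance Definition _ := GRing.Lmodule.on opfield.
Implicit Types A B : opfield.

(* sum_n a_n z^{-n-1} and sum_n a_n z^{-n} *)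
Definition series1 (a : int -> W -> W) : opfield := fun k => a (- k - 1).
Definition series0 (a : int -> W -> W) : opfield := fun k => a (- k).

(* Product of two series at the same z.  fsbig returns 0 on a family of
   infinite support, so fprod is meaningful only when fprod_ok holds. *)
Definition fprod A B : opfield := fun k w => \sum_(i \in [set: int]) A i (B (k - i) w).
Definition fprod_ok A B : Prop := forall k w,
  finite_set [set i : int | A i (B (k - i) w) != 0]%classic.

Definition fpolymul (p : {poly K}) A : opfield :=
  fun k w => \sum_(i < size p) p`_i *: A (k - i%:Z) w.

Definition fderz A : opfield := fun k w => (k + 1)%:~R *: A (k + 1) w.

(* A series a with a decomposition a = a_+ + a_-, represented by (a_+, a_-). *)
Definition split_field : Type := (opfield * opfield)%type.
Definition whole (a : split_field) : opfield := a.1 + a.2.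

Definition nord (a : split_field) B : opfield := fprod a.1 B + fprod B a.2.
Definition nord_ok (a : split_field) B : Prop :=
  fprod_ok a.1 B /\ fprod_ok B a.2.

Definition nord2 (a b : split_field) : opfield := nord a (whole b).
Definition nord3 (a b d : split_field) : opfield := nord a (nord2 b d).
End Fields.

(* The superscript 1 is the boolean s; r = false and r = true stand for
   r = 0 and r = 1. *)
Section FreeFields.
Variables (K : comNzRingType) (r : bool) (c : K).
Local Notation W := (fock K).

Definition aop (s : bool) (n : int) : W -> W :=
  if ~~ r && (0 <= n) then fder (xvar s n) else fmulX (xvar s n).

Definition asop (s : bool) (n : int) : W -> W :=
  if ~~ r && (n <= 0) then fmulX (xvar s (- n)) else - fder (xvar s (- n)).

Definition alpha (s : bool) : split_field W :=
  (series1 (fun n => if r || (n < 0) then aop s n else 0),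
   series1 (fun n => if r || (n < 0) then 0 else aop s n)).

Definition alphas (s : bool) : split_field W :=
  (series0 (fun n => if ~~ r && (n <= 0) then asop s n else 0),
   series0 (fun n => if ~~ r && (n <= 0) then 0 else asop s n)).

(* The Heisenberg modes, representing b_n = h (x) t^n, b^1_n = h (x) t^n u, at
   level 1_0 = kappa0.  As (h,h) = 2 and, modulo exact forms and the classes
   omega_{-k}, t^m d(t^n) = n delta_{m+n,0} omega_0 and
     t^m u d(t^n u) = ((n+2) delta_{m+n,-4} - 2c(n+1) delta_{m+n,-2}
                       + n delta_{m+n,0}) omega_0,
   their commutators have to be
     [b_m, b_n] = 2 n delta_{m+n,0} kappa0,     [b_m, b^1_n] = 0,
     [b^1_m, b^1_n] = 2 ((n+2) delta_{m+n,-4} - 2c(n+1) delta_{m+n,-2}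
                         + n delta_{m+n,0}) kappa0,
   which fixes the level, the signs and the coefficients below.  In the
   literature one finds the formulas with the level of the full representation
   instead of kappa0, opposite signs in b^1_n and 2c instead of 4c in b^1_0;
   these do not satisfy the relations. *)
Definition bop (lam kappa0 : K) (n : int) : W -> W := fun w =>
  if n < 0 then fmulX (yvar false n) w
  else if n == 0 then lam *: w
  else (- (2 * n%:~R) * kappa0) *: fder (yvar false (- n)) w.

Definition b1op (mu nu vk kappa0 : K) (n : int) : W -> W := fun w =>
  let D (k : int) := kappa0 *: fder (yvar true k) w in
  if n < 0 then
    fmulX (yvar true n) w - D (- 3) *+ (n == - 1) + D (- 1) *+ (n == - 3)
  else if n == 0 then
    - (4 *: D (- 4)) + (4 * c) *: D (- 2) + fB mu nu vk w
  else - ((2 * (n + 2)%:~R) *: D (- n - 4))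
       + (4 * c * (n + 1)%:~R) *: D (- n - 2)
       - (2 * n%:~R) *: D (- n).

Definition beta (lam kappa0 : K) : opfield W := series1 (bop lam kappa0).
Definition beta1 (mu nu vk kappa0 : K) : opfield W :=
  series1 (b1op mu nu vk kappa0).
End FreeFields.

Section Representation.
Variables (K : comNzRingType) (c : K).
Local Notation W := (fock K).

Definition is_representation (tau : djkm c -> W -> W) : Prop :=
  (forall g, linear (tau g)) /\
  (forall g g' w,
     tau (djkm_bracket g g') w = tau g (tau g' w) - tau g' (tau g w)).
End Representation.

(* The list of products whose local finiteness is needed for the formulas of
   tau below to make sense. *)
Definition fields_ok (K : comNzRingType) (r : bool) (b b1 : opfield (fock K)) :=
  let al := alpha K r in let as_ := alphas K r in
  [/\ forall s s', nord_ok (al s) (whole (as_ s')),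
      forall s s', nord_ok (as_ s) (whole (as_ s')),
      forall s s' s'', nord_ok (al s) (nord2 (as_ s') (as_ s'')),
      forall s, fprod_ok b (whole (as_ s))
    & forall s, fprod_ok b1 (whole (as_ s))].

Definition djkm_formulas (K : fieldType) (r : bool) (c chi0 : K)
    (b b1 : opfield (fock K)) (tau : djkm c -> fock K -> fock K) : Prop :=
  let a := alpha K r false in let a1 := alpha K r true in
  let s := alphas K r false in let s1 := alphas K r true in
  let P := djkm_poly c in
  (forall k : nat, (1 <= k <= 4)%N -> tau (omegaN c k) = 0) /\
  tau (omega0 c) = (fun w => chi0 *: w) /\
  series1 (fun m => tau (djkm_f c false m)) = - whole a /\
  series1 (fun m => tau (djkm_f c true m)) = - whole a1 /\
  series1 (fun m => tau (djkm_h c false m)) =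
    2 *: (nord2 a s + nord2 a1 s1) + b /\
  series1 (fun m => tau (djkm_h c true m)) =
    2 *: (nord2 a1 s + fpolymul P (nord2 a s1)) + b1 /\
  series1 (fun m => tau (djkm_e c false m)) =
    nord3 a s s + fpolymul P (nord3 a s1 s1) + 2 *: nord3 a1 s s1
    + fprod b (whole s) + fprod b1 (whole s1) + chi0 *: fderz (whole s) /\
  series1 (fun m => tau (djkm_e c true m)) =
    nord3 a1 s s
    + fpolymul P (nord3 a1 s1 s1 + 2 *: nord3 a s s1)
    + fprod b1 (whole s) + fpolymul P (fprod b (whole s1))
    + chi0 *: (fpolymul P (fderz (whole s1))
               + 2^-1 *: fpolymul P^`() (whole s1)).

(* Main.v *)
Require Import Defs.
From HB Require Import structures.
From mathcomp Require Import all_boot all_order all_algebra.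
From mathcomp Require Import finmap complex.
From mathcomp Require Import boolp classical_sets functions cardinality fsbigop.
From mathcomp Require Import reals monalg ring zify.
(* so that fprod is the product of fields rather than the product of finite types *)
Require Import Defs.

Set Implicit Arguments.
Unset Strict Implicit.
Unset Printing Implicit Defensive.
Import Order.TTheory GRing.Theory Num.Theory.
Local Open Scope ring_scope.

(** Let A be the coordinate ring and P = t^4 - 2 c t^2 + 1, and let phi(p, q) be
the residue of p dq, that is the coefficient of omega_0 in its class.  The modes of
a pair such as e(z), e^1(z) are the values at t^m and t^m u of an operator e(p) that
depends linearly on p in A; the factors P(z) in the formulas are there because
u * u = P.  So one has to prove the bracket relations of sl(2) (x) A for operators
e(p), f(p), h(p) with p in A, the central terms being multiples of chi_0 phi.

The operators f(p) are minus the modes a(p) of alpha and alpha^1, and commute.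
Commuting a(q) with a normally ordered product contracts it with each alpha^* in turn,
whence
  [h(p), a(q)] = - 2 a(p q)  and  [e(p), a(q)] = - h(p q) - chi_0 phi(p, q);
the derivative terms of e and e^1 are what produces phi (amode_current_h,
amode_current_e).  The other three relations could be obtained from the products of
normally ordered products, but there is a shorter way.  Let C be the charge operator:
alpha lowers the charge by 1, alpha^* raises it by 1, beta preserves it.  An operator
that commutes with all a(q) and raises the charge by k >= 0 is 0, provided that, if
k = 0, it has no matrix coefficient between polynomials in the y alone
(commuting_vanish). By the Jacobi identity and the commutativity of A, the defect
[h(p), h(q)] - 2 chi_0 phi(p, q) commutes with all a(z). It has charge 0, so that it
remains to compute its matrix coefficients between polynomials in the y
(pi_current_h_comm): for the natural ordering the quadratic part of h does not
contribute and beta contributes the level kappa_0; for the usual ordering the double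
contractions of the two beta-gamma systems add 4. This is the origin of chi_0 =
kappa_0 + 4 delta_{r,0}. The defects
  [h(p), e(q)] - 2 e(p q)  and  [e(p), e(q)]
commute with all a(z) in turn, by the Jacobi identity and the relations already proved;
their charges are 1 and 2, so they vanish without any computation.

The center acts through the linear form on the Kaehler differentials modulo exact
forms with value phi(p, q) on the class of p dq; it exists because phi obeys the
Leibniz rule in its second argument and vanishes if the first is 1 (residue_kcls).  For
uniqueness, the values of tau on the generators are given by the formulas, and it
remains to see that omega_0, ..., omega_{-4} span the differentials modulo exact forms.
A bilinear g with the formal properties of (p, q) -> class of p dq is determined
by the vectors G_m = g(t^m u, t) and g(t^-1, t); the identity d(u^2) = 2 u du gives
  (m + 6) G_{m+3} - 2 c (m + 3) G_{m+1} + m G_{m-1} = 0,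
which computes all the G_m from those with -4 <= m <= -1 (g_recurrence, g_tu0).

The products in the formulas are locally finite because, on each vector, a creating
field has only nonnegative powers of z (usual ordering) or the fields on its
right are Laurent polynomials (natural ordering); see good_ok. *)

Local Notation "m1 \* m2" := (mmul m1 m2)
  (at level 40, left associativity).

(** * Linear maps as predicates *)

Section LinearPredicate.
Variables (K : comNzRingType) (U V : lmodType K) (f : U -> V).
Hypothesis fL : linear f.

Lemma lin0 : f 0 = 0.
Proof. by have := fL (-1) 0 0; rewrite scaleN1r addr0 oppr0 scaleN1r addNr. Qed.

Lemma linZ a u : f (a *: u) = a *: f u.
Proof. by rewrite -[a *: u]addr0 fL lin0 addr0. Qed.

Lemma linD u v : f (u + v) = f u + f v.
Proof. by rewrite -[u]scale1r fL !scale1r. Qed.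

Lemma linN u : f (- u) = - f u.
Proof. by rewrite -scaleN1r linZ scaleN1r. Qed.

Lemma linB u v : f (u - v) = f u - f v.
Proof. by rewrite linD linN. Qed.

Lemma linMn u n : f (u *+ n) = f u *+ n.
Proof. by rewrite -scaler_nat linZ scaler_nat. Qed.

Lemma lin_sum I (r : seq I) (P : pred I) (F : I -> U) :
  f (\sum_(i <- r | P i) F i) = \sum_(i <- r | P i) f (F i).
Proof. exact: (big_morph f linD lin0). Qed.

End LinearPredicate.

Section LinearCombinators.
Variable K : comNzRingType.

Lemma lin_comp (U V T : lmodType K) (f : V -> T) (g : U -> V) :
  linear f -> linear g -> linear (fun u => f (g u)).
Proof. by move=> fL gL a u v; rewrite gL fL. Qed.

Lemma lin_add (U V : lmodType K) (f g : U -> V) :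
  linear f -> linear g -> linear (fun u => f u + g u).
Proof. by move=> fL gL a u v; rewrite fL gL scalerDr addrACA. Qed.

Lemma lin_scale (U V : lmodType K) (k : K) (f : U -> V) :
  linear f -> linear (fun u => k *: f u).
Proof. by move=> fL a u v; rewrite fL scalerDr !scalerA mulrC. Qed.

Lemma lin_opp (U V : lmodType K) (f : U -> V) : linear f -> linear (fun u => - f u).
Proof. by move=> fL a u v; rewrite fL opprD scalerN. Qed.

Lemma lin_scalar (U V : lmodType K) (f : U -> K^o) (v : V) :
  linear f -> linear (fun u => (f u : K) *: v).
Proof. by move=> fL a u u'; rewrite fL scalerDl -scalerA. Qed.

Lemma lin_sum3 (U V : lmodType K) (f : U -> V) (u v y : U) : linear f ->
  f (u + v + y *+ 2) = f u + f v + f y *+ 2.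
Proof. by move=> fL; rewrite (linD fL (u + v)) (linD fL u) (linMn fL). Qed.

End LinearCombinators.

Section LinearForm.
Variables (K : comNzRingType) (W : lmodType K) (f : W -> K).
Hypothesis fL : forall a u v, f (a *: u + v) = a * f u + f v.
Let fKL : linear (f : W -> K^o) := fL.

Lemma form0 : f 0 = 0.
Proof. exact: (lin0 fKL). Qed.

Lemma formD u v : f (u + v) = f u + f v.
Proof. exact: (linD fKL). Qed.

Lemma formZ a u : f (a *: u) = a * f u.
Proof. exact: (linZ fKL). Qed.

Lemma formN u : f (- u) = - f u.
Proof. exact: (linN fKL). Qed.

Lemma formMn u n : f (u *+ n) = f u *+ n.
Proof. exact: (linMn fKL). Qed.

End LinearForm.

(** * Polynomials by their coefficients *)

Section PolynomialOperators.
Variable K : comNzRingType.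
Implicit Types (p q : fpoly K) (i j : fvar) (m : {cmonom fvar}).

Lemma divcmK m i : m i != 0%N -> divcm m (ucm i) \* ucm i = m.
Proof.
move=> mi; apply/eqP/cmP => j; rewrite cmM divcmE ucmE.
by case: eqP => [<-|_]; rewrite ?subn0 ?addn0 // subnK // lt0n.
Qed.

Lemma mulcmK m i : divcm (m \* ucm i) (ucm i) = m.
Proof. by apply/eqP/cmP => j; rewrite divcmE cmM ucmE addnK. Qed.

Lemma sum_msupp1 p m (P : pred {cmonom fvar}) (f : {cmonom fvar} -> K) :
    P =1 pred1 m -> (m \notin msupp p -> f m = 0) ->
  \sum_(k <- msupp p | P k) f k = f m.
Proof.
move=> Pm f0; rewrite (eq_bigl _ _ Pm).
case: (boolP (m \in msupp p)) => [ms|mNs].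
  exact: (fbig_pred1_inj (k := id)).
rewrite f0 // big_seq_cond big1 // => k /andP[ks /eqP kE].
by rewrite -kE ks in mNs.
Qed.

Lemma mcoeff_fpXM i p m :
  (fpX K i * p)@_m = if m i == 0%N then 0 else p@_(divcm m (ucm i)).
Proof.
rewrite (malgMEw (fsubset_refl _) (fsubset_refl _)) msuppU1 big_seq_fset1.
rewrite raddf_sum /=.
have coefE k : (<< (fpX K i)@_(ucm i) * p@_k *g (ucm i \* k) >> : fpoly K)@_m
    = if (ucm i \* k) == m then p@_k else 0.
  by rewrite mcoeffU mcoeffU1 eqxx mul1r; case: eqP.
under eq_bigr do rewrite coefE.
case: ifP => [/eqP mi0|/negbT mi].
  apply: big1 => k _; case: eqP => // /(congr1 (fun m : {cmonom fvar} => m i)).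
  by rewrite cmM ucmE eqxx mi0.
rewrite -big_mkcond /=.
apply: sum_msupp1 => [k /=|]; last exact: mcoeff_outdom.
apply/eqP/eqP => [<-|->].
  by rewrite (mulmC (ucm i)) mulcmK.
by rewrite (mulmC (ucm i)) divcmK.
Qed.

Lemma mcoeff_fpder i p m : (fpder i p)@_m = p@_(m \* ucm i) *+ (m i).+1.
Proof.
rewrite /fpder raddf_sum /=.
have coefE k : (<< p@_k *+ k i *g divcm k (ucm i) >> : fpoly K)@_m
    = if k == (m \* ucm i) then p@_k *+ (m i).+1 else 0.
  rewrite mcoeffU; case: (eqVneq (k i) 0%N) => [ki0|ki].
    rewrite ki0 mulr0n mul0rn; case: eqP => // kE.
    by move: ki0; rewrite kE cmM ucmE eqxx addn1.
  have -> : (divcm k (ucm i) == m) = (k == (m \* ucm i)).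
    by apply/eqP/eqP => [<-|->]; rewrite ?divcmK ?mulcmK.
  case: eqP => [->|_]; last by rewrite mulr0n.
  by rewrite cmM ucmE eqxx addn1 mulr1n.
under eq_bigr do rewrite coefE.
rewrite -big_mkcond /=.
by apply: sum_msupp1 => // mNs; rewrite mcoeff_outdom // mul0rn.
Qed.

End PolynomialOperators.

(** * Charge and the vanishing principle *)

Section Charge.
Implicit Types (m : {cmonom fvar}) (i : fvar).

Definition charge (wt : fvar -> int) m : int :=
  \sum_(i <- finsupp m) wt i *+ m i.

Lemma chargeEw wt m (d : {fset fvar}) : (finsupp m `<=` d)%fset ->
  charge wt m = \sum_(i <- d) wt i *+ m i.
Proof.
move=> le; rewrite /charge (big_fset_incl _ le) //.
by move=> i id; rewrite -cmE_neq0 negbK => /eqP ->.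
Qed.

Lemma chargeM wt m i : charge wt (m \* ucm i) = charge wt m + wt i.
Proof.
rewrite /charge mdomD; set d := (_ `|` _)%fset.
rewrite -/(charge wt m) (chargeEw wt (fsubsetUl _ _ : finsupp m `<=` d)%fset).
have id : i \in d by rewrite inE mdomU inE eqxx orbT.
under eq_bigr do rewrite cmM ucmE mulrnDr.
rewrite big_split /=; congr (_ + _).
rewrite (big_fsetD1 i id) /= eqxx big_seq big1 ?addr0 // => j.
by rewrite !inE => /andP[ji _]; rewrite eq_sym (negbTE ji).
Qed.

End Charge.

(** The Fock space seen through the coefficients cf e m of its vectors on the
monomials mon e m, with e indexing the basis of the two-dimensional factor.  Since
every operator is described by its effect on coefficients, all relations between
operators below are identities between scalars. *)
Record coefficient_model (K : numFieldType) (W : lmodType K)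
    (cf : bool -> {cmonom fvar} -> W -> K) (mon : bool -> {cmonom fvar} -> W)
    (X D : fvar -> W -> W) (C B : W -> W)
    (plus : pred (bool * int)) (wt : fvar -> int) (mu nu vk : K) : Prop :=
  CoefficientModel {
    model_linear : forall e m a u v, cf e m (a *: u + v) = a * cf e m u + cf e m v;
    model_inj : forall u v, (forall e m, cf e m u = cf e m v) -> u = v;
    model_mon : forall e e' m m',
      cf e m (mon e' m') = ((e == e') && (m == m'))%:R;
    model_span : forall w, exists s : seq (K * (bool * {cmonom fvar})),
      w = \sum_(p <- s) p.1 *: mon p.2.1 p.2.2;
    model_X : forall e m i w,
      cf e m (X i w) = if m i == 0%N then 0 else cf e (divcm m (ucm i)) w;
    model_D : forall e m i w,
      cf e m (D i w) = cf e (m \* ucm i) w *+ (m i).+1;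
    model_wt : forall i, wt i =
      if i is inl k then (if plus k then 1 else -1) else 0;
    model_C : forall e m w, cf e m (C w) = (charge wt m)%:~R * cf e m w;
    model_B : forall e m w, cf e m (B w) =
      (if e then nu else mu) * cf false m w + (if e then mu else vk) * cf true m w
  }.

Section CoefficientModelTheory.
Variables (K : numFieldType) (W : lmodType K).
Variables (cf : bool -> {cmonom fvar} -> W -> K) (mon : bool -> {cmonom fvar} -> W).
Variables (X D : fvar -> W -> W) (C B : W -> W).
Variables (plus : pred (bool * int)) (wt : fvar -> int) (mu nu vk : K).
Hypothesis M : coefficient_model cf mon X D C B plus wt mu nu vk.
Implicit Types (m : {cmonom fvar}) (i j : fvar) (e : bool) (u v w : W).

Let cf_lin := model_linear M.
Let cf_inj := model_inj M.
Let cf_mon := model_mon M.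
Let mon_span := model_span M.
Let cfX := model_X M.
Let cfD := model_D M.
Let wtE := model_wt M.
Let cfC := model_C M.
Let cfB := model_B M.
Let cf0 e m := form0 (cf_lin e m).
Let cfDD e m := formD (cf_lin e m).
Let cfZ e m := formZ (cf_lin e m).
Let cfMn e m := formMn (cf_lin e m).

Lemma X_linear i : linear (X i).
Proof.
move=> a u v; apply: cf_inj => e m; rewrite cf_lin !cfX.
by case: eqP => _; rewrite ?cf_lin // mulr0 addr0.
Qed.

Lemma D_linear i : linear (D i).
Proof.
by move=> a u v; apply: cf_inj => e m; rewrite cf_lin !cfD cf_lin mulrnDl mulrnAr.
Qed.

Lemma D_comm i j w : D i (D j w) = D j (D i w).
Proof.
apply: cf_inj => e m; rewrite !cfD !cmM !ucmE -!mulrnA.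
rewrite -mulmA (mulmC (ucm i)) mulmA (eq_sym i j); congr (_ *+ _).
by case: eqP => [->|_]; rewrite ?addn0 mulnC.
Qed.

Lemma X_comm i j w : X i (X j w) = X j (X i w).
Proof.
apply: cf_inj => e m; rewrite !cfX !divcmE !ucmE.
case: (eqVneq i j) => [->//|ij]; rewrite !subn0.
case: eqP => mi; case: eqP => mj //; congr (cf _ _ _).
by apply/eqP/cmP => k; rewrite !divcmE subnAC.
Qed.

Lemma DX i j w : D i (X j w) = w *+ (i == j) + X j (D i w).
Proof.
apply: cf_inj => e m; rewrite cfDD cfMn cfD !cfX cfD cmM ucmE divcmE ucmE.
case: (eqVneq i j) => [->|ij].
  rewrite addn1 /= mulcmK mulrS; case: eqP => [->//|/eqP mj].
  by rewrite divcmK // subn1 prednK // lt0n.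
rewrite addn0 mulr0n add0r subn0.
case: eqP => [|/eqP mj]; first by rewrite mul0rn.
congr (cf _ _ _ *+ _); apply/eqP/cmP => k.
rewrite divcmE !cmM divcmE !ucmE.
case: (eqVneq j k) => [<-|_]; last by rewrite !subn0.
by rewrite (negbTE ij) !addn0.
Qed.

Lemma X_mon e m i : X i (mon e m) = mon e (m \* ucm i).
Proof.
apply: cf_inj => e' m'; rewrite cfX !cf_mon.
case: eqP => [mi0|/eqP mi].
  rewrite (_ : m' == _ = false) ?andbF //; apply/negP => /eqP mE.
  by move: mi0; rewrite mE cmM ucmE eqxx addn1.
congr (_ && _)%:R; apply/eqP/eqP => [<-|->]; by rewrite ?divcmK ?mulcmK.
Qed.

Lemma D_mon e m i : D i (mon e m) = (m i)%:R *: mon e (divcm m (ucm i)).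
Proof.
apply: cf_inj => e' m'; rewrite cfD cfZ !cf_mon.
case: (eqVneq (m i) 0%N) => [mi0|mi].
  rewrite mi0 mul0r (_ : _ == m = false) ?andbF ?mul0rn //.
  by apply/negP => /eqP mE; move: mi0; rewrite -mE cmM ucmE eqxx addn1.
have -> : (m' \* ucm i == m) = (m' == divcm m (ucm i)).
  by apply/eqP/eqP => [<-|->]; rewrite ?divcmK ?mulcmK.
case: eqP => _ /=; last by rewrite mul0rn mulr0.
case: eqP => [->|_]; last by rewrite mul0rn mulr0.
by rewrite divcmE ucmE eqxx subn1 prednK ?lt0n // mulr1.
Qed.

Lemma linear_mon0 (f : W -> W) : linear f ->
  (forall e m, f (mon e m) = 0) -> forall w, f w = 0.
Proof.
move=> fL f0 w; have [s ->] := mon_span w.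
elim: s => [|p s IH]; first by rewrite big_nil (lin0 fL).
by rewrite big_cons fL f0 scaler0 add0r.
Qed.

Lemma mdeg_divcm m i : m i != 0%N -> mdeg m = (mdeg (divcm m (ucm i))).+1.
Proof. by move=> mi; rewrite -{1}(divcmK mi) mdegM mdegU addn1. Qed.

Lemma C_linear : linear C.
Proof.
by move=> a u v; apply: cf_inj => e m; rewrite cf_lin !cfC cf_lin mulrDr mulrCA.
Qed.

Lemma CX i w : C (X i w) = X i (C w) + (wt i)%:~R *: X i w.
Proof.
apply: cf_inj => e m; rewrite cfDD cfZ cfC !cfX.
case: eqP => [_|/eqP mi]; first by rewrite !mulr0 addr0.
by rewrite cfC -{1}(divcmK mi) chargeM intrD mulrDl.
Qed.

Lemma CD i w : C (D i w) = D i (C w) - (wt i)%:~R *: D i w.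
Proof.
apply: cf_inj => e m; rewrite -scaleNr cfDD cfZ cfC !cfD cfC chargeM intrD.
by rewrite mulrDl mulrnDl mulNr -!mulrnAr addrK.
Qed.

Lemma C_mon e m : C (mon e m) = (charge wt m)%:~R *: mon e m.
Proof.
apply: cf_inj => e' m'; rewrite cfC cfZ cf_mon.
by case: (eqVneq m' m) => [->//|_]; rewrite andbF !mulr0.
Qed.

Definition yonly m := forall k : bool * int, m (inl k) = 0%N.

Lemma charge_le0 m : (forall k, plus k -> m (inl k) = 0%N) ->
  charge wt m <= 0 /\ (charge wt m = 0 -> yonly m).
Proof.
move=> m0.
have term_le0 i : wt i *+ m i <= 0.
  rewrite wtE; case: i => [k|k]; last by rewrite mul0rn.
  case: ifP => [/m0 ->//|_]; by rewrite mulrn_wle0.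
split; first by apply: sumr_le0 => i _; exact: term_le0.
move=> charge0 k; apply/eqP; rewrite cmE_eq0; apply/negP => km.
have : charge wt m < 0.
  rewrite /charge (big_fsetD1 _ km) /= -[ltRHS]addr0; apply: ltr_leD.
    move: km; rewrite -cmE_neq0 wtE; case: ifP => [/m0 ->//|_ mk].
    by rewrite mulNrn oppr_lt0 pmulrn_lgt0 // lt0n.
  by apply: sumr_le0 => i _; exact: term_le0.
by rewrite charge0 ltxx.
Qed.

(** A monomial that occurs in a vector killed by all positive derivatives contains
no positive variable, hence has weight at most 0, and weight 0 only if it is a monomial
in the y. *)
Lemma charge_vanish (kap : int) u : 0 <= kap ->
    (forall k, plus k -> D (inl k) u = 0) -> C u = kap%:~R *: u ->
    (kap = 0 -> forall e m, yonly m -> cf e m u = 0) -> u = 0.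
Proof.
move=> kap_ge0 Du Cu u0; apply: cf_inj => e m; rewrite cf0.
apply: contrapT => /eqP cfN0.
have m0 k : plus k -> m (inl k) = 0%N.
  move=> /Du Dku; apply: contraNeq cfN0 => mk.
  have := congr1 (cf e (divcm m (ucm (inl k)))) Dku.
  by rewrite cfD cf0 divcmK // => /eqP; rewrite mulrn_eq0.
have [le0 charge0] := charge_le0 m0.
have : charge wt m = kap.
  have := congr1 (cf e m) Cu; rewrite cfC cfZ => /(mulIf cfN0) /eqP.
  by rewrite eqr_int => /eqP.
move=> chargeE; have kap0 : kap = 0 by apply: le_anti; rewrite kap_ge0 -chargeE le0.
by move/eqP: cfN0; apply; apply: u0 => //; apply: charge0; rewrite chargeE.
Qed.

(** The vanishing principle.  Multiplications by negative variables can be pulled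
out, so it is enough to treat the monomials in the positive variables and the y, whose
weight is nonnegative.  By induction on the degree the positive derivatives kill
the image of such a monomial, and its weight is still nonnegative: charge_vanish
applies. *)
Lemma commuting_vanish (F : W -> W) (kap : int) : linear F -> 0 <= kap ->
    (forall k w, ~~ plus k -> F (X (inl k) w) = X (inl k) (F w)) ->
    (forall k w, plus k -> F (D (inl k) w) = D (inl k) (F w)) ->
    (forall w, C (F w) = F (C w) + kap%:~R *: F w) ->
    (kap = 0 -> forall e e' m m', yonly m -> yonly m' ->
       cf e' m' (F (mon e m)) = 0) ->
  forall w, F w = 0.
Proof.
move=> FL kap_ge0 FX FD FC F0.
apply: linear_mon0 => // e m.
have [n] := ubnP (mdeg m); elim: n m => // n IH m; rewrite ltnS => degm.
case: (pselect (exists k, ~~ plus k /\ m (inl k) != 0%N)) => [[k [kN mk]]|noN].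
  rewrite -(divcmK mk) -X_mon FX // IH.
    exact: lin0 (X_linear _).
  by rewrite (leq_trans _ degm) // [leqRHS](mdeg_divcm mk).
have mN k : ~~ plus k -> m (inl k) = 0%N.
  by move=> kN; apply/eqP; apply: contra_notT noN => mk; exists k.
have charge_ge0 : 0 <= charge wt m.
  apply: sumr_ge0 => i _; rewrite wtE; case: i => [k|k]; last by rewrite mul0rn.
  by case: ifPn => [_|/mN -> //]; rewrite mulrn_wge0.
apply: (@charge_vanish (charge wt m + kap)).
- exact: addr_ge0.
- move=> k kP; rewrite -FD // D_mon (linZ FL).
  case: (eqVneq (m (inl k)) 0%N) => [->|mk]; first by rewrite scale0r.
  by rewrite IH ?scaler0 // (leq_trans _ degm) // [leqRHS](mdeg_divcm mk).
- by rewrite FC C_mon (linZ FL) -scalerDl -intrD.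
- move=> /eqP; rewrite paddr_eq0 // => /andP[/eqP charge0 /eqP kap0] e' m' ym'.
  apply: F0 => // k; apply/eqP; case: (boolP (plus k)) => [kP|/mN -> //].
  apply: contraT => mk.
  have km : inl k \in finsupp m by rewrite -cmE_neq0.
  suff : 0 < charge wt m by rewrite charge0 ltxx.
  rewrite /charge (big_fsetD1 _ km) /= ltr_wpDr //.
    apply: sumr_ge0 => i _; rewrite wtE; case: i => [j|j]; last by rewrite mul0rn.
    by case: ifPn => [_|/mN -> //]; rewrite mulrn_wge0.
  by rewrite wtE kP pmulrn_lgt0 // lt0n.
Qed.

Lemma B_linear : linear B.
Proof. by move=> a u v; apply: cf_inj => e m; rewrite !(cfB, cf_lin); ring. Qed.

Lemma B_X i w : B (X i w) = X i (B w).
Proof.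
apply: cf_inj => e m; rewrite !(cfB, cfX).
by case: (m i == 0%N); rewrite // !mulr0 addr0.
Qed.

Lemma B_D i w : B (D i w) = D i (B w).
Proof. by apply: cf_inj => e m; rewrite !(cfB, cfD) mulrnDl !mulrnAr. Qed.

Lemma B_C w : C (B w) = B (C w).
Proof. by apply: cf_inj => e m; rewrite !(cfB, cfC); ring. Qed.

End CoefficientModelTheory.

(** * Locally finite sums and calculus of fields *)

Section LocallyFiniteSums.
Variables (K : comNzRingType) (W : lmodType K).
Implicit Types F G : int -> W.

Definition fin_supp F := finite_set [set i | F i != 0]%classic.
Definition fsum F : W := \sum_(i \in [set: int]) F i.

Lemma fin_supp_sub F G :
  (forall i, F i = 0 -> G i = 0) -> fin_supp F -> fin_supp G.
Proof. by move=> FG; apply: sub_finite_set => i /=; apply: contraNN => /eqP/FG/eqP. Qed.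

Lemma fin_suppD F G : fin_supp F -> fin_supp G -> fin_supp (fun i => F i + G i).
Proof.
move=> Ff Gf; apply: (@sub_finite_set _ _
  ([set i | F i != 0%R] `|` [set i | G i != 0%R])%classic).
  move=> i /=; case: (eqVneq (F i) 0) => [->|Fi _]; last by left.
  by rewrite add0r; right.
by rewrite finite_setU.
Qed.

Lemma int_range (a b i : int) : a <= i -> i <= b ->
  exists2 k : nat, i = a + k%:Z & (k <= `|b - a|)%N.
Proof. by move=> ai ib; exists `|i - a|%N; lia. Qed.

Lemma fin_supp_bounds F (a b : int) :
  (forall i, i < a -> F i = 0) -> (forall i, b < i -> F i = 0) -> fin_supp F.
Proof.
move=> Fa Fb; apply: (@sub_finite_set _ _
  [set` [seq a + k%:Z | k <- iota 0 `|b - a|.+1]]%classic); last first.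
  exact: finite_seq.
move=> i Fi; have [k -> kb] : exists2 k : nat, i = a + k%:Z & (k <= `|b - a|)%N.
  apply: int_range; rewrite leNgt; apply/negP => lti; move/eqP: Fi; apply; auto.
by apply/mapP; exists k => //; rewrite mem_iota.
Qed.

Lemma fsumE F (s : {fset int}) : (forall i, i \notin s -> F i = 0) ->
  fsum F = \sum_(i <- s) F i.
Proof. exact: fsbigTE. Qed.

Lemma fin_suppP F : fin_supp F -> exists s : {fset int}, forall i, i \notin s -> F i = 0.
Proof.
move=> Ff; exists (fset_set [set i | F i != 0]%classic) => i.
by rewrite in_fset_set // => /negP; rewrite inE /= => /negP; rewrite negbK => /eqP.
Qed.

Lemma fsumD F G : fin_supp F -> fin_supp G ->
  fsum (fun i => F i + G i) = fsum F + fsum G.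
Proof.
move=> /fin_suppP[s Fs] /fin_suppP[t Gt].
have sNU i : i \notin (s `|` t)%fset -> F i = 0 /\ G i = 0.
  by rewrite inE negb_or => /andP[/Fs -> /Gt ->].
rewrite !(@fsumE _ (s `|` t)%fset) => [|i /sNU[]|i /sNU[]|i /sNU[-> ->]] //.
  by rewrite big_split.
by rewrite addr0.
Qed.

Lemma fsum0 F : (forall i, F i = 0) -> fsum F = 0.
Proof. by move=> F0; rewrite (@fsumE _ fset0) ?big_seq_fset0. Qed.

Lemma fsum1 F j : (forall i, i != j -> F i = 0) -> fsum F = F j.
Proof.
move=> F0; rewrite (@fsumE _ [fset j]%fset) ?big_seq_fset1 // => i.
by rewrite inE; exact: F0.
Qed.

Lemma eq_fsum F G : F =1 G -> fsum F = fsum G.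
Proof. by move=> /funext ->. Qed.

End LocallyFiniteSums.

Lemma fsum_lin (K : comNzRingType) (W V : lmodType K) (f : W -> V) (F : int -> W) :
  linear f -> fin_supp F ->
  f (fsum F) = fsum (fun i => f (F i)).
Proof.
move=> fL /fin_suppP[s Fs].
rewrite (@fsumE _ _ F s) // (@fsumE _ _ (fun i => f (F i)) s) ?(lin_sum fL) // => i.
by move=> /Fs ->; exact: lin0 fL.
Qed.

Lemma fsumZ (K : comNzRingType) (W : lmodType K) (a : K) (F : int -> W) :
  fin_supp F -> a *: fsum F = fsum (fun i => a *: F i).
Proof.
move=> Ff; apply: (fsum_lin (f := fun w => a *: w)) => //.
by move=> b x y; rewrite scalerDr !scalerA mulrC.
Qed.

Section FieldCalculus.
Variables (K : comNzRingType) (W : lmodType K).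
Implicit Types (A B : opfield W) (X : W -> W).

Definition flinear A := forall k, linear (A k).

Lemma fprodE A B k w : fprod A B k w = fsum (fun i => A i (B (k - i) w)).
Proof. by []. Qed.

Lemma flinear_fprod A B : fprod_ok A B -> flinear A -> flinear B ->
  flinear (fprod A B).
Proof.
move=> AB AL BL k a u v; rewrite !fprodE.
rewrite (fsumZ _ (AB k u)) -fsumD; last exact: AB.
  by apply: eq_fsum => i; rewrite (BL _ a) (AL i a).
by apply: fin_supp_sub (AB k u) => i ->; rewrite scaler0.
Qed.

(** The relation [X, A(z)] = A'(z). *)
Definition fcomm X A A' := forall k w, X (A k w) = A k (X w) + A' k w.

Lemma fcomm_fprod X A A' B B' : linear X -> flinear A ->
    fprod_ok A B -> fprod_ok A' B -> fprod_ok A B' ->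
    fcomm X A A' -> fcomm X B B' ->
  fcomm X (fprod A B) (fprod A' B + fprod A B').
Proof.
move=> XL AL AB A'B AB' XA XB k w.
rewrite fprodE (fsum_lin XL (AB k w)).
have -> : (fprod A' B + fprod A B') k w = fprod A' B k w + fprod A B' k w by [].
rewrite !fprodE addrA addrAC -fsumD; [|exact: AB|exact: AB'].
rewrite -fsumD; [|exact: fin_suppD (AB k (X w)) (AB' k w)|exact: A'B].
by apply: eq_fsum => i; rewrite XA XB (linD (AL i)).
Qed.

Lemma fcommD X A A' B B' : linear X ->
  fcomm X A A' -> fcomm X B B' -> fcomm X (A + B) (A' + B').
Proof.
move=> XL XA XB k w.
have -> : (A + B) k w = A k w + B k w by [].
have -> : (A + B) k (X w) = A k (X w) + B k (X w) by [].
have -> : (A' + B') k w = A' k w + B' k w by [].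
by rewrite (linD XL) XA XB addrACA.
Qed.

Lemma fcommZ X A A' a : linear X -> fcomm X A A' -> fcomm X (a *: A) (a *: A').
Proof.
move=> XL XA k w.
have -> : (a *: A) k w = a *: A k w by [].
have -> : (a *: A) k (X w) = a *: A k (X w) by [].
have -> : (a *: A') k w = a *: A' k w by [].
by rewrite (linZ XL) XA scalerDr.
Qed.

Lemma fcomm_polymul X A A' p : linear X -> fcomm X A A' ->
  fcomm X (fpolymul p A) (fpolymul p A').
Proof.
move=> XL XA k w; rewrite /fpolymul (lin_sum XL) -big_split /=.
by apply: eq_bigr => i _; rewrite (linZ XL) XA scalerDr.
Qed.

Lemma fcomm_derz X A A' : linear X -> fcomm X A A' ->
  fcomm X (fderz A) (fderz A').
Proof. by move=> XL XA k w; rewrite /fderz (linZ XL) XA scalerDr. Qed.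

Lemma eq_fcomm X A A' B' : fcomm X A A' -> A' = B' -> fcomm X A B'.
Proof. by move=> XA <-. Qed.

Lemma flinearD A B : flinear A -> flinear B -> flinear (A + B).
Proof.
move=> AL BL k a u v; have E w : (A + B) k w = A k w + B k w by [].
by rewrite !E AL BL scalerDr addrACA.
Qed.

Lemma flinearZ A a : flinear A -> flinear (a *: A).
Proof.
move=> AL k b u v; have E w : (a *: A) k w = a *: A k w by [].
by rewrite !E AL scalerDr !scalerA mulrC.
Qed.

Lemma flinear_polymul A p : flinear A -> flinear (fpolymul p A).
Proof.
move=> AL k b u v; rewrite /fpolymul scaler_sumr -big_split /=.
by apply: eq_bigr => i _; rewrite AL scalerDr !scalerA mulrC.
Qed.

Lemma flinear_derz A : flinear A -> flinear (fderz A).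
Proof. by move=> AL k b u v; rewrite /fderz AL scalerDr !scalerA mulrC. Qed.

(** The series d z^j A(z), and the scalar series d z^j. *)
Definition fshift (d : K) (j : int) A : opfield W := fun k w => d *: A (k - j) w.
Definition fmono (d : K) (j : int) : opfield W :=
  fun k w => if k == j then d *: w else 0.

Lemma flinear_fshift d j A : flinear A -> flinear (fshift d j A).
Proof.
by move=> AL k a u v; rewrite /fshift AL scalerDr !scalerA mulrC.
Qed.

Lemma fprod_ok_shiftr A B d j : flinear A -> fprod_ok A B -> fprod_ok A (fshift d j B).
Proof.
move=> AL AB k w; apply: fin_supp_sub (AB (k - j) w) => i.
by rewrite /fshift (linZ (AL i)) addrAC => ->; rewrite scaler0.
Qed.

Lemma fprod_shiftr A B d j : flinear A -> fprod_ok A B ->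
  fprod A (fshift d j B) = fshift d j (fprod A B).
Proof.
move=> AL AB; apply/funext => k; apply/funext => w; rewrite /fshift !fprodE.
rewrite (fsumZ _ (AB (k - j) w)); apply: eq_fsum => i.
by rewrite (linZ (AL i)) addrAC.
Qed.

Lemma fprod_ok_shiftl A B d j : fprod_ok A B -> fprod_ok (fshift d j A) B.
Proof.
move=> AB k w.
have := AB (k - j) w => /fin_suppP[s As].
apply: (@sub_finite_set _ _ [set` [fset (i + j)%R | i in s]%fset]%classic);
  last exact: finite_fset.
move=> i /= Ai; apply/imfsetP; exists (i - j) => /=; last by rewrite subrK.
apply: contraNT Ai => /As E; rewrite /fshift.
by rewrite (_ : k - i = k - j - (i - j)) ?E ?scaler0 // opprB addrA subrK.
Qed.

Lemma fprod_shiftl A B d j : fprod_ok A B ->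
  fprod (fshift d j A) B = fshift d j (fprod A B).
Proof.
move=> AB; apply/funext => k; apply/funext => w; rewrite /fshift !fprodE.
rewrite (fsumZ _ (AB (k - j) w)) /fsum.
rewrite (reindex_fsbigT (fun i : int => i + j)) /=.
  apply: eq_fsbigr => i _; congr (_ *: _).
  by rewrite addrK opprD addrA addrAC.
by exists (fun i => i - j) => i; rewrite ?addrK ?subrK.
Qed.

Lemma fprod_ok_monol B d j : fprod_ok (fmono d j) B.
Proof.
move=> k w; apply: (@fin_supp_bounds _ _ _ j j) => i ij; rewrite /fmono.
  by rewrite lt_eqF.
by rewrite gt_eqF.
Qed.

Lemma fprod_monol B d j : fprod (fmono d j) B = fshift d j B.
Proof.
apply/funext => k; apply/funext => w; rewrite fprodE (@fsum1 _ _ _ j).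
  by rewrite /fmono eqxx.
by move=> i /negbTE ij; rewrite /fmono ij.
Qed.

Lemma fprod_ok_monor A d j : flinear A -> fprod_ok A (fmono d j).
Proof.
move=> AL k w; apply: (@fin_supp_bounds _ _ _ (k - j) (k - j)) => i ij; rewrite /fmono.
  by rewrite gt_eqF ?(lin0 (AL i)) // ltrBrDl -ltrBrDr.
by rewrite lt_eqF ?(lin0 (AL i)) // ltrBlDl -ltrBlDr.
Qed.

Lemma fprod_monor A d j : flinear A -> fprod A (fmono d j) = fshift d j A.
Proof.
move=> AL; apply/funext => k; apply/funext => w; rewrite fprodE.
rewrite (@fsum1 _ _ _ (k - j)) => [|i ij].
  by rewrite /fmono subKr eqxx (linZ (AL _)).
rewrite /fmono (_ : _ == j = false) ?(lin0 (AL i)) //.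
by apply: contraNF ij => /eqP <-; rewrite subKr.
Qed.

Lemma fprod_okDr A B B' : flinear A -> fprod_ok A B -> fprod_ok A B' ->
  fprod_ok A (B + B').
Proof.
move=> AL AB AB' k w; apply: fin_supp_sub (fin_suppD (AB k w) (AB' k w)) => i <-.
by rewrite -(linD (AL i)).
Qed.

Lemma fprod_okDl A A' B : fprod_ok A B -> fprod_ok A' B -> fprod_ok (A + A') B.
Proof. by move=> AB A'B k w; exact: fin_suppD (AB k w) (A'B k w). Qed.

Lemma fprodDr A B B' : flinear A -> fprod_ok A B -> fprod_ok A B' ->
  fprod A (B + B') = fprod A B + fprod A B'.
Proof.
move=> AL AB AB'; apply/funext => k; apply/funext => w.
have -> : (fprod A B + fprod A B') k w = fprod A B k w + fprod A B' k w by [].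
rewrite !fprodE -fsumD; [|exact: AB|exact: AB'].
by apply: eq_fsum => i; rewrite -(linD (AL i)).
Qed.

Lemma fprodDl A A' B : fprod_ok A B -> fprod_ok A' B ->
  fprod (A + A') B = fprod A B + fprod A' B.
Proof.
move=> AB A'B; apply/funext => k; apply/funext => w.
have -> : (fprod A B + fprod A' B) k w = fprod A B k w + fprod A' B k w by [].
by rewrite !fprodE -fsumD; [|exact: AB|exact: A'B].
Qed.

Section Nord.
Variables (a : split_field W) (B : opfield W).
Hypotheses (a1L : flinear a.1) (a2L : flinear a.2) (BL : flinear B).
Hypothesis ok : nord_ok a B.

Lemma flinear_nord : flinear (nord a B).
Proof. by apply: flinearD; apply: flinear_fprod => //; case: ok. Qed.

(** A scalar contraction of X with either half of a leaves B where it is, so that the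
Leibniz rule holds for the normally ordered product with nothing to reorder. *)
Lemma fcomm_nord X d1 d2 j B' : linear X ->
    fcomm X a.1 (fmono d1 j) -> fcomm X a.2 (fmono d2 j) ->
    nord_ok a B' -> fcomm X B B' ->
  fcomm X (nord a B) (fshift (d1 + d2) j B + nord a B').
Proof.
move=> XL X1 X2 [ok1 ok2] XB; have [ok1' ok2'] := ok.
apply: (@eq_fcomm _ _ (fshift d1 j B + fprod a.1 B'
   + (fprod B' a.2 + fshift d2 j B))).
  apply: fcommD => //.
    rewrite -fprod_monol; apply: fcomm_fprod => //.
    exact: fprod_ok_monol.
  rewrite -(fprod_monor _ _ BL); apply: fcomm_fprod => //.
  exact: fprod_ok_monor.
apply/funext => k; apply/funext => w.
rewrite /fshift /nord.
have E (A A' : opfield W) k' : (A + A') k' w = A k' w + A' k' w by [].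
by rewrite !E scalerDl [X in _ + X]addrC addrACA.
Qed.

Lemma fcomm_nord_scale X d d' : linear X ->
    fcomm X a.1 (d *: a.1) -> fcomm X a.2 (d *: a.2) -> fcomm X B (d' *: B) ->
  fcomm X (nord a B) ((d + d') *: nord a B).
Proof.
have sE d0 A : d0 *: A = fshift d0 0 A.
  by apply/funext => k; apply/funext => w; rewrite /fshift subr0.
rewrite !sE => XL X1 X2 XB; have [ok1 ok2] := ok.
apply: (@eq_fcomm _ _ ((fshift d 0 (fprod a.1 B) + fshift d' 0 (fprod a.1 B))
   + (fshift d' 0 (fprod B a.2) + fshift d 0 (fprod B a.2)))).
  apply: fcommD => //.
    rewrite -fprod_shiftl // -fprod_shiftr //; apply: fcomm_fprod => //.
    - exact: fprod_ok_shiftl.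
    - exact: fprod_ok_shiftr.
  rewrite -fprod_shiftl // -(fprod_shiftr _ _ BL) //; apply: fcomm_fprod => //.
  - exact: fprod_ok_shiftl.
  - exact: fprod_ok_shiftr.
apply/funext => k; apply/funext => w.
rewrite /fshift /nord.
have E (A A' : opfield W) k' : (A + A') k' w = A k' w + A' k' w by [].
by rewrite !E scalerDr !scalerDl [X in _ + X = _]addrC.
Qed.

End Nord.

Section NordLinear.
Variable a : split_field W.
Hypotheses (a1L : flinear a.1) (a2L : flinear a.2).

Lemma nord_ok_shift d j B : nord_ok a B -> nord_ok a (fshift d j B).
Proof. by case=> ok1 ok2; split; [exact: fprod_ok_shiftr|exact: fprod_ok_shiftl]. Qed.

Lemma nord_shift d j B : nord_ok a B ->
  nord a (fshift d j B) = fshift d j (nord a B).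
Proof.
case=> ok1 ok2; rewrite /nord fprod_shiftr // fprod_shiftl //.
apply/funext => k; apply/funext => w; rewrite /fshift.
have E (A A' : opfield W) k' : (A + A') k' w = A k' w + A' k' w by [].
by rewrite !E scalerDr.
Qed.

Lemma nord_ok_mono d j : nord_ok a (fmono d j).
Proof. by split; [exact: fprod_ok_monor|exact: fprod_ok_monol]. Qed.

Lemma nord_mono d j : nord a (fmono d j) = fshift d j (whole a).
Proof.
rewrite /nord fprod_monor // fprod_monol.
apply/funext => k; apply/funext => w; rewrite /fshift /whole.
have E (A A' : opfield W) k' : (A + A') k' w = A k' w + A' k' w by [].
by rewrite !E scalerDr.
Qed.

Lemma nord_okD B B' : flinear B -> flinear B' ->
  nord_ok a B -> nord_ok a B' -> nord_ok a (B + B').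
Proof.
by move=> BL BL' [? ?] [? ?]; split; [exact: fprod_okDr|exact: fprod_okDl].
Qed.

Lemma nordD B B' : nord_ok a B -> nord_ok a B' ->
  nord a (B + B') = nord a B + nord a B'.
Proof. by move=> [? ?] [? ?]; rewrite /nord fprodDr // fprodDl // addrACA. Qed.

End NordLinear.
End FieldCalculus.

(** * Local finiteness of products *)

Section Truncation.
Variables (K : comNzRingType) (W : lmodType K).
Implicit Types (A B : opfield W).

Definition lower A := forall w, exists N : int, forall k, k < N -> A k w = 0.
Definition upper A := forall w, exists N : int, forall k, N < k -> A k w = 0.

Lemma lower_range A (u : int -> W) (a : int) (n : nat) : lower A ->
  exists N : int, forall l k : int, a <= l -> l <= a + n%:Z -> k < N -> A k (u l) = 0.
Proof.
move=> lA; elim: n => [|n [N NA]].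
  have [N NA] := lA (u a); exists N => l k al la; rewrite (_ : l = a); last by lia.
  exact: NA.
have [N' NA'] := lA (u (a + n.+1%:Z)); exists (Num.min N N') => l k al la.
rewrite lt_min => /andP[kN kN'].
case: (ltrP (a + n%:Z) l) => [ltl|lel]; last exact: NA.
by rewrite (_ : l = a + n.+1%:Z); [exact: NA'|lia].
Qed.

Lemma upper_range A (u : int -> W) (a : int) (n : nat) : upper A ->
  exists N : int, forall l k : int, a <= l -> l <= a + n%:Z -> N < k -> A k (u l) = 0.
Proof.
move=> uA; elim: n => [|n [N NA]].
  have [N NA] := uA (u a); exists N => l k al la; rewrite (_ : l = a); last by lia.
  exact: NA.
have [N' NA'] := uA (u (a + n.+1%:Z)); exists (Num.max N N') => l k al la.
rewrite gt_max => /andP[kN kN'].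
case: (ltrP (a + n%:Z) l) => [ltl|lel]; last exact: NA.
by rewrite (_ : l = a + n.+1%:Z); [exact: NA'|lia].
Qed.

Lemma bounds_range B w : lower B -> upper B -> exists (a : int) (n : nat),
  forall l, l < a \/ a + n%:Z < l -> B l w = 0.
Proof.
move=> lB uB; have [N NB] := lB w; have [M MB] := uB w.
by exists N, `|M - N|%N => l [/NB //|lt]; apply: MB; lia.
Qed.

Lemma fprod_ok_ann A B : flinear A -> lower B -> upper B -> fprod_ok A B.
Proof.
move=> AL lB uB k w; have [a [n B0]] := bounds_range w lB uB.
by apply: (@fin_supp_bounds _ _ _ (k - a - n%:Z) (k - a)) => i ik;
   rewrite B0 ?(lin0 (AL i)) //; lia.
Qed.

Lemma lower_ann A B : flinear A -> lower A -> lower B -> upper B ->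
  lower (fprod A B).
Proof.
move=> AL lA lB uB w; have [a [n B0]] := bounds_range w lB uB.
have [N NA] := lower_range (fun l => B l w) a n lA.
exists (N + a) => k kN; apply: fsum0 => i.
case: (ltrP (k - i) a) => [lt|le]; first by rewrite B0 ?(lin0 (AL i)) //; left.
case: (ltrP (a + n%:Z) (k - i)) => [lt|le'].
  by rewrite B0 ?(lin0 (AL i)) //; right.
by apply: NA => //; lia.
Qed.

Lemma upper_ann A B : flinear A -> upper A -> lower B -> upper B ->
  upper (fprod A B).
Proof.
move=> AL uA lB uB w; have [a [n B0]] := bounds_range w lB uB.
have [N NA] := upper_range (fun l => B l w) a n uA.
exists (N + a + n%:Z) => k kN; apply: fsum0 => i.
case: (ltrP (k - i) a) => [lt|le]; first by rewrite B0 ?(lin0 (AL i)) //; left.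
case: (ltrP (a + n%:Z) (k - i)) => [lt|le'].
  by rewrite B0 ?(lin0 (AL i)) //; right.
by apply: NA => //; lia.
Qed.

Lemma fprod_ok_cre A B : flinear A -> (forall k w, k < 0 -> A k w = 0) ->
  lower B -> fprod_ok A B.
Proof.
move=> AL A0 lB k w; have [N NB] := lB w.
apply: (@fin_supp_bounds _ _ _ 0 (k - N)) => i ik; first exact: A0.
by rewrite NB ?(lin0 (AL i)) //; lia.
Qed.

Lemma lower_cre A B : flinear A -> (forall k w, k < 0 -> A k w = 0) ->
  lower B -> lower (fprod A B).
Proof.
move=> AL A0 lB w; have [N NB] := lB w; exists N => k kN; apply: fsum0 => i.
case: (ltrP i 0) => [lt|le]; first exact: A0.
by rewrite NB ?(lin0 (AL i)) //; lia.
Qed.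

Variable r : bool.

(** For the usual ordering a field yields a Laurent series on each vector and
creating fields have no negative power of z.  For the natural ordering creating fields
are unbounded in both directions, but the fields to their right yield Laurent
polynomials.  The predicates good and creating cover both cases. *)
Definition good A := lower A /\ (r -> upper A).
Definition creating A := ~~ r -> forall k w, k < 0 -> A k w = 0.

Lemma good_ok A B : flinear A -> creating A -> good B -> fprod_ok A B.
Proof.
move=> AL cA [lB uB]; case: (boolP r) => [/uB|/cA A0]; first exact: fprod_ok_ann.
exact: fprod_ok_cre.
Qed.

Lemma good_ann A B : flinear A -> good A -> lower B -> upper B ->
  good (fprod A B).
Proof.
move=> AL [lA uA] lB uB; split; first exact: lower_ann.
by move=> /uA ?; exact: upper_ann.
Qed.

Lemma good_cre A B : flinear A -> creating A -> good A -> good B ->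
  good (fprod A B).
Proof.
move=> AL cA gA [lB uB]; case: (boolP r) => rE.
  by apply: good_ann => //; exact: uB.
split; last by rewrite (negbTE rE).
exact: lower_cre (cA rE) _.
Qed.

Lemma goodD A B : good A -> good B -> good (A + B).
Proof.
move=> [lA uA] [lB uB]; split.
  move=> w; have [N NA] := lA w; have [M MB] := lB w.
  exists (Num.min N M) => k; rewrite lt_min => /andP[kN kM].
  by have -> : (A + B) k w = A k w + B k w by []; rewrite NA // MB // addr0.
move=> rT w; have [N NA] := uA rT w; have [M MB] := uB rT w.
exists (Num.max N M) => k; rewrite gt_max => /andP[kN kM].
by have -> : (A + B) k w = A k w + B k w by []; rewrite NA // MB // addr0.
Qed.

End Truncation.

(** * Free fields *)

(** The modes of alpha that are derivations.  The modes of alpha^* that are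
multiplications are those by the variables with these indices, so that this is
also the set of positive variables of the vanishing principle. *)
Definition annihilating (r : bool) (n : int) := ~~ r && (0 <= n).

(** The multiplications x and derivations d used by the free fields, with the
charge operator: its signs are such that every mode of alpha lowers the charge
by 1 and every mode of alpha^* raises it by 1, whatever the ordering. *)
Record weyl_system (K : comNzRingType) (W : lmodType K) (r : bool)
    (x d : bool -> int -> W -> W) (C : W -> W) : Prop := WeylSystem {
  x_linear : forall s n, linear (x s n);
  d_linear : forall s n, linear (d s n);
  x_comm : forall s t n j w, x s n (x t j w) = x t j (x s n w);
  d_comm : forall s t n j w, d s n (d t j w) = d t j (d s n w);
  d_x : forall s t n j w,
    d s n (x t j w) = w *+ ((s == t) && (n == j)) + x t j (d s n w);
  d_locally_finite : forall w, exists N : int,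
    forall s n, N < `|n| -> d s n w = 0;
  charge_linear : linear C;
  charge_x : forall s n w,
    C (x s n w) = x s n (C w) + (if annihilating r n then 1 else -1) *: x s n w;
  charge_d : forall s n w,
    C (d s n w) = d s n (C w) - (if annihilating r n then 1 else -1) *: d s n w }.

Section FreeFields.
Variables (K : comNzRingType) (W : lmodType K) (r : bool).
Variables (x d : bool -> int -> W -> W) (C : W -> W).
Hypothesis WS : weyl_system r x d C.
Implicit Types (s t : bool) (n j : int) (w : W).

Let xL := x_linear WS.
Let dL := d_linear WS.
Let xC := x_comm WS.
Let dC := d_comm WS.
Let dx := d_x WS.
Let d_fin := d_locally_finite WS.
Let CL := charge_linear WS.
Let Cx := charge_x WS.
Let Cd := charge_d WS.
Local Notation annih := (annihilating r).

(** The modes a_n, a^*_n and the fields alpha, alpha^* over a Weyl system. *)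
Definition amode s n : W -> W := if ~~ r && (0 <= n) then d s n else x s n.
Definition asmode s n : W -> W :=
  if ~~ r && (n <= 0) then x s (- n) else - d s (- n).
Definition afield s : split_field W :=
  (series1 (fun n => if r || (n < 0) then amode s n else 0),
   series1 (fun n => if r || (n < 0) then 0 else amode s n)).
Definition asfield s : split_field W :=
  (series0 (fun n => if ~~ r && (n <= 0) then asmode s n else 0),
   series0 (fun n => if ~~ r && (n <= 0) then 0 else asmode s n)).

Lemma afield1E s k w : (afield s).1 k w = if annih (- k - 1) then 0 else x s (- k - 1) w.
Proof.
rewrite /= /series1 /amode /annihilating.
have -> : (r || (- k - 1 < 0)) = ~~ (~~ r && (0 <= - k - 1)).
  by rewrite negb_and negbK -ltNge.
by case: (~~ r && _).
Qed.

Lemma afield2E s k w : (afield s).2 k w = if annih (- k - 1) then d s (- k - 1) w else 0.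
Proof.
rewrite /= /series1 /amode /annihilating.
have -> : (r || (- k - 1 < 0)) = ~~ (~~ r && (0 <= - k - 1)).
  by rewrite negb_and negbK -ltNge.
by case: (~~ r && _).
Qed.

Lemma asfield1E s k w : (asfield s).1 k w = if annih k then x s k w else 0.
Proof. by rewrite /= /series0 /asmode /annihilating oppr_le0 opprK; case: (~~ r && _). Qed.

Lemma asfield2E s k w : (asfield s).2 k w = if annih k then 0 else - d s k w.
Proof. by rewrite /= /series0 /asmode /annihilating oppr_le0 opprK; case: (~~ r && _). Qed.

Lemma wholeE (a : split_field W) k w : whole a k w = a.1 k w + a.2 k w.
Proof. by []. Qed.

Lemma whole_afield s k w : whole (afield s) k w = amode s (- k - 1) w.
Proof.
rewrite wholeE afield1E afield2E /amode -/(annih _).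
by case: (annih _); rewrite ?add0r ?addr0.
Qed.

Lemma afield1L s : flinear (afield s).1.
Proof.
by move=> k a u v; rewrite !afield1E; case: ifP => _; rewrite ?xL // scaler0 addr0.
Qed.
Lemma afield2L s : flinear (afield s).2.
Proof.
by move=> k a u v; rewrite !afield2E; case: ifP => _; rewrite ?dL // scaler0 addr0.
Qed.
Lemma asfield1L s : flinear (asfield s).1.
Proof.
by move=> k a u v; rewrite !asfield1E; case: ifP => _; rewrite ?xL // scaler0 addr0.
Qed.
Lemma asfield2L s : flinear (asfield s).2.
Proof.
move=> k a u v; rewrite !asfield2E; case: ifP => _; first by rewrite scaler0 addr0.
by rewrite dL opprD scalerN.
Qed.

Lemma afieldL s : flinear (whole (afield s)).
Proof. exact: flinearD (@afield1L s) (@afield2L s). Qed.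
Lemma asfieldL s : flinear (whole (asfield s)).
Proof. exact: flinearD (@asfield1L s) (@asfield2L s). Qed.

Lemma amodeL s n : linear (amode s n).
Proof. by rewrite /amode; case: ifP. Qed.

Lemma afield1_creating s : creating r (afield s).1.
Proof. by move=> rF k w k0; rewrite afield1E /annihilating rF ifT //=; lia. Qed.

Lemma asfield1_creating s : creating r (asfield s).1.
Proof. by move=> rF k w k0; rewrite asfield1E /annihilating rF ifF //=; lia. Qed.

Lemma afield2_lower s : lower (afield s).2.
Proof.
move=> w; have [N Nd] := d_fin w; exists (- `|N| - 1) => k kN.
by rewrite afield2E; case: ifP => // _; apply: Nd; lia.
Qed.

Lemma afield2_upper s : upper (afield s).2.
Proof.
move=> w; have [N Nd] := d_fin w; exists (`|N| + 1) => k kN.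
by rewrite afield2E; case: ifP => // _; apply: Nd; lia.
Qed.

Lemma asfield2_lower s : lower (asfield s).2.
Proof.
move=> w; have [N Nd] := d_fin w; exists (- `|N|) => k kN.
by rewrite asfield2E; case: ifP => // _; rewrite Nd ?oppr0 //; lia.
Qed.

Lemma asfield2_upper s : upper (asfield s).2.
Proof.
move=> w; have [N Nd] := d_fin w; exists `|N| => k kN.
by rewrite asfield2E; case: ifP => // _; rewrite Nd ?oppr0 //; lia.
Qed.

Lemma asfield1_good s : good r (asfield s).1.
Proof.
split=> [w|rT w]; last by exists 0 => k _; rewrite asfield1E /annihilating rT.
by exists 0 => k k0; rewrite asfield1E /annihilating ifF //; lia.
Qed.

Lemma asfield_good s : good r (whole (asfield s)).
Proof.
apply: goodD (@asfield1_good s) _; split; first exact: asfield2_lower.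
by move=> _; exact: asfield2_upper.
Qed.

Lemma afield_nord_ok s B : flinear B -> good r B -> nord_ok (afield s) B.
Proof.
move=> BL gB; split; first by apply: good_ok gB; [exact: afield1L|exact: afield1_creating].
by apply: fprod_ok_ann => //; [exact: afield2_lower|exact: afield2_upper].
Qed.

Lemma asfield_nord_ok s B : flinear B -> good r B -> nord_ok (asfield s) B.
Proof.
move=> BL gB; split; first by apply: good_ok gB; [exact: asfield1L|exact: asfield1_creating].
by apply: fprod_ok_ann => //; [exact: asfield2_lower|exact: asfield2_upper].
Qed.

Lemma asfield_nord_good s B : flinear B -> good r B -> good r (nord (asfield s) B).
Proof.
move=> BL gB; apply: goodD.
  by apply: good_cre => //; [exact: asfield1L|exact: asfield1_creating|exact: asfield1_good].
by apply: good_ann => //; [exact: asfield2_lower|exact: asfield2_upper].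
Qed.

Lemma as_asL s t : flinear (nord2 (asfield s) (asfield t)).
Proof.
apply: flinear_nord; [exact: asfield1L|exact: asfield2L|exact: asfieldL|].
by apply: asfield_nord_ok; [exact: asfieldL|exact: asfield_good].
Qed.

Lemma as_as_good s t : good r (nord2 (asfield s) (asfield t)).
Proof. by apply: asfield_nord_good; [exact: asfieldL|exact: asfield_good]. Qed.

Lemma a_as_ok s t : nord_ok (afield s) (whole (asfield t)).
Proof. by apply: afield_nord_ok; [exact: asfieldL|exact: asfield_good]. Qed.

Lemma as_as_ok s t : nord_ok (asfield s) (whole (asfield t)).
Proof. by apply: asfield_nord_ok; [exact: asfieldL|exact: asfield_good]. Qed.

Lemma a_as_as_ok s t t' : nord_ok (afield s) (nord2 (asfield t) (asfield t')).
Proof. by apply: afield_nord_ok; [exact: as_asL|exact: as_as_good]. Qed.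

(** The fields :alpha^s alpha^{*t}: and :alpha^s alpha^{*t} alpha^{*t'}:. *)
Definition quad s t := nord2 (afield s) (asfield t).
Definition cubic s t t' := nord3 (afield s) (asfield t) (asfield t').

Lemma quadL s t : flinear (quad s t).
Proof.
by apply: flinear_nord; [exact: afield1L|exact: afield2L|exact: asfieldL|exact: a_as_ok].
Qed.

Lemma cubicL s t t' : flinear (cubic s t t').
Proof.
by apply: flinear_nord; [exact: afield1L|exact: afield2L|exact: as_asL|exact: a_as_as_ok].
Qed.

Lemma amode_afield1_0 t j s : fcomm (amode t j) (afield s).1 (fmono 0 0).
Proof.
move=> k w; rewrite !afield1E /fmono scale0r if_same addr0.
case: ifPn => kN; first exact: lin0 (amodeL t j).
rewrite /amode -/(annih _); case: (boolP (annih j)) => jN; last exact: xC.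
rewrite dx (_ : (j == _) = false) ?andbF ?add0r //.
by apply: contraNF kN => /eqP <-.
Qed.

Lemma amode_afield2_0 t j s : fcomm (amode t j) (afield s).2 (fmono 0 0).
Proof.
move=> k w; rewrite !afield2E /fmono scale0r if_same addr0.
case: ifPn => kN; last exact: lin0 (amodeL t j).
rewrite /amode -/(annih _); case: (boolP (annih j)) => jN; first exact: dC.
rewrite dx (_ : (_ == j) = false) ?andbF ?add0r //.
by apply: contraNF jN => /eqP <-.
Qed.

Lemma amode_asfield1 t j s :
  fcomm (amode t j) (asfield s).1 (fmono ((t == s) && annih j)%:R j).
Proof.
move=> k w; rewrite !asfield1E /fmono.
case: (boolP (annih k)) => kN; last first.
  rewrite (lin0 (amodeL t j)) add0r; case: eqP => // kj.
  by rewrite -kj (negbTE kN) andbF scale0r.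
rewrite /amode -/(annih _); case: (boolP (annih j)) => jN.
  rewrite dx andbT addrC (eq_sym j); congr (_ + _).
  by case: (k == j); rewrite ?andbT ?andbF // scaler_nat.
by rewrite andbF scale0r if_same addr0 xC.
Qed.

Lemma amode_asfield2 t j s :
  fcomm (amode t j) (asfield s).2 (fmono ((t == s) && ~~ annih j)%:R j).
Proof.
move=> k w; rewrite !asfield2E /fmono.
case: (boolP (annih k)) => kN.
  rewrite (lin0 (amodeL t j)) add0r; case: eqP => // kj.
  by rewrite -kj kN andbF scale0r.
rewrite (linN (amodeL t j)) /amode -/(annih _); case: (boolP (annih j)) => jN.
  by rewrite andbF scale0r if_same addr0 dC.
rewrite dx andbT (eq_sym t) opprD addrAC -[LHS]add0r; congr (_ + _).
case: (k == j); rewrite ?andbT ?andbF ?mulr0n ?oppr0 ?addr0 //.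
by rewrite scaler_nat addNr.
Qed.

(** The contraction of a_j with alpha^* sits in one of the two halves of alpha^*,
depending on j and the ordering, but its value does not depend on them. *)
Lemma amode_asfield t j s : fcomm (amode t j) (whole (asfield s)) (fmono (t == s)%:R j).
Proof.
apply: eq_fcomm (fcommD (amodeL t j) (@amode_asfield1 t j s) (@amode_asfield2 t j s)) _.
apply/funext => k; apply/funext => w.
have E (A B : opfield W) : (A + B) k w = A k w + B k w by [].
rewrite E /fmono; case: eqP => _; last by rewrite addr0.
by rewrite -scalerDl -natrD; case: (t == s); case: (annih j).
Qed.

Lemma fmono0 j : fmono 0 j = 0 :> opfield W.
Proof.
by apply/funext => k; apply/funext => w; rewrite /fmono scale0r if_same.
Qed.

Lemma fshift0 j (A : opfield W) : fshift 0 j A = 0.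
Proof. by apply/funext => k; apply/funext => w; rewrite /fshift scale0r. Qed.

(* The zero series is written with an arbitrary exponent to match fcomm_nord. *)
Lemma amode_afield1 t j s i : fcomm (amode t j) (afield s).1 (fmono 0 i).
Proof. by rewrite fmono0 -(fmono0 0); exact: amode_afield1_0. Qed.

Lemma amode_afield2 t j s i : fcomm (amode t j) (afield s).2 (fmono 0 i).
Proof. by rewrite fmono0 -(fmono0 0); exact: amode_afield2_0. Qed.

Lemma amode_quad t j s s' :
  fcomm (amode t j) (quad s s') (fshift (t == s')%:R j (whole (afield s))).
Proof.
apply: eq_fcomm (fcomm_nord (afield1L s) (asfieldL s') (a_as_ok s s') (amodeL t j)
  (@amode_afield1 t j s 0) (@amode_afield2 t j s 0) _ (@amode_asfield t j s')) _.
  by apply: nord_ok_mono; exact: afield1L.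
by rewrite addr0 fshift0 add0r nord_mono //; exact: afield1L.
Qed.

Lemma amode_as_as t j s s' :
  fcomm (amode t j) (nord2 (asfield s) (asfield s'))
    (fshift (t == s)%:R j (whole (asfield s')) +
     fshift (t == s')%:R j (whole (asfield s))).
Proof.
apply: eq_fcomm (fcomm_nord (asfield1L s) (asfieldL s') (as_as_ok s s') (amodeL t j)
  (@amode_asfield1 t j s) (@amode_asfield2 t j s) _ (@amode_asfield t j s')) _.
  by apply: nord_ok_mono; exact: asfield1L.
rewrite nord_mono //; last exact: asfield1L.
by rewrite -natrD; case: (t == s); case: (annih j).
Qed.

Lemma amode_cubic t j s s' s'' :
  fcomm (amode t j) (cubic s s' s'')
    (fshift (t == s')%:R j (quad s s'') + fshift (t == s'')%:R j (quad s s')).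
Proof.
have ok1 := nord_ok_shift (afield1L s) (t == s')%:R j (a_as_ok s s'').
have ok1' := nord_ok_shift (afield1L s) (t == s'')%:R j (a_as_ok s s').
apply: eq_fcomm (fcomm_nord (afield1L s) (as_asL s' s'') (a_as_as_ok s s' s'')
  (amodeL t j) (@amode_afield1 t j s 0) (@amode_afield2 t j s 0) _
  (@amode_as_as t j s' s'')) _.
  by apply: nord_okD ok1 ok1'; [exact: afield1L|apply: flinear_fshift; exact: asfieldL..].
rewrite addr0 fshift0 add0r nordD //; last exact: afield1L.
by rewrite !nord_shift //; first [exact: afield1L|exact: a_as_ok].
Qed.

Lemma C_afield1 s : fcomm C (afield s).1 (-1 *: (afield s).1).
Proof.
move=> k w; have -> : (-1 *: (afield s).1) k w = -1 *: (afield s).1 k w by [].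
rewrite !afield1E; case: ifPn => kN; first by rewrite (lin0 CL) scaler0 addr0.
by rewrite Cx (negbTE kN).
Qed.

Lemma C_afield2 s : fcomm C (afield s).2 (-1 *: (afield s).2).
Proof.
move=> k w; have -> : (-1 *: (afield s).2) k w = -1 *: (afield s).2 k w by [].
rewrite !afield2E; case: ifPn => kN; last by rewrite (lin0 CL) scaler0 addr0.
by rewrite Cd kN scaleN1r scale1r.
Qed.

Lemma C_asfield1 s : fcomm C (asfield s).1 (1 *: (asfield s).1).
Proof.
move=> k w; have -> : (1 *: (asfield s).1) k w = 1 *: (asfield s).1 k w by [].
rewrite !asfield1E; case: ifPn => kN; last by rewrite (lin0 CL) scaler0 addr0.
by rewrite Cx kN.
Qed.

Lemma C_asfield2 s : fcomm C (asfield s).2 (1 *: (asfield s).2).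
Proof.
move=> k w; have -> : (1 *: (asfield s).2) k w = 1 *: (asfield s).2 k w by [].
rewrite !asfield2E; case: ifPn => kN; first by rewrite (lin0 CL) scaler0 addr0.
by rewrite (linN CL) Cd (negbTE kN) scaleN1r scale1r opprD opprK.
Qed.

Lemma C_asfield s : fcomm C (whole (asfield s)) (1 *: whole (asfield s)).
Proof. by rewrite scalerDr; apply: fcommD => //; [exact: C_asfield1|exact: C_asfield2]. Qed.

Lemma C_quad s t : fcomm C (quad s t) 0.
Proof.
have := fcomm_nord_scale (afield1L s) (asfieldL t) (a_as_ok s t) CL
  (@C_afield1 s) (@C_afield2 s) (@C_asfield t).
by rewrite addNr scale0r.
Qed.

Lemma C_as_as s t :
  fcomm C (nord2 (asfield s) (asfield t)) (2 *: nord2 (asfield s) (asfield t)).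
Proof.
have := fcomm_nord_scale (asfield1L s) (asfieldL t) (as_as_ok s t) CL
  (@C_asfield1 s) (@C_asfield2 s) (@C_asfield t).
by rewrite (_ : 1 + 1 = 2 :> K) -?mulr2n.
Qed.

Lemma C_cubic s t t' : fcomm C (cubic s t t') (1 *: cubic s t t').
Proof.
have := fcomm_nord_scale (afield1L s) (as_asL t t') (a_as_as_ok s t t') CL
  (@C_afield1 s) (@C_afield2 s) (@C_as_as t t').
by rewrite (_ : -1 + 2 = 1 :> K) //; ring.
Qed.

End FreeFields.

(** * The currents *)

(** The residue of t^m u^s d(t^n u^t) when u^2 = p(t).  The case s = t = 1 comes
from u d(t^n u) = n t^(n-1) p dt + t^n p' dt / 2, where the coefficient p_i
carries the factor n + i / 2; if only one of s, t is 1 there is no even part. *)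
Definition pairing (K : fieldType) (p : {poly K}) (s t : bool) (m n : int) : K :=
  if s && t then
    \sum_(i < size p) p`_i * (n%:~R + i%:R / 2) *+ (m + n + i%:Z == 0)
  else if s || t then 0 else n%:~R *+ (m + n == 0).

(** What the currents use of the fields beta and beta^1. *)
Record heisenberg_system (K : fieldType) (W : lmodType K)
    (x d : bool -> int -> W -> W) (C : W -> W) (p : {poly K}) (kap : K)
    (b : bool -> int -> W -> W) : Prop := HeisenbergSystem {
  b_linear : forall s n, linear (b s n);
  b_x : forall s t n j w, b s n (x t j w) = x t j (b s n w);
  b_d : forall s t n j w, b s n (d t j w) = d t j (b s n w);
  b_charge : forall s n w, C (b s n w) = b s n (C w);
  b_bounded : forall s w, exists N : int, forall n, N < n -> b s n w = 0;
  b_comm : forall s t m n w, b s m (b t n w) - b t n (b s m w)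
    = (2 * kap * pairing p s t m n) *: w }.

Section PolymulLinear.
Variables (K : fieldType) (W : lmodType K) (p : {poly K}).
Implicit Types A B : opfield W.

Lemma fpolymulD q A B : fpolymul q (A + B) = fpolymul q A + fpolymul q B.
Proof.
apply/funext => k; apply/funext => w.
have -> : (fpolymul q A + fpolymul q B) k w = fpolymul q A k w + fpolymul q B k w by [].
by rewrite /fpolymul -big_split; apply: eq_bigr => i _ /=; rewrite -scalerDr.
Qed.

Lemma fpolymulZ q a A : fpolymul q (a *: A) = a *: fpolymul q A.
Proof.
apply/funext => k; apply/funext => w.
have -> : (a *: fpolymul q A) k w = a *: fpolymul q A k w by [].
rewrite /fpolymul scaler_sumr; apply: eq_bigr => i _.
by rewrite scalerA mulrC -scalerA.
Qed.

Lemma fpolymul_shift q e j A : fpolymul q (fshift e j A) = fshift e j (fpolymul q A).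
Proof.
apply/funext => k; apply/funext => w; rewrite /fshift /fpolymul scaler_sumr.
by apply: eq_bigr => i _; rewrite scalerA mulrC -scalerA addrAC.
Qed.

Lemma fpolymul0 q : fpolymul q (0 : opfield W) = 0.
Proof.
apply/funext => k; apply/funext => w; rewrite /fpolymul big1 // => i _.
by rewrite (_ : (0 : opfield W) _ w = 0) ?scaler0.
Qed.

Lemma fshiftD e j A B : fshift e j (A + B) = fshift e j A + fshift e j B.
Proof.
by apply/funext => k; apply/funext => w; rewrite /fshift -scalerDr.
Qed.

Lemma fshiftZ e j a A : fshift e j (a *: A) = a *: fshift e j A.
Proof.
apply/funext => k; apply/funext => w.
have -> : (a *: fshift e j A) k w = a *: fshift e j A k w by [].
by rewrite /fshift (_ : (a *: A) _ w = a *: A (k - j) w) // scalerA mulrC -scalerA.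
Qed.

Lemma fshift_scale e j A : fshift e j A = e *: fshift 1 j A.
Proof.
apply/funext => k; apply/funext => w.
have -> : (e *: fshift 1 j A) k w = e *: fshift 1 j A k w by [].
by rewrite /fshift scale1r.
Qed.

Lemma fderz0 : fderz (0 : opfield W) = 0.
Proof.
apply/funext => k; apply/funext => w; rewrite /fderz.
by rewrite (_ : (0 : opfield W) _ w = 0) ?scaler0.
Qed.

Lemma double_scale A B : 2 *: (A + B) = A + A + 2 *: B.
Proof. by rewrite scalerDr scaler_nat mulr2n. Qed.

Lemma fpolymul_deriv A k w :
  fpolymul p^`() A k w = \sum_(i < size p) (p`_i *+ i) *: A (k + 1 - i%:Z) w.
Proof.
rewrite /fpolymul.
pose F i : W := p^`()`_i *: A (k - i%:Z) w.
have le : (size p^`() <= size p)%N := leq_trans (size_poly _ _) (leq_pred _).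
transitivity (\sum_(i < size p) F i).
  rewrite (big_ord_widen (size p) F le) [RHS](bigID (fun i : 'I__ => (i < size p^`())%N)) /=.
  rewrite [X in _ = _ + X]big1 ?addr0 // => i; rewrite -leqNgt => ile.
  by rewrite /F nth_default // scale0r.
pose G i : W := (p`_i *+ i) *: A (k + 1 - i%:Z) w.
transitivity (\sum_(i < (size p).+1) G i); last first.
  by rewrite big_ord_recr /= /G nth_default // mul0rn scale0r addr0.
rewrite big_ord_recl /= /G mulr0n scale0r add0r; apply: eq_bigr => i _.
rewrite /F coef_deriv /bump /= add1n; congr (_ *: A _ w).
by lia.
Qed.

End PolymulLinear.

Section Currents.
Variables (K : numFieldType) (W : lmodType K) (r : bool).
Variables (x d : bool -> int -> W -> W) (C : W -> W).
Hypothesis WS : weyl_system r x d C.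
Variables (p : {poly K}) (kap chi : K) (b : bool -> int -> W -> W).
Hypothesis HS : heisenberg_system x d C p kap b.
Implicit Types (s t : bool) (n j : int) (w : W).

Local Notation annih := (annihilating r).
Local Notation amode := (amode r x d).
Local Notation afield := (afield r x d).
Local Notation asfield := (asfield r x d).
Local Notation quad := (quad r x d).
Local Notation cubic := (cubic r x d).
Local Notation afieldL := (afieldL WS).
Local Notation asfieldL := (asfieldL WS).
Local Notation quadL := (quadL WS).
Local Notation cubicL := (cubicL WS).
Local Notation amodeL := (amodeL WS).
Let CL := charge_linear WS.

Definition bfield s : opfield W := series1 (b s).
Let bL := b_linear HS.

Lemma bfieldL s : flinear (bfield s). Proof. by move=> k; exact: bL. Qed.

(** Although beta is not a creating field, it commutes with alpha^*_+, which has
only nonnegative powers of z, and its large modes kill the vector; these two facts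
bound the sum from both sides. *)
Lemma b_as_ok s t : fprod_ok (bfield s) (whole (asfield t)).
Proof.
apply: fprod_okDr; first exact: bfieldL.
  move=> k w; have [N Nb] := b_bounded HS s w.
  apply: (@fin_supp_bounds _ _ _ (- N - 1) k) => i ik.
    rewrite asfield1E; case: ifP => _; last exact: lin0 (bfieldL s i).
    by rewrite /bfield /series1 (b_x HS) Nb ?(lin0 (x_linear WS t _)) //; lia.
  by rewrite asfield1E /annihilating ifF ?(lin0 (bfieldL s i)) //; lia.
by apply: fprod_ok_ann; [exact: bfieldL|exact: asfield2_lower WS t|exact: asfield2_upper WS t].
Qed.

Definition free_h s : opfield W :=
  if s then quad true false + fpolymul p (quad false true)
  else quad false false + quad true true.

Definition current_h s : opfield W := 2 *: free_h s + bfield s.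

Definition current_e s : opfield W :=
  if s then
    cubic true false false
    + fpolymul p (cubic true true true + 2 *: cubic false false true)
    + fprod (bfield true) (whole (asfield false))
    + fpolymul p (fprod (bfield false) (whole (asfield true)))
    + chi *: (fpolymul p (fderz (whole (asfield true)))
              + 2^-1 *: fpolymul p^`() (whole (asfield true)))
  else
    cubic false false false + fpolymul p (cubic false true true)
    + 2 *: cubic true false true
    + fprod (bfield false) (whole (asfield false))
    + fprod (bfield true) (whole (asfield true))
    + chi *: fderz (whole (asfield false)).

(** If A s has modes F(t^m u^s) with F linear on the ring, fmul A s t has modes
F(t^m u^s u^t); the factor p is u^2. *)
Definition fmul (A : bool -> opfield W) s t : opfield W :=
  if s && t then fpolymul p (A false) else A (s (+) t).

Lemma free_hL s : flinear (free_h s).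
Proof.
by case: s; apply: flinearD; [| apply: flinear_polymul| |]; exact: quadL.
Qed.

Lemma current_hL s : flinear (current_h s).
Proof. by apply: flinearD (bfieldL s); apply: flinearZ; exact: free_hL. Qed.

Lemma b_asL s t : flinear (fprod (bfield s) (whole (asfield t))).
Proof. by apply: flinear_fprod; [exact: b_as_ok|exact: bfieldL|exact: asfieldL]. Qed.

Lemma current_eL s : flinear (current_e s).
Proof.
rewrite /current_e; case: s; repeat first
  [ exact: cubicL | exact: b_asL | exact: asfieldL
  | apply: flinearD | apply: flinearZ | apply: flinear_polymul
  | apply: flinear_derz ].
Qed.

Lemma amode_b t j s : fcomm (amode t j) (bfield s) 0.
Proof.
move=> k w; have -> : (0 : opfield W) k w = 0 by [].
by rewrite addr0 /bfield /series1 /amode; case: ifP => _; rewrite ?(b_x HS) ?(b_d HS).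
Qed.

Lemma amode_b_as t j s s' :
  fcomm (amode t j) (fprod (bfield s) (whole (asfield s')))
    (fshift (t == s')%:R j (bfield s)).
Proof.
apply: eq_fcomm (fcomm_fprod (amodeL t j) (bfieldL s) (b_as_ok s s') _ _
  (@amode_b t j s) (amode_asfield WS t j s')) _.
- by rewrite -(fmono0 W 0); exact: fprod_ok_monol.
- by apply: fprod_ok_monor; exact: bfieldL.
- rewrite -(fmono0 W 0) fprod_monol fshift0 add0r fprod_monor //; exact: bfieldL.
Qed.

Lemma amode_free_h t j s : fcomm (amode t j) (free_h s)
  (fshift 1 j (fmul (fun s => whole (afield s)) s t)).
Proof.
have N s1 s2 := amode_quad WS t j s1 s2.
case: s; apply: eq_fcomm (fcommD (amodeL t j) _ _) _.
- exact: N.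
- apply: fcomm_polymul; [exact: amodeL|exact: N].
- by case: t N => _; rewrite /fmul /= fshift0 ?fpolymul0 ?fpolymul_shift ?add0r ?addr0.
- exact: N.
- exact: N.
- by case: t N => _; rewrite /fmul /= fshift0 ?add0r ?addr0.
Qed.

Lemma amode_current_h t j s : fcomm (amode t j) (current_h s)
  (fshift 2 j (fmul (fun s => whole (afield s)) s t)).
Proof.
apply: eq_fcomm (fcommD (amodeL t j) (fcommZ _ (amodeL t j) (@amode_free_h t j s))
  (@amode_b t j s)) _.
by rewrite addr0 -fshift_scale.
Qed.

(** The scalar series whose coefficient of z^k is chi times the residue of
t^(-k-1) u^s d(t^j u^t). *)
Definition central_term s t j : opfield W :=
  fun k w => (chi * pairing p s t (- k - 1) j) *: w.

Lemma central_term_off s t j : s (+) t -> central_term s t j = 0.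
Proof.
move=> st; apply/funext => k; apply/funext => w; rewrite /central_term /pairing.
by case: s t st => -[] //= _; rewrite mulr0 scale0r.
Qed.

Lemma central_term_even j : central_term false false j = chi *: fderz (fmono 1 j).
Proof.
apply/funext => k; apply/funext => w; rewrite /central_term /pairing /=.
have -> : (chi *: fderz (fmono 1 j)) k w = chi *: fderz (fmono 1 j) k w by [].
rewrite /fderz /fmono scale1r scalerA (_ : (- k - 1 + j == 0) = (k + 1 == j)); last by lia.
by case: eqP => [->|_]; rewrite ?mulr1n // mulr0n mulr0 scale0r scaler0.
Qed.

(** The combination P d/dz + P'/2 in the current e^1 is dictated by this
identity. *)
Lemma central_term_odd j : central_term true true j =
  chi *: (fpolymul p (fderz (fmono 1 j)) + 2^-1 *: fpolymul p^`() (fmono 1 j)).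
Proof.
apply/funext => k; apply/funext => w; rewrite /central_term /pairing /=.
set A := fpolymul p _; set B := fpolymul p^`() _.
have -> : (chi *: (A + 2^-1 *: B)) k w = chi *: (A k w + 2^-1 *: B k w) by [].
rewrite {}/A {}/B -scalerA; congr (_ *: _).
rewrite fpolymul_deriv scaler_suml scaler_sumr -big_split; apply: eq_bigr => i _ /=.
rewrite /fderz /fmono !scalerA scale1r.
have -> : (- k - 1 + j + i%:Z == 0) = (k - i%:Z + 1 == j) by lia.
have -> : (k + 1 - i%:Z == j) = (k - i%:Z + 1 == j) by lia.
case: eqP => [->|_]; last by rewrite mulr0n !scaler0 scale0r addr0.
by rewrite -scalerDl mulr1n -mulr_natr; congr (_ *: _); field.
Qed.

(** Contracting a_j with the cubic terms gives the quadratic terms of h, twice when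
the two alpha^* are equal; contracting it with beta alpha^* leaves beta, and with the
derivative of alpha^* the central term. *)
Lemma amode_current_e t j s : fcomm (amode t j) (current_e s)
  (fshift 1 j (fmul current_h s t) + central_term s t j).
Proof.
have N3 s1 s2 s3 := amode_cubic WS t j s1 s2 s3.
have B s1 s2 := @amode_b_as t j s1 s2.
have A s1 := amode_asfield WS t j s1.
have aL := amodeL t j.
case: s.
- apply: eq_fcomm (fcommD aL (fcommD aL (fcommD aL (fcommD aL (N3 _ _ _)
    (fcomm_polymul _ aL (fcommD aL (N3 _ _ _) (fcommZ _ aL (N3 _ _ _)))))
    (B _ _)) (fcomm_polymul _ aL (B _ _)))
    (fcommZ _ aL (fcommD aL (fcomm_polymul _ aL (fcomm_derz aL (A _)))
       (fcommZ _ aL (fcomm_polymul _ aL (A _)))))) _.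
  case: t N3 B A aL => _ _ _ _ /=;
    rewrite ?fshift0 ?fmono0 ?fderz0 ?(add0r, addr0, fpolymul0, scaler0).
  - rewrite -central_term_odd /fmul /= -fpolymul_shift -fpolymulD; congr (fpolymul p _ + _).
    rewrite -!fshiftZ -!fshiftD; congr fshift.
    rewrite /current_h /free_h /= [quad false false + quad true true]addrC.
    by rewrite (double_scale (quad true true)).
  - rewrite central_term_off // addr0 /fmul /=.
    rewrite -!fshiftZ fpolymul_shift -!fshiftD; congr fshift.
    by rewrite /current_h /free_h /= (double_scale (quad true false)) fpolymulZ.
- apply: eq_fcomm (fcommD aL (fcommD aL (fcommD aL (fcommD aL (fcommD aL
    (N3 _ _ _) (fcomm_polymul _ aL (N3 _ _ _))) (fcommZ _ aL (N3 _ _ _)))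
    (B _ _)) (B _ _)) (fcommZ _ aL (fcomm_derz aL (A _)))) _.
  case: t N3 B A aL => _ _ _ _ /=;
    rewrite ?fshift0 ?fmono0 ?fderz0 ?(add0r, addr0, fpolymul0, scaler0).
  - rewrite central_term_off // addr0 /fmul /=.
    rewrite -!fshiftZ -!fshiftD fpolymul_shift -!fshiftD; congr fshift.
    rewrite /current_h /free_h /= [quad true false + _]addrC.
    by rewrite (double_scale (fpolymul p (quad false true))) fpolymulD.
  - rewrite -central_term_even /fmul /= -!fshiftZ -!fshiftD; congr (_ + _); congr fshift.
    by rewrite /current_h /free_h /= (double_scale (quad false false)).
Qed.

Lemma C_bfield s : fcomm C (bfield s) 0.
Proof.
move=> k w; have -> : (0 : opfield W) k w = 0 by [].
by rewrite addr0 /bfield /series1 (b_charge HS).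
Qed.

Lemma C_current_h s : fcomm C (current_h s) 0.
Proof.
have N s1 s2 := C_quad WS s1 s2.
apply: eq_fcomm (fcommD CL (fcommZ 2 CL (_ : fcomm C (free_h s) 0)) (@C_bfield s)) _.
  case: s; apply: eq_fcomm (fcommD CL _ _) _.
  - exact: N.
  - by apply: fcomm_polymul => //; exact: N.
  - by rewrite fpolymul0 addr0.
  - exact: N.
  - exact: N.
  - by rewrite addr0.
by rewrite scaler0 addr0.
Qed.

Lemma C_current_e s : fcomm C (current_e s) (1 *: current_e s).
Proof.
have N3 s1 s2 s3 := C_cubic WS s1 s2 s3.
have A s1 := C_asfield WS s1.
have B s1 s2 : fcomm C (fprod (bfield s1) (whole (asfield s2)))
    (1 *: fprod (bfield s1) (whole (asfield s2))).
  have sE D : 1 *: D = fshift 1 0 D :> opfield W.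
    by apply/funext => k; apply/funext => w; rewrite /fshift subr0.
  apply: eq_fcomm (fcomm_fprod CL (bfieldL s1) (b_as_ok s1 s2) _ _ (@C_bfield s1) (A s2)) _.
  - by rewrite -(fmono0 W 0); exact: fprod_ok_monol.
  - by rewrite sE; apply: fprod_ok_shiftr; [exact: bfieldL|exact: b_as_ok].
  - rewrite -(fmono0 W 0) fprod_monol fshift0 add0r !sE.
    by apply: fprod_shiftr; [exact: bfieldL|exact: b_as_ok].
have Z D c0 : fcomm C D (1 *: D) -> fcomm C (c0 *: D) (1 *: (c0 *: D)).
  by move=> CD; apply: eq_fcomm (fcommZ c0 CL CD) _; rewrite !scale1r.
have P D q : fcomm C D (1 *: D) -> fcomm C (fpolymul q D) (1 *: fpolymul q D).
  by move=> CD; apply: eq_fcomm (fcomm_polymul q CL CD) _; rewrite !scale1r.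
have dz D : fcomm C D (1 *: D) -> fcomm C (fderz D) (1 *: fderz D).
  by move=> CD; apply: eq_fcomm (fcomm_derz CL CD) _; rewrite !scale1r.
have S D D' : fcomm C D (1 *: D) -> fcomm C D' (1 *: D') ->
    fcomm C (D + D') (1 *: (D + D')).
  by move=> CD CD'; apply: eq_fcomm (fcommD CL CD CD') _; rewrite scalerDr.
by rewrite /current_e; case: s; repeat first [ exact: N3 | exact: B | exact: A
  | apply: (S _ _) | apply: (Z _ _) | apply: (P _ _) | apply: (dz _) ].
Qed.

End Currents.

(** * Vacuum expectation values *)

(** The map pi stands for the coefficient of a monomial in the y: it kills all
multiples of the x, so that only full contractions survive. *)
Section Vacuum.
Variables (K : numFieldType) (W V : lmodType K) (r : bool).
Variables (x d : bool -> int -> W -> W) (C : W -> W).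
Hypothesis WS : weyl_system r x d C.
Variables (p : {poly K}) (kap : K) (b : bool -> int -> W -> W).
Hypothesis HS : heisenberg_system x d C p kap b.
Variable pi : W -> V.
Hypothesis piL : linear pi.
Hypothesis pi_x : forall s n w, pi (x s n w) = 0.
Implicit Types (s t : bool) (n j : int) (v w : W).

Local Notation annih := (annihilating r).
Local Notation amode := (amode r x d).
Local Notation afield := (afield r x d).
Local Notation asfield := (asfield r x d).
Local Notation quad := (quad r x d).
Local Notation free_h := (free_h r x d p).
Local Notation current_h := (current_h r x d p b).
Local Notation bfield := (bfield b).

Definition vacuum v := forall s n, d s n v = 0.

Lemma vacuum_b s n v : vacuum v -> vacuum (b s n v).
Proof. by move=> v0 t m; rewrite -(b_d HS) v0 (lin0 (b_linear HS s n)). Qed.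

Lemma quad_vacuum s t k v : vacuum v -> quad s t k v = fsum (fun i =>
  if ~~ annih (- i - 1) && annih (k - i) then x s (- i - 1) (x t (k - i) v)
  else 0).
Proof.
move=> v0.
have -> : quad s t k v = fprod (afield s).1 (whole (asfield t)) k v
    + fprod (whole (asfield t)) (afield s).2 k v by [].
rewrite [X in _ + X]fsum0 ?addr0 => [|i]; last first.
  by rewrite afield2E v0 if_same (lin0 (asfieldL WS t _)).
apply: eq_fsum => i.
rewrite wholeE asfield1E asfield2E v0 oppr0 if_same addr0 afield1E.
case: (annih (- i - 1)) => //=; case: ifP => _ //.
exact: lin0 (x_linear WS s _).
Qed.

Lemma quad_vacuum_fin s t k v : fin_supp (fun i =>
  if ~~ annih (- i - 1) && annih (k - i) then x s (- i - 1) (x t (k - i) v)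
  else 0).
Proof.
apply: (@fin_supp_bounds _ _ _ 0 k) => i ik; rewrite ifF // /annihilating;
  case: (r) => //=; lia.
Qed.

Lemma pi_quad_vacuum s t k v : vacuum v -> pi (quad s t k v) = 0.
Proof.
move=> v0; rewrite quad_vacuum // (fsum_lin piL (quad_vacuum_fin s t k v)) fsum0 // => i.
by case: ifP => _; rewrite ?pi_x ?(lin0 piL).
Qed.

Lemma pi_b_quad_vacuum s n t t' k v : vacuum v -> pi (b s n (quad t t' k v)) = 0.
Proof.
move=> v0; rewrite quad_vacuum // (fsum_lin (b_linear HS s n) (quad_vacuum_fin t t' k v)).
rewrite (fsum_lin piL); last first.
  by apply: fin_supp_sub (quad_vacuum_fin t t' k v) => i ->; exact: lin0 (b_linear HS s n).
rewrite fsum0 // => i; case: ifP => _; last by rewrite (lin0 (b_linear HS s n)) (lin0 piL).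
by rewrite (b_x HS) pi_x.
Qed.

Lemma fsum_range (c : V) (k : int) :
  fsum (fun i : int => if (0 <= i) && (i <= k) then c else 0)
  = if 0 <= k then c *+ `|(k + 1)%R|%N else 0.
Proof.
case: (lerP 0 k) => [k0|kN]; last by apply: fsum0 => i; rewrite ifF //; lia.
have [n ->] : exists n : nat, k = n by exists `|k|%N; lia.
elim: n {k k0} => [|n IH].
  rewrite (@fsum1 _ _ _ 0) => [|i i0]; first by rewrite add0r mulr1n.
  by rewrite ifF //; lia.
rewrite (@eq_fsum _ _ _ (fun i : int => (if (0 <= i) && (i <= n%:Z) then c else 0)
    + (if i == n.+1%:Z then c else 0))).
  rewrite fsumD.
  - rewrite IH (@fsum1 _ _ _ n.+1%:Z) ?eqxx => [|i /negbTE -> //].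
    by rewrite -mulrSr; congr (_ *+ _); lia.
  - by apply: (@fin_supp_bounds _ _ _ 0 n%:Z) => i ik; rewrite ifF //; lia.
  - apply: (@fin_supp_bounds _ _ _ n.+1%:Z n.+1%:Z) => i ik; rewrite ifF //; lia.
move=> i; case: eqP => [->|iN]; first by rewrite ifT ?ifF ?add0r //; lia.
by rewrite addr0; congr (if _ then _ else _); lia.
Qed.

(** The number of summands of :alpha alpha^*: at z^k that do not kill the vacuum:
they are the products of a_{-i-1} and x_{k-i} with 0 <= i <= k.  For the natural ordering
no positive variable exists and there is none. *)
Definition contraction_count (k : int) : K := if ~~ r && (0 <= k) then (k + 1)%:~R else 0.

(** On the vacuum the inner field is a sum of products of two multiplications, one
of which is a mode of alpha.  Moving that mode to the left, where pi kills it, costs a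
contraction with alpha^{*s'}; what remains is the contraction of alpha^s with the
other multiplication. *)
Lemma pi_quad_quad s s' t t' k l v : vacuum v ->
  pi (quad s s' k (quad t t' l v)) =
  - (contraction_count l *+ [&& s' == t, s == t' & k + l + 2 == 0]) *: pi v.
Proof.
move=> v0; rewrite (quad_vacuum t t' l v0).
rewrite (fsum_lin (quadL WS s s' k) (quad_vacuum_fin t t' l v)).
rewrite (fsum_lin piL); last first.
  by apply: fin_supp_sub (quad_vacuum_fin t t' l v) => i ->; exact: lin0 (quadL WS s s' k).
pose c : V := - ((1 *+ [&& s' == t, s == t' & k + l + 2 == 0] : K) *: pi v).
rewrite (@eq_fsum _ _ _ (fun i => if ~~ annih (- i - 1) && annih (l - i) then c else 0)).
  case: (boolP r) => rT.
    rewrite fsum0 => [|i]; last by rewrite /annihilating.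
    by rewrite /contraction_count rT /= mul0rn oppr0 scale0r.
  rewrite (@eq_fsum _ _ _ (fun i => if (0 <= i) && (i <= l) then c else 0)) => [|i].
    rewrite fsum_range /contraction_count rT /=.
    case: ifP => l0; last by rewrite mul0rn oppr0 scale0r.
    rewrite /c mulNrn -scaler_nat scalerA scaleNr; congr (- (_ *: _)).
    rewrite mulrnAr mulr1; congr (_ *+ _).
    by rewrite -[in RHS](@gez0_abs (l + 1)) //; lia.
  by congr (if _ then _ else _); rewrite /annihilating /=; lia.
move=> i; case: ifP => [/andP[iN iP]|_]; last by rewrite (lin0 (quadL WS s s' k)) (lin0 piL).
have -> : x t (- i - 1) = amode t (- i - 1) by rewrite /amode -/(annih _) (negbTE iN).
set u := x t' (l - i) v; have -> : quad s s' k (amode t (- i - 1) u)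
    = amode t (- i - 1) (quad s s' k u)
      - fshift (t == s')%:R (- i - 1) (whole (afield s)) k u.
  by rewrite (amode_quad WS t (- i - 1) s s' k u) addrK.
rewrite (linB piL) {}/u.
have -> w : pi (amode t (- i - 1) w) = 0 by rewrite /amode -/(annih _) (negbTE iN) pi_x.
rewrite sub0r /c /fshift (linZ piL) whole_afield //.
set n := - _ - 1.
have -> : pi (amode s n (x t' (l - i) v)) = pi v *+ ((s == t') && (n == l - i)).
  rewrite /amode -/(annih _); case: ifPn => nN.
    by rewrite (d_x WS) v0 (lin0 (x_linear WS _ _)) addr0 (linMn piL).
  rewrite pi_x (_ : (n == _) = false) ?andbF //.
  by apply: contraNF nN => /eqP ->.
rewrite (_ : (n == l - i) = (k + l + 2 == 0)); last by rewrite /n; lia.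
rewrite (eq_sym t); congr (- _).
by case: (s' == t); case: (s == t'); case: (_ == 0);
  rewrite /= ?mulr0n ?scaler0 ?scale0r.
Qed.

Lemma pi_quad_comm s s' t t' k l v : vacuum v ->
  pi (quad s s' k (quad t t' l v)) - pi (quad t t' l (quad s s' k v)) =
  - ((~~ r)%:R * (l + 1)%:~R *+ [&& s' == t, s == t' & k + l + 2 == 0]) *: pi v.
Proof.
move=> v0; rewrite !pi_quad_quad // -scalerBl; congr (_ *: _).
rewrite (eq_sym t' s) (eq_sym t s') (addrC l).
case: (s' == t); case: (s == t') => /=; rewrite ?mulr0n ?oppr0 ?addr0 //.
case: eqP => [kl|_]; last by rewrite !mulr0n !oppr0 addr0.
rewrite !mulr1n opprK /contraction_count; case: (r) => /=; first by rewrite mul0r oppr0 addr0.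
rewrite mul1r; have kE : k = - l - 2 by lia.
have [lt|[lt|lE]] : l < -1 \/ (0 <= l \/ l = -1) by lia.
- have -> : (0 <= l) = false by lia.
  have -> : (0 <= k) = true by lia.
  by rewrite oppr0 add0r kE -intrN; congr (_%:~R); lia.
- have -> : (0 <= k) = false by lia.
  by rewrite lt addr0.
- have -> : (0 <= k) = false by lia.
  by rewrite lE /= oppr0 addr0.
Qed.

Lemma free_hE s k w : free_h s k w =
  if s then quad true false k w + \sum_(i < size p) p`_i *: quad false true (k - i%:Z) w
  else quad false false k w + quad true true k w.
Proof. by case: s. Qed.

(** The two families of free fields are exchanged by the double contractions with
P, and kept apart by the others. *)
Lemma pi_free_h_free_h s t k l v : vacuum v -> pi (free_h s k (free_h t l v)) =
  if s && t then
    \sum_(i < size p) p`_i *: (pi (quad true false k (quad false true (l - i%:Z) v))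
                              + pi (quad false true (k - i%:Z) (quad true false l v)))
  else if s || t then 0
  else pi (quad false false k (quad false false l v))
       + pi (quad true true k (quad true true l v)).
Proof.
move=> v0.
have N0 s1 s1' t1 t1' k1 l1 : ~~ ((s1' == t1) && (s1 == t1')) ->
    pi (quad s1 s1' k1 (quad t1 t1' l1 v)) = 0.
  by rewrite pi_quad_quad // => /negbTE E; rewrite andbA E mulr0n oppr0 scale0r.
have L s1 s1' k1 := quadL WS s1 s1' k1.
have S f : pi (\sum_(i < size p) f i) = \sum_(i < size p) pi (f i) by exact: lin_sum.
have free_h_v t1 l1 u : linear u -> u (free_h t1 l1 v) = if t1
    then u (quad true false l1 v)
      + \sum_(i < size p) p`_i *: u (quad false true (l1 - i%:Z) v)
    else u (quad false false l1 v) + u (quad true true l1 v) :> V.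
  move=> uL; rewrite free_hE; case: t1; rewrite (linD uL) // (lin_sum uL).
  by congr (_ + _); apply: eq_bigr => i _; rewrite (linZ uL).
rewrite (free_h_v t l (fun w => pi (free_h s k w))); last first.
  by move=> a u w; rewrite (free_hL WS p s k) piL.
have E s1 s1' k1 : pi (free_h s k (quad s1 s1' k1 v)) = if s
    then pi (quad true false k (quad s1 s1' k1 v))
         + \sum_(i < size p) p`_i *: pi (quad false true (k - i%:Z) (quad s1 s1' k1 v))
    else pi (quad false false k (quad s1 s1' k1 v))
         + pi (quad true true k (quad s1 s1' k1 v)).
  rewrite free_hE; case: (s); rewrite (linD piL) // S.
  by congr (_ + _); apply: eq_bigr => i _; rewrite (linZ piL).
case: s t free_h_v E => -[] _ E /=; rewrite !E.
- rewrite N0 // add0r addrC -big_split; apply: eq_bigr => i _ /=.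
  rewrite E -scalerDr; congr (_ *: (_ + _)).
  by rewrite big1 ?addr0 // => j _; rewrite N0 // scaler0.
- rewrite !N0 // !add0r big1 ?big1 ?addr0 // => i _; by rewrite N0 // scaler0.
- rewrite !N0 // !add0r big1 // => i _; by rewrite E !N0 // addr0 scaler0.
- by rewrite (N0 true true) // (N0 false false true) // addr0 add0r.
Qed.

Lemma pi_free_h_comm s t k l v : vacuum v ->
  pi (free_h s k (free_h t l v)) - pi (free_h t l (free_h s k v)) =
  (2 * (~~ r)%:R * pairing p s t (- k - 1) (- l - 1)) *: pi v.
Proof.
move=> v0; rewrite !pi_free_h_free_h // (andbC t) (orbC t) /pairing.
case: (boolP (s && t)) => [_|_].
  rewrite -sumrB mulr_sumr scaler_suml; apply: eq_bigr => i _.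
  rewrite -scalerBr [X in _ - X]addrC opprD addrACA !pi_quad_comm // /=.
  have -> : k + (l - i%:Z) + 2 = k + l + 2 - i%:Z by lia.
  have -> : k - i%:Z + l + 2 = k + l + 2 - i%:Z by lia.
  have -> : (- k - 1 + (- l - 1) + i%:Z == 0) = (k + l + 2 - i%:Z == 0) by lia.
  rewrite -scalerDl scalerA; congr (_ *: _).
  case: eqP => _; last by rewrite !mulr0n !mulr0 oppr0 addr0 mulr0.
  rewrite !mulr1n (_ : l - i%:Z + 1 = l + 1 - i%:Z); last by lia.
  rewrite (_ : - l - 1 = - (l + 1)); last by lia.
  by rewrite intrB intrN; field.
case: (s || t); first by rewrite subr0 mulr0 scale0r.
rewrite opprD addrACA !pi_quad_comm // -scalerDl; congr (_ *: _) => /=.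
have -> : (- k - 1 + (- l - 1) == 0) = (k + l + 2 == 0) by lia.
case: eqP => _; last by rewrite !mulr0n mulr0 oppr0 addr0.
rewrite !mulr1n (_ : - l - 1 = - (l + 1)); last by lia.
by rewrite intrN; ring.
Qed.

(** The factor 2 in h makes the double contractions count four times, and they
amount to twice the residue pairing for the usual ordering, against
2 kap times it for beta. *)
Lemma pi_current_h_comm s t k l v : vacuum v ->
  pi (current_h s k (current_h t l v)) - pi (current_h t l (current_h s k v)) =
  (2 * (kap + 4 *+ ~~ r) * pairing p s t (- k - 1) (- l - 1)) *: pi v.
Proof.
move=> v0.
have current_hE s1 k1 w : current_h s1 k1 w = 2 *: free_h s1 k1 w + bfield s1 k1 w by [].
have piT s1 k1 u : vacuum u -> pi (free_h s1 k1 u) = 0.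
  move=> u0; rewrite free_hE; case: s1; rewrite (linD piL) !pi_quad_vacuum ?add0r //.
  rewrite (lin_sum piL) big1 // => i _.
  by rewrite (linZ piL) pi_quad_vacuum // scaler0.
have pibT s1 k1 s2 k2 : pi (bfield s1 k1 (free_h s2 k2 v)) = 0.
  have bL := b_linear HS s1 (- k1 - 1).
  rewrite /bfield /series1 free_hE.
  case: s2; rewrite (linD bL) (linD piL) !pi_b_quad_vacuum ?add0r //.
  rewrite (lin_sum bL) (lin_sum piL) big1 // => i _.
  by rewrite (linZ bL) (linZ piL) pi_b_quad_vacuum // scaler0.
have E s1 k1 s2 k2 : pi (current_h s1 k1 (current_h s2 k2 v))
    = 4 *: pi (free_h s1 k1 (free_h s2 k2 v)) + pi (bfield s1 k1 (bfield s2 k2 v)).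
  have TL := free_hL WS p s1 k1; have bL := b_linear HS s1 (- k1 - 1).
  rewrite !current_hE (linD TL) (linZ TL) (linD (bL : linear (bfield s1 k1))).
  rewrite (linZ (bL : linear (bfield s1 k1))) scalerDr scalerA !(linD piL) !(linZ piL).
  have vb : vacuum (bfield s2 k2 v) by exact: (@vacuum_b s2 (- k2 - 1) v v0).
  rewrite pibT (piT _ _ _ vb) ?scaler0 ?addr0 ?add0r.
  by congr (_ *: _ + _); ring.
rewrite !E opprD addrACA -scalerBr pi_free_h_comm // -(linB piL) (b_comm HS) (linZ piL).
rewrite scalerA -scalerDl; congr (_ *: _).
by case: (r) => /=; rewrite ?mulr0n ?mulr1n; ring.
Qed.

End Vacuum.

(** * From the commutators with alpha to the representation *)

(** The coordinates cf turn identities between vectors into identities between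
scalars, which ring decides once all operators are expanded. *)
Section CurrentAlgebra.
Variables (K : numFieldType) (W : lmodType K) (A : comAlgType K) (I : Type).
Variable cf : I -> W -> K.
Hypothesis cfL : forall i a u v, cf i (a *: u + v) = a * cf i u + cf i v.
Hypothesis cf_inj : forall u v, (forall i, cf i u = cf i v) -> u = v.

Variables (fa h e : A -> W -> W) (phi : A -> A -> K) (chi : K) (C : W -> W).
Implicit Types (p q z : A) (u v w : W).

Hypothesis faL : forall p, linear (fa p).
Hypothesis hL : forall p, linear (h p).
Hypothesis eL : forall p, linear (e p).
Hypothesis CL : linear C.
Hypothesis fa_lin : forall w, linear (fa^~ w).
Hypothesis h_lin : forall w, linear (h^~ w).
Hypothesis e_lin : forall w, linear (e^~ w).

Hypothesis phi_leibniz : forall p q z, phi p (q * z) = phi (p * q) z + phi (p * z) q.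
Hypothesis phi1 : forall q, phi 1 q = 0.

Hypothesis fa_fa : forall p q w, fa p (fa q w) = fa q (fa p w).
Hypothesis h_fa : forall p q w, h p (fa q w) = fa q (h p w) - 2 *: fa (p * q) w.
Hypothesis e_fa : forall p q w,
  e p (fa q w) = fa q (e p w) - h (p * q) w - (chi * phi p q) *: w.
Hypothesis C_h : forall p w, C (h p w) = h p (C w).
Hypothesis C_e : forall p w, C (e p w) = e p (C w) + e p w.

Variable vacuum_zero : (W -> W) -> Prop.
Hypothesis vanish : forall (F : W -> W) (kap : int), linear F -> 0 <= kap ->
  (forall q w, F (fa q w) = fa q (F w)) ->
  (forall w, C (F w) = F (C w) + kap%:~R *: F w) ->
  (kap = 0 -> vacuum_zero F) -> forall w, F w = 0.
Hypothesis h_h_vacuum : forall p q,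
  vacuum_zero (fun w => h p (h q w) - h q (h p w) - (2 * chi * phi p q) *: w).

Let cfE := ((fun i => formD (cfL i)), (fun i => formN (cfL i)),
  (fun i => formZ (cfL i)), (fun i => form0 (cfL i))).

Lemma phi_anti p q : phi p q = - phi q p.
Proof.
by have := phi_leibniz 1 p q; rewrite phi1 !mul1r => /esym/eqP; rewrite addr_eq0 => /eqP.
Qed.

(** The residue of d(p q z) is 0. *)
Lemma phi_cyclic p q z : phi p (q * z) + phi q (p * z) = phi (p * q) z.
Proof.
rewrite (phi_leibniz p) (phi_leibniz q) (mulrC q p) (phi_anti (p * z) q).
by rewrite (phi_leibniz q) (mulrC q p); ring.
Qed.

(** By the Jacobi identity the difference commutes with fa z, since p q z and q p z
are equal, and it has charge 0. *)
Lemma h_h p q w : h p (h q w) - h q (h p w) = (2 * chi * phi p q) *: w.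
Proof.
apply/eqP; rewrite -subr_eq0; apply/eqP.
apply: (vanish (kap := 0) _ _ _ _ (fun _ => @h_h_vacuum p q)) w => //.
- move=> a u v; apply: cf_inj => i; rewrite !(hL, cfE); ring.
- move=> z w; rewrite !h_fa !(linD (hL _), linN (hL _), linZ (hL _), h_fa).
  rewrite !(linD (faL _), linN (faL _), linZ (faL _)) !mulrA (mulrC q p).
  apply: cf_inj => i; rewrite !cfE; ring.
- move=> w; rewrite !(linD CL, linN CL, linZ CL) !C_h scale0r addr0 //.
Qed.

(** The difference has charge 1; by the Jacobi identity it commutes with fa z up
to the defect of the relation for h and h and the cyclic sum of phi, which vanish. *)
Lemma h_e p q w : h p (e q w) - e q (h p w) = 2 *: e (p * q) w.
Proof.
apply/eqP; rewrite -subr_eq0; apply/eqP.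
apply: (vanish (F := fun w => h p (e q w) - e q (h p w) - 2 *: e (p * q) w)
  (kap := 1)) w => //.
- move=> a u v; apply: cf_inj => i; rewrite !(hL, eL, cfE); ring.
- move=> z w; rewrite !(h_fa, e_fa, linD (hL _), linN (hL _), linZ (hL _),
    linD (eL _), linN (eL _), linZ (eL _)).
  have hh := h_h p (q * z) w.
  have -> : h p (h (q * z) w) = h (q * z) (h p w) + (2 * chi * phi p (q * z)) *: w.
    by rewrite -hh addrC subrK.
  rewrite !(h_fa, e_fa, linD (faL _), linN (faL _), linZ (faL _)).
  rewrite !mulrA (mulrC q p) -(phi_cyclic p q z).
  apply: cf_inj => i; rewrite !cfE; ring.
- move=> w; rewrite !(linD CL, linN CL, linZ CL, C_e, C_h, linD (hL _), linD (eL _)).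
  apply: cf_inj => i; rewrite !cfE; ring.
Qed.

(** As before, with charge 2 and the relation between h and e. *)
Lemma e_e p q w : e p (e q w) = e q (e p w).
Proof.
apply/eqP; rewrite -subr_eq0; apply/eqP.
apply: (vanish (F := fun w => e p (e q w) - e q (e p w)) (kap := 2)) w => //.
- move=> a u v; apply: cf_inj => i; rewrite !(eL, cfE); ring.
- move=> z w; rewrite !(e_fa, linD (eL _), linN (eL _), linZ (eL _)).
  have he p' q' : e q' (h p' w) = h p' (e q' w) - 2 *: e (p' * q') w.
    by rewrite -(h_e p' q' w) opprB addrC subrK.
  rewrite !(he, e_fa, linD (faL _), linN (faL _), linZ (faL _)).
  rewrite (mulrAC p z q) (mulrAC q z p) (mulrC q p).
  apply: cf_inj => i; rewrite !cfE; ring.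
- move=> w; rewrite !(linD CL, linN CL, C_e, linD (eL _)).
  apply: cf_inj => i; rewrite !cfE; ring.
Qed.

Definition sl2_action (x : sl2 A) w := e x.1.1 w - fa x.1.2 w + h x.2 w.

Lemma sl2_action_comm (a b d a' b' d' : A) w :
  let x : sl2 A := (a, b, d) in let y : sl2 A := (a', b', d') in
  sl2_action x (sl2_action y w) - sl2_action y (sl2_action x w)
  = sl2_action (sl2_bracket x y) w
    + (chi * (phi a b' + phi b a' + phi d d' *+ 2)) *: w.
Proof.
rewrite /sl2_action /=.
rewrite !(linD (eL _), linN (eL _), linD (hL _), linN (hL _), linD (faL _),
  linN (faL _)).
have he p' q' : e q' (h p' w) = h p' (e q' w) - 2 *: e (p' * q') w.
  by rewrite -(h_e p' q' w) opprB addrC subrK.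
rewrite !(e_fa, h_fa, he) (e_e a a') (fa_fa b b').
have -> : h d (h d' w) = h d' (h d w) + (2 * chi * phi d d') *: w.
  by rewrite -h_h addrC subrK.
have eD p' q' : e (p' - q') w = e p' w - e q' w := linB (e_lin w) p' q'.
have hD p' q' : h (p' - q') w = h p' w - h q' w := linB (h_lin w) p' q'.
have aD p' q' : fa (p' - q') w = fa p' w - fa q' w := linB (fa_lin w) p' q'.
have e2 p' : e (p' *+ 2) w = e p' w *+ 2 := linMn (e_lin w) p' 2.
have a2 p' : fa (p' *+ 2) w = fa p' w *+ 2 := linMn (fa_lin w) p' 2.
rewrite !(e2, a2, eD, hD, aD) (phi_anti b a') (mulrC b d') (mulrC b a') (mulrC a d').
by apply: cf_inj => i; rewrite !mulr2n !cfE; ring.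
Qed.

End CurrentAlgebra.

(** * The monomial basis of the coordinate ring *)

Section LaurentBasis.
Variables (K : numFieldType) (U : lmodType K) (g : int -> U).
Implicit Types p q : laurent K.

Lemma lcoeffD p q m : (p + q : laurent K)@_m = p@_m + q@_m.
Proof. exact: (@mcoeffD _ _ m (p : {malg K[int]}) q). Qed.

Lemma lcoeffZ a p m : (a *: p : laurent K)@_m = a * p@_m.
Proof. exact: (@mcoeffZ _ _ a (p : {malg K[int]}) m). Qed.

Lemma lcoeff_lin a p q m : (a *: p + q : laurent K)@_m = a * p@_m + q@_m.
Proof. exact: etrans (lcoeffD (a *: p) q m) (f_equal (+%R^~ _) (lcoeffZ a p m)). Qed.

Definition lsum p : U := \sum_(m <- msupp p) p@_m *: g m.

Lemma lsumE p (D : {fset int}) : (msupp p `<=` D)%fset ->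
  lsum p = \sum_(m <- D) p@_m *: g m.
Proof.
move=> le; rewrite /lsum (big_fset_incl _ le) // => m _ /mcoeff_outdom ->.
by rewrite scale0r.
Qed.

Lemma lsum_linear : linear lsum.
Proof.
move=> a p q; set u : laurent K := a *: p + q.
pose D := (msupp u `|` (msupp p `|` msupp q))%fset.
have Du : (msupp u `<=` D)%fset by exact: fsubsetUl.
have Dp : (msupp p `<=` D)%fset.
  by apply: fsubset_trans (fsubsetUr _ _); exact: fsubsetUl.
have Dq : (msupp q `<=` D)%fset.
  by apply: fsubset_trans (fsubsetUr _ _); exact: fsubsetUr.
rewrite (lsumE Du) (lsumE Dp) (lsumE Dq) scaler_sumr -big_split /=.
apply: eq_bigr => m _; rewrite scalerA -scalerDl; congr (_ *: _).
exact: lcoeff_lin.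
Qed.

Lemma lsum_monom m : lsum (<< m >> : laurent K) = g m.
Proof.
rewrite /lsum msuppU oner_eq0 big_seq_fset1.
by rewrite (_ : _@__ = 1) ?scale1r //; exact: mcoeffUU.
Qed.

End LaurentBasis.

Section DJKMBasis.
Variables (K : numFieldType) (c : K).
Local Notation A := (djkm_ring c).
Local Notation tu := (djkm_tu c).

Definition tu_lift (U : lmodType K) (g : bool -> int -> U) (x : A) : U :=
  lsum (g false) (djkm_val x).1 + lsum (g true) (djkm_val x).2.

Lemma tu_lift_linear (U : lmodType K) (g : bool -> int -> U) : linear (tu_lift g).
Proof.
move=> a [[p q]] [[p' q']]; rewrite /tu_lift /=.
have -> := lsum_linear (g false) a p p'; have -> := lsum_linear (g true) a q q'.
by rewrite scalerDr addrACA.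
Qed.

Lemma tu_liftE (U : lmodType K) (g : bool -> int -> U) s m : tu_lift g (tu s m) = g s m.
Proof.
rewrite /tu_lift; case: s => /=; rewrite lsum_monom (lin0 (lsum_linear _)).
  by rewrite add0r.
by rewrite addr0.
Qed.

Lemma lsum_id (p : laurent K) : lsum (fun m => << m >> : laurent K) p = p.
Proof.
rewrite [RHS]monalgE /lsum; apply: eq_bigr => m _.
by apply/malgP => k; rewrite lcoeffZ !mcoeffU; case: (m == k);
  rewrite /= ?mulr0 ?mulr1n ?mulr1.
Qed.

Lemma djkm_pairD (p q p' q' : laurent K) :
  Djkm (p, q) + Djkm (p', q') = Djkm (p + p', q + q') :> A.
Proof. by []. Qed.

Lemma djkm_pairZ a (p q : laurent K) : a *: (Djkm (p, q) : A) = Djkm (a *: p, a *: q).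
Proof. by []. Qed.

Lemma tu_lift_id (x : A) : tu_lift tu x = x.
Proof.
case: x => [[p q]]; rewrite /tu_lift /lsum /=.
have F (r : laurent K) : \sum_(m <- msupp r) r@_m *: tu false m = Djkm (r, 0).
  rewrite -[in RHS](lsum_id r) /lsum.
  rewrite (big_morph (fun z : laurent K => Djkm (z, 0) : A) (id1 := 0) (op1 := +%R)) //.
    by apply: eq_bigr => m _; rewrite djkm_pairZ scaler0.
  by move=> y z; rewrite djkm_pairD addr0.
have G (r : laurent K) : \sum_(m <- msupp r) r@_m *: tu true m = Djkm (0, r).
  rewrite -[in RHS](lsum_id r) /lsum.
  rewrite (big_morph (fun z : laurent K => Djkm (0, z) : A) (id1 := 0) (op1 := +%R)) //.
    by apply: eq_bigr => m _; rewrite djkm_pairZ scaler0.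
  by move=> y z; rewrite djkm_pairD addr0.
by rewrite F G djkm_pairD addr0 add0r.
Qed.

Lemma tu_ext (U : lmodType K) (f f' : A -> U) : linear f -> linear f' ->
  (forall s m, f (tu s m) = f' (tu s m)) -> f =1 f'.
Proof.
move=> fL f'L E x; rewrite -(tu_lift_id x) /tu_lift /lsum.
rewrite !(linD fL, linD f'L) !(lin_sum fL, lin_sum f'L).
by congr (_ + _); apply: eq_bigr => m _; rewrite (linZ fL) (linZ f'L) E.
Qed.

Lemma lmonomM m n : (<< m >> : laurent K) * << n >> = << m + n >>.
Proof. by have := lmulUU (1 : K) 1 m n; rewrite mul1r. Qed.

Lemma lmonomX n : (laurent_t K) ^+ n = << n%:Z >>.
Proof.
elim: n => [|n IH]; first by rewrite expr0.
by rewrite exprS IH lmonomM; congr << _ >>; lia.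
Qed.

Lemma djkm_pairM (p q p' q' : laurent K) : (Djkm (p, q) : A) * Djkm (p', q')
  = Djkm (p * p' + laurent_P c * (q * q'), p * q' + q * p').
Proof. by []. Qed.

Lemma laurent_PM n : laurent_P c * (<< n >> : laurent K) =
  << n + 4 >> - (2 * c) *: (<< n + 2 >> : laurent K) + << n >>.
Proof.
rewrite /laurent_P !lmonomX mulrDl mulrBl mul1r -scalerAl !lmonomM.
by rewrite (addrC _ n) (addrC _ n).
Qed.

Definition tu_mul s t m n : A :=
  if s && t then tu false (m + n + 4) - (2 * c) *: tu false (m + n + 2) + tu false (m + n)
  else tu (s (+) t) (m + n).

Lemma tuM s t m n : tu s m * tu t n = tu_mul s t m n.
Proof.
rewrite /djkm_tu /tu_mul; case: s; case: t; rewrite djkm_pairM /=.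
- rewrite lmonomM laurent_PM mul0r mulr0 addr0 add0r.
  set X := << _ >>; set Y := << _ >>; set Z := << _ >>.
  transitivity (Djkm (X - (2 * c) *: Y + Z, 0 - (2 * c) *: (0 : laurent K) + 0) : A) => //.
  by rewrite scaler0 subr0 addr0 mul0r.
- by rewrite lmonomM !mul0r !mulr0 ?(add0r, addr0).
- by rewrite lmonomM !mul0r !mulr0 ?(add0r, addr0).
- by rewrite lmonomM !mul0r !mulr0 ?(add0r, addr0).
Qed.

Lemma tu1 : tu false 0 = 1.
Proof. by []. Qed.

Lemma poly_sum (U : lmodType K) (f : nat -> U) :
  \sum_(i < size (djkm_poly c)) (djkm_poly c)`_i *: f i
  = f 4 - (2 * c) *: f 2 + f 0.
Proof.
have le : (size (djkm_poly c) <= 5)%N.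
  rewrite /djkm_poly (leq_trans (size_polyD _ _)) // geq_max size_poly1 andbT.
  rewrite (leq_trans (size_polyD _ _)) // geq_max size_polyXn /= size_polyN.
  by rewrite (leq_trans (size_scale_leq _ _)) // size_polyXn.
transitivity (\sum_(i < 5) (djkm_poly c)`_i *: f i).
  rewrite (big_ord_widen 5 (fun i => (djkm_poly c)`_i *: f i) le).
  rewrite [RHS](bigID (fun i : 'I_5 => (i < size (djkm_poly c))%N)) /=.
  rewrite [X in _ = _ + X]big1 ?addr0 // => i; rewrite -leqNgt => ile.
  by rewrite nth_default // scale0r.
rewrite !big_ord_recr big_ord0 /= /djkm_poly !coefD !coefN !coefZ !coefXn !coef1 /=.
rewrite !(mulr0, mulr1, oppr0, addr0, add0r, scale0r, scale1r) scaleNr.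
by rewrite [RHS]addrC addrCA addrC.
Qed.

End DJKMBasis.

(** * Kaehler differentials modulo exact forms *)

Section QuotientFactor.
Variables (K : pzRingType) (V : lmodType K) (G : set V) (U : zmodType).
Variable f : V -> U.
Hypothesis fB : forall u v, f (u - v) = f u - f v.
Hypothesis fG : forall v, v \in mspan G -> f v = 0.

Definition qfactor (q : mquot G) : U := f (repr q).

Lemma qfactor_mpi v : qfactor (mpi G v) = f v.
Proof.
apply/eqP; rewrite -subr_eq0 -fB; apply/eqP/fG.
by apply/(@mpiP K V G); rewrite mpiK.
Qed.

Lemma mpi_scale a v : mpi G (a *: v) = a *: mpi G v.
Proof. exact: mpiZ. Qed.

Lemma mpiB u v : mpi G (u - v) = mpi G u - mpi G v.
Proof. exact: (raddfB (mpi G)). Qed.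

Lemma mpi0 : mpi G 0 = 0.
Proof. by apply: (addrI (mpi G 0)); rewrite -mpi_is_additive !addr0. Qed.

Lemma mpi_gen0 v : G v -> mpi G v = 0.
Proof.
move=> Gv; rewrite -mpi0; apply/mpiP; rewrite subr0; apply/asboolP.
exists [:: (1, v)]; split; last by rewrite big_seq1 scale1r.
by move=> y; rewrite inE => /eqP ->.
Qed.

End QuotientFactor.

Section KahlerFunctional.
Variables (K : comNzRingType) (A : comAlgType K) (phi : A -> A -> K).
Implicit Types (a b z : A).
Hypothesis phiDl : forall a b z, phi (a + b) z = phi a z + phi b z.
Hypothesis phiDr : forall a b z, phi a (b + z) = phi a b + phi a z.
Hypothesis phiZl : forall k a b, phi (k *: a) b = k * phi a b.
Hypothesis phi_leibniz : forall a b z, phi a (b * z) = phi (a * b) z + phi (a * z) b.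
Hypothesis phi_scalar : forall a k, phi a k%:A = 0.
Hypothesis phi1 : forall a, phi 1 a = 0.

Let phi0 z : phi 0 z = 0.
Proof. by apply: (addrI (phi 0 z)); rewrite -phiDl !addr0. Qed.

Definition free_form (v : {malg A[A]}) : K := \sum_(b <- msupp v) phi v@_b b.

Lemma free_formE v (D : {fset A}) : (msupp v `<=` D)%fset ->
  free_form v = \sum_(b <- D) phi v@_b b.
Proof.
move=> le; rewrite /free_form (big_fset_incl _ le) // => b _ /mcoeff_outdom ->.
exact: phi0.
Qed.

Lemma free_formD u v : free_form (u + v) = free_form u + free_form v.
Proof.
pose D := (msupp (u + v) `|` (msupp u `|` msupp v))%fset.
have Du : (msupp (u + v) `<=` D)%fset by exact: fsubsetUl.
have Dp : (msupp u `<=` D)%fset.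
  by apply: fsubset_trans (fsubsetUr _ _); exact: fsubsetUl.
have Dq : (msupp v `<=` D)%fset.
  by apply: fsubset_trans (fsubsetUr _ _); exact: fsubsetUr.
rewrite (free_formE Du) (free_formE Dp) (free_formE Dq) -big_split /=.
by apply: eq_bigr => b _; rewrite mcoeffD phiDl.
Qed.

Lemma free_formN v : free_form (- v) = - free_form v.
Proof.
apply/eqP; rewrite -addr_eq0 -free_formD addNr /free_form msupp0.
by rewrite big_seq_fset0.
Qed.

Lemma free_formU a b : free_form << a *g b >> = phi a b.
Proof. by rewrite (free_formE msuppU_le) big_seq_fset1 mcoeffUU. Qed.

Lemma malgZU a a' b : a *: (<< a' *g b >> : {malg A[A]}) = << a * a' *g b >>.
Proof. by apply/malgP => k; rewrite mcoeffZ !mcoeffU mulrnAr. Qed.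

Lemma free_formZ k v : free_form (k%:A *: v) = k * free_form v.
Proof.
have le : (msupp (k%:A *: v) `<=` msupp v)%fset := msuppZ_le _ _.
rewrite (free_formE le) /free_form mulr_sumr; apply: eq_bigr => b _.
by rewrite mcoeffZ -scalerAl mul1r phiZl.
Qed.

Lemma free_form_rel v : v \in mspan (@kahler_rel K A) -> free_form v = 0.
Proof.
move=> /asboolP[s [sG ->]].
elim: s sG => [|z s IH] sG.
  by rewrite big_nil /free_form msupp0 big_seq_fset0.
rewrite big_cons free_formD IH => [|y ys]; last by apply: sG; rewrite inE ys orbT.
rewrite addr0; case: z sG => a v' /= sG.
have /= := sG (a, v') (mem_head _ _).
case=> [[b [b' ->]]|[b [b' ->]]|[k ->]].
- rewrite !scalerBr !malgZU !(free_formD, free_formN) !free_formU.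
  by rewrite !mulr1 phiDr -addrA -opprD subrr.
- rewrite !scalerBr !scalerA !malgZU !(free_formD, free_formN) !free_formU.
  by rewrite !mulr1 phi_leibniz -addrA -opprD subrr.
- by rewrite malgZU free_formU phi_scalar.
Qed.

Definition kahler_form : kahler A -> K := @qfactor _ _ (@kahler_rel K A) _ free_form.

Lemma kahler_form_mpi v : kahler_form (mpi _ v) = free_form v.
Proof.
apply: qfactor_mpi => [x y|x]; first by rewrite free_formD free_formN.
exact: free_form_rel.
Qed.

Lemma kahler_formD u v : kahler_form (u + v) = kahler_form u + kahler_form v.
Proof.
rewrite -[u]mpiK -[v]mpiK -mpi_is_additive !kahler_form_mpi; exact: free_formD.
Qed.

Lemma kahler_form0 : kahler_form 0 = 0.
Proof. by apply: (addrI (kahler_form 0)); rewrite -kahler_formD !addr0. Qed.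

Lemma kahler_formZ k (u : restr (kahler A)) : kahler_form (k *: u) = k * kahler_form u.
Proof.
rewrite -(mpiK (u : kahler A)) /GRing.scale /= /restr_scale.
have -> : k%:A *: (mpi _ (repr (u : kahler A)) : kahler A)
   = mpi _ (k%:A *: repr (u : kahler A)) by rewrite mpi_scale.
by rewrite !kahler_form_mpi free_formZ.
Qed.

Lemma kahler_formZd a b : kahler_form (a *: kd b) = phi a b.
Proof.
have -> : a *: kd b = mpi _ (a *: << b >>) :> kahler A by rewrite mpi_scale.
by rewrite kahler_form_mpi malgZU mulr1 free_formU.
Qed.

Lemma kahler_form_exact (v : restr (kahler A)) :
  v \in mspan (@kahler_exact K A) -> kahler_form v = 0.
Proof.
move=> /asboolP[s [sG ->]].
elim: s sG => [|z s IH] sG; first by rewrite big_nil kahler_form0.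
rewrite big_cons kahler_formD IH => [|y ys]; last by apply: sG; rewrite inE ys orbT.
rewrite addr0 kahler_formZ; have [b _ <-] := sG z (mem_head _ _).
by rewrite -[kd b]scale1r kahler_formZd phi1 mulr0.
Qed.

(** The linear form with value phi a b on the class of a db.  The relations among
differentials are respected because phi obeys the Leibniz rule and kills scalars in
its second argument, exact forms because phi 1 b = 0. *)
Definition residue : kahler_mod_exact A -> K :=
  @qfactor _ _ (@kahler_exact K A) _ kahler_form.

Lemma residue_mpi v : residue (mpi _ v) = kahler_form v.
Proof.
apply: qfactor_mpi => [x y|x]; last exact: kahler_form_exact.
rewrite kahler_formD; congr (_ + _); apply/eqP; rewrite -addr_eq0.
by rewrite -kahler_formD addNr kahler_form0.
Qed.

Lemma residue_kcls a b : residue (kcls a b) = phi a b.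
Proof. by rewrite residue_mpi kahler_formZd. Qed.

Lemma residue_linear k (u v : kahler_mod_exact A) :
  residue (k *: u + v) = k * residue u + residue v.
Proof.
rewrite -[u]mpiK -[v]mpiK -mpi_scale -mpi_is_additive !residue_mpi.
by rewrite kahler_formD kahler_formZ.
Qed.

End KahlerFunctional.

Section KahlerGenerators.
Variables (K : comNzRingType) (A : comAlgType K).
Implicit Types a b z : A.

Lemma kclsDl a b z : kcls (a + b) z = kcls a z + kcls b z.
Proof.
rewrite /kcls -mpi_is_additive; congr (mpi _ _).
exact: (scalerDl (kd z : kahler A) a b).
Qed.

Lemma kdD a b : kd (a + b) = kd a + kd b :> kahler A.
Proof.
apply/eqP; rewrite -subr_eq0 opprD addrA; apply/eqP.
rewrite -(mpi_gen0 (v := << a + b >> - << a >> - << b >>)); last first.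
  by apply: Or31; exists a, b.
by rewrite !mpiB.
Qed.

Lemma kdM a b : kd (a * b) = a *: kd b + b *: kd a :> kahler A.
Proof.
apply/eqP; rewrite -subr_eq0 opprD addrA; apply/eqP.
rewrite -(mpi_gen0 (v := << a * b >> - a *: << b >> - b *: << a >>)); last first.
  by apply: Or32; exists a, b.
by rewrite !mpiB !mpi_scale.
Qed.

Lemma kdZ k a : kd (k *: a) = k%:A *: kd a :> kahler A.
Proof.
rewrite -[k *: a]mulr_algl kdM.
rewrite (_ : kd k%:A = 0) ?scaler0 ?addr0 //.
by apply: mpi_gen0; apply: Or33; exists k.
Qed.

Lemma kclsZl k a b : kcls (k *: a) b = k *: kcls a b.
Proof.
rewrite /kcls -[RHS](mpi_scale (@kahler_exact K A)); congr (mpi _ _).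
rewrite -[k *: a]mulr_algl.
exact: (esym (scalerA k%:A a (kd b : kahler A))).
Qed.

Lemma kclsDr a b z : kcls a (b + z) = kcls a b + kcls a z.
Proof.
rewrite /kcls -mpi_is_additive kdD; congr (mpi _ _).
exact: (scalerDr a (kd b : kahler A) (kd z)).
Qed.

Lemma kclsZr k a b : kcls a (k *: b) = k *: kcls a b.
Proof.
have E : a *: (k%:A *: kd b) = k%:A *: (a *: kd b) :> kahler A.
  apply: etrans (scalerA a k%:A (kd b : kahler A)) _; rewrite mulrC.
  exact: (esym (scalerA k%:A a (kd b : kahler A))).
rewrite /kcls (kdZ k b) E.
exact: (mpi_scale (@kahler_exact K A) k (a *: kd b)).
Qed.

Lemma kcls_leibniz a b z : kcls a (b * z) = kcls (a * b) z + kcls (a * z) b.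
Proof.
have E : a *: kd (b * z) = (a * b) *: kd z + (a * z) *: kd b :> kahler A.
  by rewrite kdM scalerDr !scalerA.
by rewrite /kcls E; exact: mpi_is_additive.
Qed.

Lemma kcls1 a : kcls 1 a = 0.
Proof.
by rewrite /kcls scale1r; apply: mpi_gen0; exists a.
Qed.

(** The classes of the a db span since the symbols db generate the differentials. *)
Lemma kcls_span (V : lmodType K) (f : kahler_mod_exact A -> V) : linear f ->
  (forall a b, f (kcls a b) = 0) -> forall q, f q = 0.
Proof.
move=> fL f0 q; rewrite -(mpiK q); set u := repr q.
rewrite -(mpiK (u : kahler A)); set v := repr _.
rewrite (monalgE v).
pose g (w : {malg A[A]}) := f (mpi (@kahler_exact K A) (mpi (@kahler_rel K A) w : kahler A)).
have gD w w' : g (w + w') = g w + g w'.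
  by rewrite /g mpi_is_additive mpi_is_additive (linD fL).
have g0 : g 0 = 0 by apply: (addrI (g 0)); rewrite -gD !addr0.
rewrite -/(g _) (big_morph g gD g0) big1 // => b _.
have -> : << v@_b *g b >> = v@_b *: << b >> :> {malg A[A]}.
  by rewrite malgZU mulr1.
by rewrite /g mpi_scale; exact: f0.
Qed.

End KahlerGenerators.

(** * The residue pairing of the coordinate ring *)

Ltac decide_int_eqs := repeat match goal with
  | |- context [@eq_op ?T ?a ?b] =>
      first [ have -> : @eq_op T a b = true by lia
            | have -> : @eq_op T a b = false by lia ]
  end.
Section DJKMPairing.
Variables (K : numFieldType) (c : K).
Local Notation A := (djkm_ring c).
Local Notation tu := (djkm_tu c).
Local Notation P := (djkm_poly c).

Lemma pairing_djkm s t m n : pairing P s t m n =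
  if s && t then
    (n + 2)%:~R *+ (m + n + 4 == 0) - 2 * c * ((n + 1)%:~R *+ (m + n + 2 == 0))
    + n%:~R *+ (m + n == 0)
  else if s || t then 0 else n%:~R *+ (m + n == 0).
Proof.
rewrite /pairing; case: (s && t) => //.
pose f (i : nat) : K^o := (n%:~R + i%:R / 2) *+ (m + n + i%:Z == 0).
rewrite (eq_bigr (fun i : 'I__ => P`_i *: f i)); last first.
  by move=> i _; rewrite -mulrnAr.
rewrite poly_sum /f; congr (_ *+ _ - _ * (_ *+ _) + _ *+ _).
- by rewrite intrD; field.
- by rewrite intrD; field.
- by rewrite mul0r addr0.
- by rewrite addr0.
Qed.

(** The coefficient of omega_0 in the class of x dy. *)
Definition phi (x y : A) : K := tu_lift (U := K^o) (fun s m =>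
  tu_lift (U := K^o) (fun t n => pairing P s t m n) y) x.

Lemma phi_tu s t m n : phi (tu s m) (tu t n) = pairing P s t m n.
Proof. by rewrite /phi !tu_liftE. Qed.

Lemma phi_linl y : linear (phi^~ y : A -> K^o).
Proof. exact: tu_lift_linear. Qed.

Lemma phi_linr x : linear (phi x : A -> K^o).
Proof.
move=> a y z.
apply: (tu_ext (f := fun x => phi x (a *: y + z) : K^o)
               (f' := fun x => a *: (phi x y : K^o) + phi x z)).
- exact: phi_linl.
- move=> b u v; have E w := phi_linl w b u v.
  rewrite (E y) (E z) !scalerDr !scalerA (mulrC a b) addrACA; congr (_ + _).
- by move=> s m; rewrite /phi !tu_liftE; exact: tu_lift_linear.
Qed.

Lemma phiL k x y z : phi (k *: x + y) z = k * phi x z + phi y z.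
Proof. exact: phi_linl. Qed.

Lemma phiR k x y z : phi x (k *: y + z) = k * phi x y + phi x z.
Proof. exact: phi_linr. Qed.

Lemma tuM_lin (U : lmodType K) (f : A -> U) s t m n : linear f ->
  f (tu s m * tu t n) =
    if s && t then f (tu false (m + n + 4)) - (2 * c) *: f (tu false (m + n + 2))
                   + f (tu false (m + n))
    else f (tu (s (+) t) (m + n)).
Proof.
move=> fL; rewrite tuM /tu_mul; case: (s && t) => //.
by rewrite (linD fL) (linB fL) (linZ fL).
Qed.

(** On monomials, with m + n + l the sum of the exponents of t, a term is nonzero
only if this sum is 0, -2 or -4, and in each of these cases the identity is one between
coefficients of P. *)
Lemma phi_leibniz x y z : phi x (y * z) = phi (x * y) z + phi (x * z) y.
Proof.
have ML (a : A) : linear (fun b => a * b).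
  by move=> k u v; rewrite mulrDr -scalerAr.
have MR (a : A) : linear (fun b => b * a).
  by move=> k u v; rewrite mulrDl -scalerAl.
move: x; apply: (tu_ext (f := fun x => phi x (y * z) : K^o)
    (f' := fun x => (phi (x * y) z : K^o) + phi (x * z) y)).
- exact: phi_linl.
- move=> k u v /=; rewrite (MR y) (MR z).
  by rewrite !phiL /GRing.scale /=; ring.
move=> s m; move: y; apply: (tu_ext (f := fun y => phi (tu s m) (y * z) : K^o)
    (f' := fun y => (phi (tu s m * y) z : K^o) + phi (tu s m * z) y)).
- move=> k u v /=; rewrite (MR z); exact: phi_linr.
- move=> k u v /=; rewrite (ML (tu s m)).
  by rewrite phiL phiR /GRing.scale /=; ring.
move=> t n; move: z; apply: (tu_ext (f := fun z => phi (tu s m) (tu t n * z) : K^o)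
    (f' := fun z => (phi (tu s m * tu t n) z : K^o) + phi (tu s m * z) (tu t n))).
- move=> k u v /=; rewrite (ML (tu t n)); exact: phi_linr.
- move=> k u v /=; rewrite (ML (tu s m)).
  by rewrite phiL phiR /GRing.scale /=; ring.
move=> v l.
rewrite (tuM_lin t v n l (phi_linr (tu s m))).
rewrite (tuM_lin s t m n (phi_linl (tu v l))) (tuM_lin s v m l (phi_linl (tu t n))).
rewrite !phi_tu !pairing_djkm /GRing.scale /=.
have cases : m + n + l = 0 \/ (m + n + l + 2 = 0 \/ (m + n + l + 4 = 0 \/
  (m + n + l != 0 /\ (m + n + l + 2 != 0 /\ m + n + l + 4 != 0)))) by lia.
by case: s t v => -[] [] /=; case: cases => [H|[H|[H|[H [H' H'']]]]];
  decide_int_eqs; rewrite ?(mulr0n, mulr1n) ?intrD; ring.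
Qed.

Lemma phi1 x : phi 1 x = 0.
Proof.
move: x; apply: (tu_ext (f := phi 1 : A -> K^o) (f' := fun _ => 0)).
- exact: phi_linr.
- by move=> k u v; rewrite scaler0 addr0.
- move=> s m; rewrite -tu1 phi_tu pairing_djkm add0r.
  by case: s => //=; case: eqP => [->|_].
Qed.

Lemma phi_scalar x k : phi x k%:A = 0.
Proof.
have -> : phi x k%:A = k * phi x 1 by exact: (linZ (phi_linr x) k 1).
by have := phi_leibniz x 1 1; rewrite !mulr1 -[LHS]addr0 => /addrI <-; rewrite mulr0.
Qed.

End DJKMPairing.

(** * The five classes omega span *)

(** A bilinear map g with the formal properties of the class of x dy vanishes as soon
as it kills the five classes omega.  All values reduce to the vectors g (t^m u) t,
which satisfy a three-term recurrence. *)
Section Vanishing.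
Variables (K : numFieldType) (A : comAlgType K) (c : K) (tu : bool -> int -> A).
Hypothesis tu1 : tu false 0 = 1.
Hypothesis tuMf : forall s m n, tu s m * tu false n = tu s (m + n).
Hypothesis tuMt : forall m n, tu true m * tu true n =
  tu false (m + n + 4) - (2 * c) *: tu false (m + n + 2) + tu false (m + n).
Variables (V : lmodType K) (g : A -> A -> V).
Hypothesis gLl : forall z, linear (g^~ z).
Hypothesis gLr : forall x, linear (g x).
Hypothesis g_leibniz : forall x y z, g x (y * z) = g (x * y) z + g (x * z) y.
Hypothesis g1 : forall x, g 1 x = 0.
Local Notation t := (tu false 1).
Local Notation u := (tu true 0).
Hypothesis g_omega0 : g (tu false (-1)) t = 0.
Hypothesis g_omegaN : forall k : nat, (1 <= k <= 4)%N -> g (tu true (- k%:Z)) t = 0.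

Lemma g_anti x y : g x y = - g y x.
Proof.
have := g_leibniz 1 x y; rewrite g1 !mul1r => /esym/eqP.
by rewrite addr_eq0 => /eqP.
Qed.

Lemma int_step_ind (Q : int -> Prop) : Q 0 -> (forall n, Q n -> Q (n + 1)) ->
  (forall n, Q (n + 1) -> Q n) -> forall n, Q n.
Proof.
move=> Q0 up down; elim/int_rec => [//|n /up|n Qn].
  by have -> : n.+1%:Z = n%:Z + 1 by lia.
by apply: down; have -> : - n.+1%:Z + 1 = - n%:Z by lia.
Qed.

Lemma g_pow x n : g x (tu false n) = n%:~R *: g (x * tu false (n - 1)) t.
Proof.
have step y k : g y (tu false (k + 1)) = g (y * tu false k) t + g (y * t) (tu false k).
  by rewrite -(tuMf false k 1) g_leibniz.
have shift y k : y * t * tu false (k - 1) = y * tu false k.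
  by rewrite -mulrA (mulrC t) tuMf; congr (_ * tu _ _); lia.
move: n x; apply: int_step_ind => [x|n IH x|n IH x].
- rewrite scale0r tu1; have := g_leibniz x 1 1.
  by rewrite !mulr1 -[LHS]addr0 => /addrI.
- rewrite step IH shift (_ : n + 1 - 1 = n); last by lia.
  by rewrite intrD addrC scalerDl scale1r.
- have := step (x * tu false (-1)) n; rewrite IH.
  rewrite -!mulrA !tuMf (_ : -1 + (n + 1 - 1) = n - 1); last by lia.
  rewrite (_ : -1 + n = n - 1); last by lia.
  rewrite (_ : -1 + 1 = 0) // tu1 mulr1.
  by rewrite intrD scalerDl scale1r addrC => /addrI ->.
Qed.

Lemma g_monom_t m : g (tu false m) t = 0.
Proof.
case: (eqVneq (m + 1) 0) => [m1|m1]; first by rewrite (_ : m = -1) //; lia.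
have := g_pow 1 (m + 1); rewrite g1 mul1r (_ : m + 1 - 1 = m); last by lia.
move=> /esym/eqP; rewrite scaler_eq0 intr_eq0 (negbTE m1) => /eqP //.
Qed.

Lemma g_monom_u m : g (tu false m) u = - m%:~R *: g (tu true (m - 1)) t.
Proof.
rewrite g_anti g_pow scaleNr; congr (- (_ *: g _ _)).
by rewrite tuMf; congr tu; lia.
Qed.

Lemma g_poly (x : A) (m : int) : g x (tu true m * u) =
  (m + 4)%:~R *: g (x * tu false (m + 3)) t
  - (2 * c) *: ((m + 2)%:~R *: g (x * tu false (m + 1)) t)
  + m%:~R *: g (x * tu false (m - 1)) t.
Proof.
rewrite tuMt addr0 (linD (gLr x)) (linB (gLr x)) (linZ (gLr x)).
rewrite (g_pow x (m + 4)) (g_pow x (m + 2)) (g_pow x m).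
have -> : m + 4 - 1 = m + 3 by lia.
by have -> : m + 2 - 1 = m + 1 by lia.
Qed.

(** Both expressions of t^m u d(u^2): as the differential of a polynomial in t, and
as 2 t^m u^2 du. *)
Lemma g_recurrence m : (m + 6)%:~R *: g (tu true (m + 3)) t
  - (2 * c * (m + 3)%:~R) *: g (tu true (m + 1)) t
  + m%:~R *: g (tu true (m - 1)) t = 0.
Proof.
pose G k := g (tu true k) t.
have e1 : g (tu true m) (u * u) = 4 *: G (m + 3) - (2 * c) *: (2 *: G (m + 1)).
  rewrite (g_poly (tu true m) 0) !tuMf !add0r /G scale0r addr0.
  by [].
have e2 : g (tu true m) (u * u) = 2 *: g (tu true m * u) u.
  by rewrite g_leibniz scaler_nat mulr2n.
have e3 : g (tu true m * u) u = - (m + 4)%:~R *: G (m + 3)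
    + (2 * c) *: ((m + 2)%:~R *: G (m + 1)) - m%:~R *: G (m - 1).
  rewrite tuMt addr0 (linD (gLl u)) (linB (gLl u)) (linZ (gLl u)) !g_monom_u /G.
  have -> : m + 4 - 1 = m + 3 by lia.
  have -> : m + 2 - 1 = m + 1 by lia.
  by rewrite !scaleNr scalerN opprK.
have : 2^-1 *: (4 *: G (m + 3) - (2 * c) *: (2 *: G (m + 1)))
  - (- (m + 4)%:~R *: G (m + 3)
    + (2 * c) *: ((m + 2)%:~R *: G (m + 1)) - m%:~R *: G (m - 1)) = 0.
  by rewrite -e1 -e3 e2 scalerA mulVf ?scale1r ?subrr // pnatr_eq0.
rewrite -/(G _) -/(G _) -/(G _) => <-.
rewrite scalerBr !opprD !opprK !scalerA -!scaleNr opprK !addrA.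
rewrite -[X in _ = X + _]addrA addrACA -!scalerDl.
by congr (_ *: _ + _ *: _ + _ *: _); rewrite ?intrD; field.
Qed.

(** The exponents -1, ..., -4 are the initial values.  From them one goes up dividing
by m + 6 with m >= -3, and down dividing by m with m <= -4. *)
Lemma g_odd_t m : g (tu true m) t = 0.
Proof.
have up (n : nat) : g (tu true (n%:Z - 4)) t = 0.
  have [k] := ubnP n; elim: k n => // k IH n; rewrite ltnS => nk.
  case: (ltnP n 4) => n4.
    rewrite (_ : n%:Z - 4 = - (4 - n)%N%:Z); first by apply: g_omegaN; lia.
    by lia.
  have := g_recurrence (n%:Z - 7).
  have -> : n%:Z - 7 + 3 = n%:Z - 4 by lia.
  have -> : n%:Z - 7 + 1 = (n - 2)%N%:Z - 4 by lia.
  have -> : n%:Z - 7 - 1 = (n - 4)%N%:Z - 4 by lia.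
  rewrite (IH (n - 2)%N) ?(IH (n - 4)%N); try by lia.
  rewrite !scaler0 subr0 addr0 => /eqP; rewrite scaler_eq0 intr_eq0.
  by case/orP => [|/eqP //]; lia.
have down (n : nat) : g (tu true (- 1 - n%:Z)) t = 0.
  have [k] := ubnP n; elim: k n => // k IH n; rewrite ltnS => nk.
  case: (ltnP n 4) => n4.
    by rewrite (_ : - 1 - n%:Z = - n.+1%:Z); [apply: g_omegaN; lia|lia].
  have := g_recurrence (- n%:Z).
  have -> : - n%:Z + 3 = - 1 - (n - 4)%N%:Z by lia.
  have -> : - n%:Z + 1 = - 1 - (n - 2)%N%:Z by lia.
  have -> : - n%:Z - 1 = - 1 - n%:Z by lia.
  rewrite (IH (n - 2)%N) ?(IH (n - 4)%N); try by lia.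
  rewrite !scaler0 subr0 add0r => /eqP; rewrite scaler_eq0 intr_eq0.
  by case/orP => [|/eqP //]; lia.
case: (lerP (-4) m) => [le|lt].
  by have := up `|(m + 4)%R|%N; rewrite (_ : _ - 4 = m) //; lia.
by have := down `|(m + 1)%R|%N; rewrite (_ : -1 - _ = m) //; lia.
Qed.

Lemma g_tu0 s m s' n : g (tu s m) (tu s' n) = 0.
Proof.
have gt x k : g (tu x k) t = 0 by case: x; [exact: g_odd_t|exact: g_monom_t].
have gf x k l : g (tu x k) (tu false l) = 0 by rewrite g_pow tuMf gt scaler0.
have gfu k : g (tu false k) u = 0 by rewrite g_monom_u gt scaler0.
have fu k : tu false k * u = tu true k by rewrite mulrC tuMf add0r.
have gu k : g (tu true k) u = 0.
  have := g_leibniz (tu false k) u u; rewrite fu tuMt addr0.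
  rewrite (linD (gLr _)) (linB (gLr _)) (linZ (gLr _)) !gf scaler0 subr0 addr0.
  move=> /esym/eqP; rewrite -mulr2n -scaler_nat scaler_eq0 pnatr_eq0 /=.
  by move=> /eqP.
case: s'; last exact: gf.
rewrite -[n in LHS]add0r -tuMf g_leibniz tuMf.
have -> : g (tu s m * u) (tu false n) = 0.
  case: s; last by rewrite fu gf.
  rewrite tuMt (linD (gLl _)) (linB (gLl _)) (linZ (gLl _)) !gf.
  by rewrite scaler0 subr0 addr0.
by rewrite add0r; case: s; [exact: gu|exact: gfu].
Qed.

End Vanishing.

(** * The Heisenberg modes *)

(** Here y and e are the multiplications and derivations for the variables y, and B
is the action of the zero mode on the two-dimensional factor. *)
Section HeisenbergModes.
Variables (K : numFieldType) (W : lmodType K) (I : Type) (cf : I -> W -> K).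
Hypothesis cfL : forall i a u v, cf i (a *: u + v) = a * cf i u + cf i v.
Hypothesis cf_inj : forall u v, (forall i, cf i u = cf i v) -> u = v.
Variables (y e : bool -> int -> W -> W) (B : W -> W).
Implicit Types (s t : bool) (m n k : int) (w : W).
Hypothesis yL : forall s n, linear (y s n).
Hypothesis eL : forall s n, linear (e s n).
Hypothesis BL : linear B.
Hypothesis y_comm : forall s t m n w, y s m (y t n w) = y t n (y s m w).
Hypothesis e_comm : forall s t m n w, e s m (e t n w) = e t n (e s m w).
Hypothesis e_y : forall s t m n w, m < 0 -> n < 0 ->
  e s m (y t n w) = w *+ ((s == t) && (m == n)) + y t n (e s m w).
Hypothesis B_y : forall s n w, B (y s n w) = y s n (B w).
Hypothesis B_e : forall s n w, B (e s n w) = e s n (B w).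
Hypothesis e_fin : forall w, exists N : int, forall s n, n < N -> e s n w = 0.

Variables (c lam kap : K).

Definition bmode n w : W :=
  if n < 0 then y false n w
  else if n == 0 then lam *: w
  else (- (2 * n%:~R) * kap) *: e false (- n) w.

Definition b1mode n w : W :=
  let D (k : int) := kap *: e true k w in
  if n < 0 then
    y true n w - D (- 3) *+ (n == - 1) + D (- 1) *+ (n == - 3)
  else if n == 0 then
    - (4 *: D (- 4)) + (4 * c) *: D (- 2) + B w
  else - ((2 * (n + 2)%:~R) *: D (- n - 4))
       + (4 * c * (n + 1)%:~R) *: D (- n - 2)
       - (2 * n%:~R) *: D (- n).

Definition hmode s : int -> W -> W := if s then b1mode else bmode.

(** A mode is the sum of a multiplication, a combination of derivations with explicit
coefficients, and a zero mode.  Two of these parts fail to commute only if one is a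
multiplication and the other consists of derivations, so that a commutator is a
difference of two contractions. *)
Definition creation s n w : W := if n < 0 then y s n w else 0.
Definition zero_mode s n w : W :=
  if n == 0 then (if s then B w else lam *: w) else 0.
Definition derivation_terms s n : seq (K * int) :=
  if s then
    if n < 0 then [:: (- (n == -1)%:R, -3); ((n == -3)%:R, -1)]
    else if n == 0 then [:: (-4, -4); (4 * c, -2)]
    else [:: (- (2 * (n + 2)%:~R), - n - 4); (4 * c * (n + 1)%:~R, - n - 2);
             (- (2 * n%:~R), - n)]
  else if 0 < n then [:: (- (2 * n%:~R), - n)] else [::].
Definition derivation s (L : seq (K * int)) w : W :=
  kap *: \sum_(z <- L) z.1 *: e s z.2 w.

Let cfE := ((fun i => formD (cfL i)), (fun i => formN (cfL i)),
  (fun i => formZ (cfL i)), (fun i => form0 (cfL i)), (fun i => formMn (cfL i))).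

Lemma hmodeE s n w : hmode s n w =
  creation s n w + derivation s (derivation_terms s n) w + zero_mode s n w.
Proof.
rewrite /hmode /derivation /derivation_terms /creation /zero_mode.
case: s; rewrite /b1mode /bmode /=; case: (ltgtP n 0) => n0;
  rewrite ?big_cons ?big_nil /=; apply: cf_inj => i;
  try (case: (n == -1); case: (n == -3));
  rewrite ?(cfE, mulr0n, mulr1n) /=; ring.
Qed.

Lemma derivation_neg s n z : z \in derivation_terms s n -> z.2 < 0.
Proof.
rewrite /derivation_terms; case: s; case: (ltgtP n 0) => n0;
  rewrite ?inE //; do ?[case/orP]; move=> /eqP -> //=; lia.
Qed.

Lemma creationL s n : linear (creation s n).
Proof.
by move=> a u v; rewrite /creation; case: ifP => _; rewrite ?yL // scaler0 addr0.
Qed.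

Lemma derivationL s L : linear (derivation s L).
Proof.
move=> a u v; rewrite /derivation scalerA mulrC -scalerA -scalerDr; congr (_ *: _).
rewrite scaler_sumr -big_split; apply: eq_bigr => z _ /=.
by rewrite eL scalerDr !scalerA mulrC.
Qed.

Lemma zero_modeL s n : linear (zero_mode s n).
Proof.
move=> a u v; rewrite /zero_mode; case: ifP => _; last by rewrite scaler0 addr0.
by case: s; rewrite ?BL // scalerDr !scalerA mulrC.
Qed.

Lemma hmodeL s n : linear (hmode s n).
Proof.
move=> a u v; rewrite !hmodeE creationL derivationL zero_modeL !scalerDr.
by rewrite -!addrA; congr (_ + _); rewrite !addrA; apply: cf_inj => i; rewrite !cfE; ring.
Qed.

Lemma hmode_commute (T : W -> W) : linear T ->
  (forall s n w, T (y s n w) = y s n (T w)) ->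
  (forall s n w, T (e s n w) = e s n (T w)) ->
  (forall w, T (B w) = B (T w)) ->
  forall s n w, T (hmode s n w) = hmode s n (T w).
Proof.
move=> TL Ty Te TB s n w; rewrite !hmodeE !(linD TL); congr (_ + _ + _).
- by rewrite /creation; case: ifP => _; rewrite ?(lin0 TL).
- rewrite /derivation (linZ TL) (lin_sum TL); congr (_ *: _).
  by apply: eq_bigr => z _; rewrite (linZ TL) Te.
- rewrite /zero_mode; case: ifP => _; last exact: lin0 TL.
  by case: (s); rewrite ?TB // (linZ TL).
Qed.

Lemma hmode_bounded s w : exists N : int, forall n, N < n -> hmode s n w = 0.
Proof.
have [N Ne] := e_fin w; exists `|N| => n nN.
rewrite hmodeE /creation /zero_mode !ifF; try lia.
rewrite addr0 add0r /derivation big1_seq ?scaler0 // => z /=.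
rewrite /derivation_terms; case: s; case: (ltgtP n 0) => n0; try lia;
  rewrite ?inE //; do ?[case/orP]; move=> /eqP -> /=; rewrite Ne ?scaler0 //; lia.
Qed.

Definition contraction s t (L : seq (K * int)) n : K :=
  if (n < 0) && (s == t) then \sum_(z <- L) z.1 *+ (z.2 == n) else 0.

Lemma derivation_creation s t m n w :
  derivation s (derivation_terms s m) (creation t n w) =
  creation t n (derivation s (derivation_terms s m) w)
  + (kap * contraction s t (derivation_terms s m) n) *: w.
Proof.
rewrite /creation /contraction; case: ifP => n0 /=; last first.
  by rewrite (lin0 (derivationL _ _)) mulr0 scale0r addr0.
rewrite /derivation (linZ (yL t n)) -scalerA -scalerDr; congr (_ *: _).
rewrite (lin_sum (yL t n)).
case: eqP => [<-|st].
  rewrite scaler_suml -big_split; apply: eq_big_seq => z /derivation_neg z0 /=.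
  rewrite (linZ (yL _ _)) e_y // eqxx /= scalerDr addrC; congr (_ + _).
  by rewrite -scalerMnr scalerMnl.
rewrite scale0r addr0; apply: eq_big_seq => z /derivation_neg z0.
rewrite (linZ (yL _ _)) e_y // (_ : (s == t) = false) ?add0r //; exact/eqP.
Qed.

Lemma derivation_derivation s t m n w :
  derivation s (derivation_terms s m) (derivation t (derivation_terms t n) w) =
  derivation t (derivation_terms t n) (derivation s (derivation_terms s m) w).
Proof.
have E s' L T : linear T -> (forall k v, T (e s' k v) = e s' k (T v)) ->
    forall v, T (derivation s' L v) = derivation s' L (T v).
  move=> TL Te v; rewrite /derivation (linZ TL) (lin_sum TL); congr (_ *: _).
  by apply: eq_bigr => z _; rewrite (linZ TL) Te.
apply: (E _ _ _ (derivationL _ _)) => k v.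
by rewrite (E s _ (e t k) (eL t k)).
Qed.

Lemma hmode_comm s t m n w : hmode s m (hmode t n w) - hmode t n (hmode s m w)
  = (kap * (contraction s t (derivation_terms s m) n
            - contraction t s (derivation_terms t n) m)) *: w.
Proof.
have zc s' t' m' n' v : zero_mode s' m' (hmode t' n' v) = hmode t' n' (zero_mode s' m' v).
  apply: hmode_commute; first exact: zero_modeL.
  - move=> s0 n0 v0; rewrite /zero_mode; case: ifP => _; last by rewrite (lin0 (yL _ _)).
    by case: (s'); rewrite ?B_y // (linZ (yL _ _)).
  - move=> s0 n0 v0; rewrite /zero_mode; case: ifP => _; last by rewrite (lin0 (eL _ _)).
    by case: (s'); rewrite ?B_e // (linZ (eL _ _)).
  - move=> v0; rewrite /zero_mode; case: ifP => _; last by rewrite (lin0 BL).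
    by case: (s'); rewrite // (linZ BL).
have [b' b'E] : exists b' : bool -> int -> W -> W, forall s m w, b' s m w
    = creation s m w + derivation s (derivation_terms s m) w.
  by exists (fun s m w => creation s m w + derivation s (derivation_terms s m) w).
have hE s' m' v : hmode s' m' v = b' s' m' v + zero_mode s' m' v by rewrite hmodeE b'E.
have b'L s' m' : linear (b' s' m').
  by move=> a u v; rewrite !b'E creationL derivationL scalerDr addrACA.
have zz s' t' m' n' v : zero_mode s' m' (zero_mode t' n' v)
    = zero_mode t' n' (zero_mode s' m' v).
  rewrite /zero_mode; case: (m' == 0); case: (n' == 0); case: (s'); case: (t') => //;
    by rewrite ?(linZ BL) ?(lin0 BL) ?scaler0 // !scalerA mulrC.
have zb s' t' m' n' v : zero_mode s' m' (b' t' n' v) = b' t' n' (zero_mode s' m' v).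
  have := zc s' t' m' n' v; rewrite !hE (linD (zero_modeL s' m')) zz.
  exact: addIr.
have b'b' : b' s m (b' t n w) = b' t n (b' s m w)
   + (kap * (contraction s t (derivation_terms s m) n
            - contraction t s (derivation_terms t n) m)) *: w.
  rewrite !b'E !(linD (creationL _ _), linD (derivationL _ _)).
  rewrite !derivation_creation (derivation_derivation s t).
  have -> : creation s m (creation t n w) = creation t n (creation s m w).
    by rewrite /creation; case: (m < 0); case: (n < 0) => //; rewrite (lin0 (yL _ _)).
  by apply: cf_inj => i; rewrite !cfE; ring.
rewrite !hE !(linD (b'L _ _), linD (zero_modeL _ _)) !zb (zz s t) b'b'.
by apply: cf_inj => i; rewrite !cfE; ring.
Qed.

(** For equal superscripts the contraction coefficients are compared with the
pairing according to the signs of m and n.  Two negative modes of beta^1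
contract only through the derivations added at -1 and -3, and two nonnegative modes have
no multiplication to contract with. *)
Lemma hmode_pairing s t m n w : hmode s m (hmode t n w) - hmode t n (hmode s m w)
  = (2 * kap * pairing (djkm_poly c) s t m n) *: w.
Proof.
rewrite hmode_comm; suff -> : contraction s t (derivation_terms s m) n
    - contraction t s (derivation_terms t n) m = 2 * pairing (djkm_poly c) s t m n.
  by congr (_ *: _); ring.
rewrite pairing_djkm /contraction (eq_sym t s).
case: (eqVneq s t) => [<-|st]; last first.
  rewrite !andbF subrr; by case: s t st => -[] //= _; rewrite mulr0.
rewrite !andbT andbb orbb.
have tN k l : k < 0 -> \sum_(z <- derivation_terms true k) z.1 *+ (z.2 == l)
    = - (k == -1)%:R *+ (-3 == l) + (k == -3)%:R *+ (-1 == l).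
  by move=> k0; rewrite /derivation_terms k0 !big_cons big_nil addr0.
have tP k l : 0 <= k -> \sum_(z <- derivation_terms true k) z.1 *+ (z.2 == l)
    = - (2 * (k + 2)%:~R) *+ (- k - 4 == l) + (4 * c * (k + 1)%:~R) *+ (- k - 2 == l)
      - (2 * k%:~R) *+ (- k == l).
  move=> k0; rewrite /derivation_terms ltNge k0 /=; case: eqP => [->|_].
    rewrite !big_cons big_nil /= mulr0 mul0rn oppr0 mulr1 !addr0.
    by rewrite (_ : 2 * (0 + 2)%:~R = 4 :> K) //; ring.
  by rewrite !big_cons big_nil /= addr0 addrA !mulNrn.
have fN k l : k < 0 -> \sum_(z <- derivation_terms false k) z.1 *+ (z.2 == l) = 0.
  by move=> k0; rewrite /derivation_terms ltNge (ltW k0) big_nil.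
have fP k l : 0 <= k -> \sum_(z <- derivation_terms false k) z.1 *+ (z.2 == l)
    = - (2 * k%:~R) *+ (- k == l).
  rewrite le_eqVlt /derivation_terms => /orP[/eqP <-|->].
    by rewrite big_nil mulr0 oppr0 mul0rn.
  by rewrite big_seq1.
case: s; case: (ltrP m 0) => m0; case: (ltrP n 0) => n0 /=;
  [rewrite !tN //|rewrite !tP //|rewrite !tP //| |rewrite !fN //|rewrite !fP //
  |rewrite !fP //|].
- have [[-> ->]|[[-> ->]|[[-> ->]|[[-> ->]|H]]]] :
    (m = -1 /\ n = -1) \/ ((m = -1 /\ n = -3) \/ ((m = -3 /\ n = -1) \/
    ((m = -2 /\ n = -2) \/ (m + n != -2 /\ m + n != -4)))) by lia.
  1-4: rewrite /= ?(mulr0n, mulr1n); ring.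
  case: (eqVneq m (-1)) => [mE|m1]; case: (eqVneq m (-3)) => [mE'|m3];
    case: (eqVneq n (-1)) => [nE|n1]; case: (eqVneq n (-3)) => [nE'|n3];
    solve [ exfalso; lia | decide_int_eqs; rewrite /= ?(mulr0n, mulr1n); ring ].
1-2: have [nE|[nE|[nE|H]]] : n = - m \/ (n = - m - 2 \/ (n = - m - 4 \/
    (m + n != 0 /\ (m + n + 2 != 0 /\ m + n + 4 != 0)))) by lia.
1-8: decide_int_eqs; rewrite ?nE ?(mulr0n, mulr1n) ?intrD ?intrN; ring.
- have [[-> ->]|H] : (m = 0 /\ n = 0) \/ 0 < m + n by lia.
    by rewrite /= ?(mulr0n, mulr1n); ring.
  decide_int_eqs; rewrite ?(mulr0n, mulr1n); ring.
- decide_int_eqs; rewrite ?(mulr0n, mulr1n); ring.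
1-2: have [nE|nE] : n = - m \/ m + n != 0 by lia.
1-4: decide_int_eqs; rewrite ?nE ?(mulr0n, mulr1n) ?intrD ?intrN; ring.
have [[-> ->]|H] : (m = 0 /\ n = 0) \/ 0 < m + n by lia.
  by rewrite /= ?(mulr0n, mulr1n); ring.
decide_int_eqs; rewrite ?(mulr0n, mulr1n); ring.
Qed.

End HeisenbergModes.

(** * The Fock space *)

Section FockModel.
Variables (K : numFieldType) (r : bool) (c lam mu nu vk kap : K).
Local Notation W := (fock K).
Implicit Types (w u v : W) (m : {cmonom fvar}).

Definition fock_coeff (e : bool) m w : K := if e then w.2@_m else w.1@_m.
Definition fock_mon (e : bool) m : W := if e then (0, << m >>) else (<< m >>, 0).

Lemma fcoeff_lin a (p q : fpoly K) m : (a *: p + q)@_m = a * p@_m + q@_m.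
Proof.
exact: etrans (@mcoeffD _ _ m (a *: p) q) (f_equal (+%R^~ _) (@mcoeffZ _ _ a p m)).
Qed.

Lemma fock_coeff_lin e m a u v :
  fock_coeff e m (a *: u + v) = a * fock_coeff e m u + fock_coeff e m v.
Proof. by case: e; [exact: (fcoeff_lin a u.2)|exact: (fcoeff_lin a u.1)]. Qed.

Lemma fock_coeff_inj u v :
  (forall e m, fock_coeff e m u = fock_coeff e m v) -> u = v.
Proof.
case: u v => [u1 u2] [v1 v2] E; congr pair.
  by apply/malgP => m; exact: (E false m).
by apply/malgP => m; exact: (E true m).
Qed.

Lemma fock_coeffX e m i w : fock_coeff e m (fmulX i w) =
  if m i == 0%N then 0 else fock_coeff e (divcm m (ucm i)) w.
Proof. by case: e; [exact: (mcoeff_fpXM i w.2 m)|exact: (mcoeff_fpXM i w.1 m)]. Qed.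

Lemma fock_coeffD e m i w :
  fock_coeff e m (fder i w) = fock_coeff e (mmul m (ucm i)) w *+ (m i).+1.
Proof. by case: e; [exact: (mcoeff_fpder i w.2 m)|exact: (mcoeff_fpder i w.1 m)]. Qed.

Lemma fock_coeff_mon e e' m m' :
  fock_coeff e m (fock_mon e' m') = ((e == e') && (m == m'))%:R.
Proof.
by case: e e' => -[]; rewrite /fock_coeff /fock_mon /= ?mcoeffU1 ?mcoeff0 1?eq_sym.
Qed.

Lemma fpoly_sum (p : fpoly K) : p = \sum_(m <- msupp p) p@_m *: (<< m >> : fpoly K).
Proof.
rewrite [LHS]monalgE; apply: eq_bigr => m _; apply/malgP => k.
apply: etrans (mcoeffU m p@_m k) _.
apply: etrans (esym (@mcoeffZ _ _ (p@_m) << m >> k)).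
rewrite (mcoeffU m 1 k); case: (m == k) => /=.
  by rewrite mulr1n mulr1n mulr1.
by rewrite !mulr0n mulr0.
Qed.

Lemma fock_mon_span w : exists s : seq (K * (bool * {cmonom fvar})),
  w = \sum_(p <- s) p.1 *: fock_mon p.2.1 p.2.2.
Proof.
exists ([seq (w.1@_m, (false, m)) | m <- msupp w.1]
        ++ [seq (w.2@_m, (true, m)) | m <- msupp w.2]).
rewrite big_cat !big_map /=.
have F (p : fpoly K) : \sum_(m <- msupp p) p@_m *: fock_mon false m = (p, 0).
  rewrite [in RHS](fpoly_sum p).
  rewrite (big_morph (fun z : fpoly K => (z, 0) : W) (id1 := 0) (op1 := +%R)) //.
    by apply: eq_bigr => m _; congr pair; rewrite scaler0.
  by move=> y z; congr pair; rewrite addr0.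
have G (p : fpoly K) : \sum_(m <- msupp p) p@_m *: fock_mon true m = (0, p).
  rewrite [in RHS](fpoly_sum p).
  rewrite (big_morph (fun z : fpoly K => (0, z) : W) (id1 := 0) (op1 := +%R)) //.
    by apply: eq_bigr => m _; congr pair; rewrite scaler0.
  by move=> y z; congr pair; rewrite addr0.
by rewrite F G; case: w => [p q]; congr pair; rewrite ?addr0 ?add0r.
Qed.

Definition index_size (i : fvar) : nat :=
  match i with inl (_, n) => `|n|%N | inr (_, k) => k end.

Definition weight (i : fvar) : int :=
  if i is inl k then (if annihilating r k.2 then 1 else -1) else 0.

Definition poly_charge (p : fpoly K) : fpoly K :=
  [malg m in msupp p => (charge weight m)%:~R * p@_m].

Definition fock_charge w : W := (poly_charge w.1, poly_charge w.2).

Lemma poly_chargeE p m : (poly_charge p)@_m = (charge weight m)%:~R * p@_m.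
Proof.
rewrite [LHS]mcoeffE; case: ifPn => // /mcoeff_outdom ->; by rewrite mulr0.
Qed.

Lemma fock_coeffC e m w :
  fock_coeff e m (fock_charge w) = (charge weight m)%:~R * fock_coeff e m w.
Proof. by case: e; exact: poly_chargeE. Qed.

Lemma weightE s n : (weight (xvar s n))%:~R = (if annihilating r n then 1 else -1) :> K.
Proof. by rewrite /weight /=; case: ifP. Qed.

Lemma fock_coeffB e m w : fock_coeff e m (fB mu nu vk w) =
  (if e then nu else mu) * fock_coeff false m w
  + (if e then mu else vk) * fock_coeff true m w.
Proof.
have E (x y : K) (p q : fpoly K) : (x *: p + y *: q)@_m = x * p@_m + y * q@_m.
  by apply: etrans (fcoeff_lin x p _ m) _; congr (_ + _); exact: (@mcoeffZ _ _ y q m).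
by case: e; exact: E.
Qed.

Lemma fock_model : coefficient_model fock_coeff fock_mon (@fmulX K) (@fder K)
  fock_charge (fB mu nu vk) (fun k => annihilating r k.2) weight mu nu vk.
Proof.
split.
- exact: fock_coeff_lin.
- exact: fock_coeff_inj.
- exact: fock_coeff_mon.
- exact: fock_mon_span.
- exact: fock_coeffX.
- exact: fock_coeffD.
- by [].
- exact: fock_coeffC.
- exact: fock_coeffB.
Qed.

(** Finitely many variables occur in w, so their sizes are bounded. *)
Lemma fder_finite w : exists N : nat, forall i, (N < index_size i)%N -> fder i w = 0.
Proof.
have [s ->] := fock_mon_span w.
have DL i := D_linear fock_model i.
elim: s => [|[a [e m]] s [N IH]].
  by exists 0%N => i _; rewrite big_nil; exact: lin0 (DL i).
exists (maxn N (\sum_(i <- finsupp m) index_size i)) => i.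
rewrite gtn_max => /andP[iN im]; rewrite big_cons (linD (DL i)) (linZ (DL i)) IH // addr0.
rewrite /= (D_mon fock_model e m i) (_ : m i = 0%N) ?scale0r ?scaler0 //.
apply/eqP; rewrite cmE_eq0; apply/negP => ims.
by move: im; rewrite (big_fsetD1 i ims) /= ltnNge leq_addr.
Qed.

Let xs s n := @fmulX K (xvar s n).
Let ds s n := @fder K (xvar s n).
Let ys s n := @fmulX K (yvar s n).
Let es s n := @fder K (yvar s n).

Lemma fock_weyl : weyl_system r xs ds fock_charge.
Proof.
split.
- by move=> s n; exact: (X_linear fock_model).
- by move=> s n; exact: (D_linear fock_model).
- by move=> s t n j w; exact: (X_comm fock_model).
- by move=> s t n j w; exact: (D_comm fock_model).
- by move=> s t n j w; exact: (DX fock_model).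
- move=> w; have [N Nd] := fder_finite w; exists N%:Z => s n nN.
  by apply: Nd => /=; lia.
- exact: (C_linear fock_model).
- by move=> s n w; have := CX fock_model (xvar s n) w; rewrite weightE; exact.
- by move=> s n w; have := CD fock_model (xvar s n) w; rewrite weightE; exact.
Qed.

Definition fock_modes s := if s then b1op c mu nu vk kap else bop lam kap.

Lemma yvar_eq s t (m n : int) : m < 0 -> n < 0 ->
  (yvar s m == yvar t n) = (s == t) && (m == n).
Proof.
move=> m0 n0; apply/eqP/andP => [[-> mn]|[/eqP -> /eqP -> //]].
by split=> //; apply/eqP; lia.
Qed.

Lemma fock_heisenberg :
  heisenberg_system xs ds fock_charge (djkm_poly c) kap fock_modes.
Proof.
have DXx s (m : int) t n w : ds s m (ys t n w) = ys t n (ds s m w).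
  by have := DX fock_model (xvar s m) (yvar t n) w; rewrite add0r.
have DXy s (m : int) t n w : es s m (xs t n w) = xs t n (es s m w).
  by have := DX fock_model (yvar s m) (xvar t n) w; rewrite add0r.
pose cfp (i : bool * {cmonom fvar}) w := fock_coeff i.1 i.2 w.
have cfpL i a u v : cfp i (a *: u + v) = a * cfp i u + cfp i v by exact: fock_coeff_lin.
have cfp_inj u v : (forall i, cfp i u = cfp i v) -> u = v.
  by move=> E; apply: fock_coeff_inj => e m; exact: (E (e, m)).
have yL s n : linear (ys s n) by exact: (X_linear fock_model).
have eL s n : linear (es s n) by exact: (D_linear fock_model).
have modesE s n w : fock_modes s n w = hmode ys es (fB mu nu vk) c lam kap s n w.
  by case: s.
have e_fin w : exists N : int, forall s n, n < N -> es s n w = 0.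
  have [N Nd] := fder_finite w; exists (- N%:Z - 2) => s n nN.
  by apply: Nd => /=; lia.
have e_y s t (m n : int) w : m < 0 -> n < 0 ->
    es s m (ys t n w) = w *+ ((s == t) && (m == n)) + ys t n (es s m w).
  move=> m0 n0; rewrite -(yvar_eq s t m0 n0).
  exact: (DX fock_model (yvar s m) (yvar t n) w).
have commute T : linear T -> (forall s n w, T (ys s n w) = ys s n (T w)) ->
    (forall s n w, T (es s n w) = es s n (T w)) ->
    (forall w, T (fB mu nu vk w) = fB mu nu vk (T w)) ->
    forall s n w, fock_modes s n (T w) = T (fock_modes s n w).
  move=> TL Ty Te TB s n w; rewrite !modesE; apply/esym.
  exact: (hmode_commute cfpL cfp_inj c lam kap TL Ty Te TB).
split.
- move=> s n a u v; rewrite !modesE.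
  exact: (hmodeL cfpL cfp_inj yL eL (B_linear fock_model)).
- move=> s t n j w; apply: (commute (xs t j)).
  + exact: (X_linear fock_model).
  + by move=> *; exact: (X_comm fock_model).
  + by move=> *; rewrite DXy.
  + by move=> v; exact: esym (B_X fock_model (xvar t j) v).
- move=> s t n j w; apply: (commute (ds t j)).
  + exact: (D_linear fock_model).
  + by move=> *; rewrite DXx.
  + by move=> *; exact: (D_comm fock_model).
  + by move=> v; exact: esym (B_D fock_model (xvar t j) v).
- move=> s n w; apply/esym; apply: (commute fock_charge).
  + exact: (C_linear fock_model).
  + by move=> t j v; have := CX fock_model (yvar t j) v; rewrite scale0r addr0; exact.
  + by move=> t j v; have := CD fock_model (yvar t j) v; rewrite scale0r subr0; exact.
  + exact: (B_C fock_model).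
- move=> s w.
  have [N Nb] := hmode_bounded cfpL cfp_inj ys (fB mu nu vk) e_fin c lam kap s w.
  by exists N => n /Nb; rewrite modesE.
- move=> s t m n w; rewrite !modesE.
  apply: (hmode_pairing cfpL cfp_inj yL eL (B_linear fock_model)).
  + by move=> *; exact: (X_comm fock_model).
  + by move=> *; exact: (D_comm fock_model).
  + exact: e_y.
  + by move=> *; exact: (B_X fock_model).
  + by move=> *; exact: (B_D fock_model).
Qed.

End FockModel.

(** * The action of the central extension *)

Section CurrentModes.
Variables (K : numFieldType) (W : lmodType K) (r : bool) (c kap : K).
Variables (cf : bool -> {cmonom fvar} -> W -> K) (mon : bool -> {cmonom fvar} -> W).
Variables (X D : fvar -> W -> W) (C B : W -> W) (wt : fvar -> int) (mu nu vk : K).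
Hypothesis M : coefficient_model cf mon X D C B
  (fun k => annihilating r k.2) wt mu nu vk.
Let x s n := X (xvar s n).
Let d s n := D (xvar s n).
Hypothesis WS : weyl_system r x d C.
Variable b : bool -> int -> W -> W.
Hypothesis HS : heisenberg_system x d C (djkm_poly c) kap b.
Let chi := kap + 4 *+ ~~ r.

Local Notation A := (djkm_ring c).
Local Notation tu := (djkm_tu c).
Local Notation P := (djkm_poly c).
Local Notation current_e := (current_e r x d P chi b).
Local Notation current_h := (current_h r x d P b).
Local Notation amode := (amode r x d).
Local Notation afield := (afield r x d).
Implicit Types (s t : bool) (m n k : int) (p q z : A) (w : W).

(** The coefficient of z^(-m-1) in the series G s belongs to t^m u^s. *)
Definition modes (G : bool -> opfield W) p w : W :=
  tu_lift (fun s m => G s (- m - 1) w) p.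

Lemma modes_tu G s m w : modes G (tu s m) w = G s (- m - 1) w.
Proof. exact: tu_liftE. Qed.

Lemma modes_linl G w : linear (modes G ^~ w).
Proof. exact: tu_lift_linear. Qed.

Lemma modes_linr G p : (forall s, flinear (G s)) -> linear (modes G p).
Proof.
move=> GL a u v; move: p.
apply: (tu_ext (f := fun p => modes G p (a *: u + v))
               (f' := fun p => a *: modes G p u + modes G p v)).
- exact: modes_linl.
- move=> k p q; have E w := modes_linl G w k p q.
  by rewrite (E u) (E v) !scalerDr !scalerA (mulrC a k) addrACA.
- by move=> s m; rewrite !modes_tu GL.
Qed.

Lemma modes_mul G s m t n w :
  modes G (tu s m * tu t n) w = fmul P G s t (- m - 1 - n) w.
Proof.
rewrite (tuM_lin s t m n (modes_linl G w)) /fmul !modes_tu.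
have E i : - (m + n + i) - 1 = - m - 1 - n - i by lia.
have E0 : - (m + n) - 1 = - m - 1 - n by lia.
case: (s && t); last by rewrite E0.
by rewrite /fpolymul (poly_sum c (fun i => G false (- m - 1 - n - i%:Z) w)) !E E0 subr0.
Qed.

Definition cur_a := modes (fun s => whole (afield s)).
Definition cur_h := modes current_h.
Definition cur_e := modes current_e.

Lemma cur_a_tu s n w : cur_a (tu s n) w = amode s n w.
Proof.
rewrite [LHS]modes_tu whole_afield.
by rewrite (_ : - (- n - 1) - 1 = n) //; lia.
Qed.

Lemma cur_h_tu s n w : cur_h (tu s n) w = current_h s (- n - 1) w.
Proof. exact: modes_tu. Qed.

Lemma cur_e_tu s n w : cur_e (tu s n) w = current_e s (- n - 1) w.
Proof. exact: modes_tu. Qed.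

Lemma cur_aL p : linear (cur_a p).
Proof. by apply: modes_linr => s; exact: (afieldL WS). Qed.
Lemma cur_hL p : linear (cur_h p).
Proof. by apply: modes_linr => s; exact: (current_hL WS HS). Qed.
Lemma cur_eL p : linear (cur_e p).
Proof. by apply: modes_linr => s; exact: (current_eL WS chi HS). Qed.

Lemma tu_ext2 (U : lmodType K) (f g : A -> A -> U) :
  (forall q, linear (f^~ q)) -> (forall p, linear (f p)) ->
  (forall q, linear (g^~ q)) -> (forall p, linear (g p)) ->
  (forall s m t n, f (tu s m) (tu t n) = g (tu s m) (tu t n)) ->
  forall p q, f p q = g p q.
Proof.
move=> fl fr gl gr E p q; move: p; apply: (tu_ext (f := f^~ q) (f' := g^~ q)) => // s m.
by move: q; apply: tu_ext => // t n.
Qed.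

Lemma mulr_linl z : linear (fun p => p * z).
Proof. by move=> a p q; rewrite mulrDl scalerAl. Qed.

Lemma mulr_linr z : linear (fun p => z * p).
Proof. by move=> a p q; rewrite mulrDr scalerAr. Qed.

Lemma cur_a_a p q w : cur_a p (cur_a q w) = cur_a q (cur_a p w).
Proof.
have l u : linear (cur_a^~ u) := modes_linl _ u.
apply: (tu_ext2 (f := fun p q => cur_a p (cur_a q w))
   (g := fun p q => cur_a q (cur_a p w))).
- by move=> z; exact: l.
- by move=> z; apply: lin_comp; [exact: cur_aL|exact: l].
- by move=> z; apply: lin_comp; [exact: cur_aL|exact: l].
- by move=> z; exact: l.
move=> s m t n; rewrite !cur_a_tu /amode; case: ifP => am; case: ifP => an.
- exact: (d_comm WS).
- rewrite (d_x WS) (_ : (m == n) = false) ?andbF ?add0r //.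
  by apply: contraFF an => /eqP <-.
- rewrite (d_x WS) (_ : (n == m) = false) ?andbF ?add0r //.
  by apply: contraFF am => /eqP <-.
- exact: (x_comm WS).
Qed.

Lemma cur_h_a p q w :
  cur_h p (cur_a q w) = cur_a q (cur_h p w) - 2 *: cur_a (p * q) w.
Proof.
have la u : linear (cur_a^~ u) := modes_linl _ u.
have lh u : linear (cur_h^~ u) := modes_linl _ u.
apply: (tu_ext2 (f := fun p q => cur_h p (cur_a q w))
   (g := fun p q => cur_a q (cur_h p w) - 2 *: cur_a (p * q) w)).
- by move=> z; exact: lh.
- by move=> z; apply: lin_comp; [exact: cur_hL|exact: la].
- move=> z; apply: lin_add; first by apply: lin_comp; [exact: cur_aL|exact: lh].
  apply: lin_opp; apply: lin_scale.
  exact: lin_comp (la w) (mulr_linl z).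
- move=> z; apply: lin_add; first exact: la.
  by apply: lin_opp; apply: lin_scale; exact: lin_comp (la w) (mulr_linr z).
move=> s m t n; rewrite (modes_mul _ s m t n w : cur_a (tu s m * tu t n) w = _).
rewrite !cur_a_tu !cur_h_tu.
by rewrite (amode_current_h WS HS t n s (- m - 1) w) /fshift addrK.
Qed.

Lemma cur_e_a p q w : cur_e p (cur_a q w) =
  cur_a q (cur_e p w) - cur_h (p * q) w - (chi * phi p q) *: w.
Proof.
have la u : linear (cur_a^~ u) := modes_linl _ u.
have lh u : linear (cur_h^~ u) := modes_linl _ u.
have le u : linear (cur_e^~ u) := modes_linl _ u.
apply: (tu_ext2 (f := fun p q => cur_e p (cur_a q w))
   (g := fun p q => cur_a q (cur_e p w) - cur_h (p * q) w - (chi * phi p q) *: w)).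
- by move=> z; exact: le.
- by move=> z; apply: lin_comp; [exact: cur_eL|exact: la].
- move=> z; apply: lin_add; [apply: lin_add|].
  + by apply: lin_comp; [exact: cur_aL|exact: le].
  + by apply: lin_opp; exact: lin_comp (lh w) (mulr_linl z).
  + by apply: lin_opp; apply: lin_scalar; apply: (lin_scale (V := K^o)); exact: phi_linl.
- move=> z; apply: lin_add; [apply: lin_add|].
  + exact: la.
  + by apply: lin_opp; exact: lin_comp (lh w) (mulr_linr z).
  + by apply: lin_opp; apply: lin_scalar; apply: (lin_scale (V := K^o)); exact: phi_linr.
move=> s m t n; rewrite (modes_mul _ s m t n w : cur_h (tu s m * tu t n) w = _).
rewrite !cur_a_tu !cur_e_tu phi_tu.
rewrite (amode_current_e WS chi HS t n s (- m - 1) w).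
have -> : (fshift 1 n (fmul P current_h s t) + central_term P chi s t n) (- m - 1) w
  = 1 *: fmul P current_h s t (- m - 1 - n) w
    + (chi * pairing P s t (- (- m - 1) - 1) n) *: w by [].
rewrite (_ : - (- m - 1) - 1 = m); last by lia.
rewrite scale1r; set F := fmul _ _ _ _ _ _; rewrite (addrC F).
by rewrite [_ + (_ + F)]addrA !addrK.
Qed.

Lemma cur_h_C p w : C (cur_h p w) = cur_h p (C w).
Proof.
have lh u : linear (cur_h^~ u) := modes_linl _ u.
move: p; apply: tu_ext; [exact: lin_comp (charge_linear WS) (lh w)|exact: lh|].
by move=> s m; rewrite !cur_h_tu (C_current_h WS HS s (- m - 1) w) addr0.
Qed.

Lemma cur_e_C p w : C (cur_e p w) = cur_e p (C w) + cur_e p w.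
Proof.
have le u : linear (cur_e^~ u) := modes_linl _ u.
move: p; apply: tu_ext.
- exact: lin_comp (charge_linear WS) (le w).
- exact: lin_add.
move=> s m; rewrite !cur_e_tu (C_current_e WS chi HS s (- m - 1) w).
by rewrite (_ : (1 *: current_e s) _ w = 1 *: current_e s (- m - 1) w) // scale1r.
Qed.

(** No matrix coefficient between two polynomials in the y. *)
Definition vacuum_zero (F : W -> W) := forall e e' (m m' : {cmonom fvar}),
  yonly m -> yonly m' -> cf e' m' (F (mon e m)) = 0.

(** The vanishing principle applies to operators commuting with all cur_a, as their
values on monomials are the multiplications by the negative variables and the
derivations along the positive ones. *)
Lemma cur_vanish (F : W -> W) (k : int) : linear F -> 0 <= k ->
  (forall q w, F (cur_a q w) = cur_a q (F w)) ->
  (forall w, C (F w) = F (C w) + k%:~R *: F w) ->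
  (k = 0 -> vacuum_zero F) -> forall w, F w = 0.
Proof.
move=> FL k0 Fa FC Fs; apply: (commuting_vanish M FL k0) => //.
- move=> [s n] w kN; have := Fa (tu s n) w; rewrite !cur_a_tu /amode.
  by move: kN; rewrite /annihilating /= => /negbTE ->.
- move=> [s n] w kP; have := Fa (tu s n) w; rewrite !cur_a_tu /amode.
  by move: kP; rewrite /annihilating /= => ->.
Qed.

Lemma cur_h_h_vacuum p q : vacuum_zero (fun w =>
  cur_h p (cur_h q w) - cur_h q (cur_h p w) - (2 * chi * phi p q) *: w).
Proof.
move=> e e' m m' ym ym'.
have lh u : linear (cur_h^~ u) := modes_linl _ u.
set v := mon e m.
have piL : linear (cf e' m' : W -> K^o) by move=> a u u'; exact: (model_linear M).
apply: (tu_ext2 (U := K^o) (f := fun p q => cf e' m' (cur_h p (cur_h q v)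
    - cur_h q (cur_h p v) - (2 * chi * phi p q) *: v)) (g := fun _ _ => 0)).
- move=> z; apply: lin_comp piL _; apply: lin_add; [apply: lin_add|].
  + exact: lh.
  + by apply: lin_opp; apply: lin_comp; [exact: cur_hL|exact: lh].
  + by apply: lin_opp; apply: lin_scalar; apply: (lin_scale (V := K^o)); exact: phi_linl.
- move=> z; apply: lin_comp piL _; apply: lin_add; [apply: lin_add|].
  + by apply: lin_comp; [exact: cur_hL|exact: lh].
  + by apply: lin_opp; exact: lh.
  + by apply: lin_opp; apply: lin_scalar; apply: (lin_scale (V := K^o)); exact: phi_linr.
- by move=> z a u u'; rewrite scaler0 addr0.
- by move=> z a u u'; rewrite scaler0 addr0.
move=> s k t n.
have v0 : vacuum d v.
  by move=> s' n'; rewrite /d (D_mon M) ym scale0r.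
have pi_x s' n' w : (cf e' m' : W -> K^o) (x s' n' w) = 0.
  by rewrite /x (model_X M) ym'.
have := pi_current_h_comm WS HS piL pi_x s t (- k - 1) (- n - 1) v0.
rewrite !cur_h_tu !(linB piL) (linZ piL) phi_tu => ->.
rewrite !(_ : forall i : int, - (- i - 1) - 1 = i) ?subrr //; lia.
Qed.

Local Notation res := (residue (@phi K c)).

Definition tau (g : djkm c) w : W :=
  sl2_action cur_a cur_h cur_e g.1 w + (chi * res g.2) *: w.

Lemma phiDl p q z : phi (p + q) z = phi p z + phi q z.
Proof. by have := phiL 1 p q z; rewrite scale1r mul1r. Qed.

Lemma phiDr p q z : phi p (q + z) = phi p q + phi p z.
Proof. by have := phiR 1 p q z; rewrite scale1r mul1r. Qed.

Lemma phi0l z : phi (0 : A) z = 0.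
Proof. by apply: (addrI (phi 0 z)); rewrite -phiDl !addr0. Qed.

Lemma phiZl a p z : phi (a *: p) z = a * phi p z.
Proof. by have := phiL a p 0 z; rewrite !addr0 phi0l addr0. Qed.

Let res_kcls p q : res (kcls p q) = phi p q :=
  residue_kcls phiDl phiDr phiZl (@phi_leibniz K c) (@phi_scalar K c) (@phi1 K c) p q.

Let res_linear : linear (res : kahler_mod_exact A -> K^o).
Proof.
move=> k u v.
exact: (residue_linear phiDl phiDr phiZl (@phi_leibniz K c) (@phi_scalar K c) (@phi1 K c)).
Qed.

Lemma tau_linearl w : linear (tau^~ w).
Proof.
have la : linear (cur_a^~ w) := modes_linl _ w.
have lh : linear (cur_h^~ w) := modes_linl _ w.
have le : linear (cur_e^~ w) := modes_linl _ w.
have l1 : linear (fun g : djkm c => cur_e g.1.1.1 w) by move=> k u v; exact: le.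
have l2 : linear (fun g : djkm c => cur_a g.1.1.2 w) by move=> k u v; exact: la.
have l3 : linear (fun g : djkm c => cur_h g.1.2 w) by move=> k u v; exact: lh.
have l4 : linear (fun g : djkm c => res g.2 : K^o) by move=> k u v; exact: res_linear.
apply: lin_add; first by apply: lin_add => //; apply: lin_add => //; exact: lin_opp.
by apply: lin_scalar; exact: (lin_scale (V := K^o)).
Qed.

Lemma tau_linearr g : linear (tau g).
Proof.
apply: lin_add; last by move=> a u v; rewrite scalerDr !scalerA mulrC.
apply: lin_add; last exact: cur_hL.
by apply: lin_add; [exact: cur_eL|apply: lin_opp; exact: cur_aL].
Qed.

Lemma tau_bracket g g' w :
  tau (djkm_bracket g g') w = tau g (tau g' w) - tau g' (tau g w).
Proof.
pose cfp (i : bool * {cmonom fvar}) v := cf i.1 i.2 v.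
have cfpL i a u v : cfp i (a *: u + v) = a * cfp i u + cfp i v by exact: (model_linear M).
have cfp_inj u v : (forall i, cfp i u = cfp i v) -> u = v.
  by move=> E; apply: (model_inj M) => e m; exact: (E (e, m)).
case: g g' => [[[p q] z] u] [[[p' q'] z'] u'].
have := sl2_action_comm cfpL cfp_inj cur_aL cur_hL cur_eL (charge_linear WS)
  (modes_linl _) (modes_linl _) (modes_linl _) (@phi_leibniz K c) (@phi1 K c)
  cur_a_a cur_h_a cur_e_a cur_h_C cur_e_C cur_vanish cur_h_h_vacuum
  p q z p' q' z' w.
set S := sl2_action _ _ _.
have SL y : linear (S y).
  apply: lin_add; last exact: cur_hL.
  by apply: lin_add; [exact: cur_eL|apply: lin_opp; exact: cur_aL].
rewrite /tau -/S /= => E.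
have -> : res (kcls p q' + kcls q p' + kcls z z' *+ 2)
    = phi p q' + phi q p' + phi z z' *+ 2.
  apply: etrans (lin_sum3 (kcls p q') (kcls q p') (kcls z z') res_linear) _.
  exact: (f_equal2 +%R (f_equal2 +%R (res_kcls p q') (res_kcls q p'))
            (f_equal (fun a : K => a *+ 2) (res_kcls z z'))).
rewrite -[LHS]E !(linD (SL _)) !(linZ (SL _)) !scalerDr !scalerA.
apply: cfp_inj => i.
rewrite !(formD (cfpL i), formN (cfpL i), formZ (cfpL i)); ring.
Qed.

Lemma tau_e s m w : tau (djkm_e c s m) w = current_e s (- m - 1) w.
Proof.
rewrite /tau /sl2_action /= cur_e_tu (lin0 res_linear) mulr0 scale0r.
rewrite (lin0 (modes_linl _ w : linear (cur_a^~ w))).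
by rewrite (lin0 (modes_linl _ w : linear (cur_h^~ w))) subr0 !addr0.
Qed.

Lemma tau_f s m w : tau (djkm_f c s m) w = - amode s m w.
Proof.
rewrite /tau /sl2_action /= cur_a_tu (lin0 res_linear) mulr0 scale0r.
rewrite (lin0 (modes_linl _ w : linear (cur_e^~ w))).
by rewrite (lin0 (modes_linl _ w : linear (cur_h^~ w))) sub0r !addr0.
Qed.

Lemma tau_h s m w : tau (djkm_h c s m) w = current_h s (- m - 1) w.
Proof.
rewrite /tau /sl2_action /= cur_h_tu (lin0 res_linear) mulr0 scale0r.
rewrite (lin0 (modes_linl _ w : linear (cur_e^~ w))).
by rewrite (lin0 (modes_linl _ w : linear (cur_a^~ w))) subr0 addr0 add0r.
Qed.

Lemma tau_center u w : tau (0, u) w = (chi * res u) *: w.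
Proof.
rewrite /tau /sl2_action /=.
rewrite (lin0 (modes_linl _ w : linear (cur_e^~ w))).
rewrite (lin0 (modes_linl _ w : linear (cur_a^~ w))).
by rewrite (lin0 (modes_linl _ w : linear (cur_h^~ w))) subr0 !add0r.
Qed.

Lemma tau_omega0 w : tau (omega0 c) w = chi *: w.
Proof.
rewrite [LHS]tau_center res_kcls phi_tu pairing_djkm /=.
by rewrite mulr1n mulr1.
Qed.

Lemma tau_omegaN (k : nat) w : tau (omegaN c k) w = 0.
Proof. by rewrite [LHS]tau_center res_kcls phi_tu pairing_djkm /= mulr0 scale0r. Qed.

End CurrentModes.

(** * Uniqueness and the theorem *)

Section Determination.
Variables (K : numFieldType) (c : K) (U : lmodType K).
Local Notation A := (djkm_ring c).
Local Notation tu := (djkm_tu c).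

(** On the central part, the difference of the two maps is a bilinear map on the
ring with the formal properties of the class of x dy, killing the classes omega. *)
Lemma djkm_linear_ext (T T' : djkm c -> U) : linear T -> linear T' ->
  (forall s m, T (djkm_e c s m) = T' (djkm_e c s m)) ->
  (forall s m, T (djkm_f c s m) = T' (djkm_f c s m)) ->
  (forall s m, T (djkm_h c s m) = T' (djkm_h c s m)) ->
  T (omega0 c) = T' (omega0 c) ->
  (forall k : nat, (1 <= k <= 4)%N -> T (omegaN c k) = T' (omegaN c k)) ->
  T =1 T'.
Proof.
move=> TL T'L Te Tf Th T0 TN [[[p q] z] u].
pose ie : djkm c := (sl2_e p, 0); pose jf : djkm c := (sl2_f q, 0).
pose ih : djkm c := (sl2_h z, 0); pose iu : djkm c := (0, u).
have sumT (S : djkm c -> U) : linear S -> S (p, q, z, u) = S ie + S jf + S ih + S iu.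
  move=> SL; rewrite -(linD SL ie jf : S (ie + jf) = _).
  rewrite -(linD SL (ie + jf) ih : S (ie + jf + ih) = _).
  rewrite -(linD SL (ie + jf + ih) iu : S (ie + jf + ih + iu) = _).
  apply: (f_equal S).
  apply: (f_equal2 pair); [apply: (f_equal2 pair); [apply: (f_equal2 pair)|]|];
    by rewrite /= ?addr0 ?add0r ?addr0.
have pairL (i : A -> sl2 A) : linear i -> linear (fun p => (i p, 0) : djkm c).
  move=> iL k y y'; rewrite (iL k); apply: (f_equal2 pair) => //.
  by change (0 = k *: (0 : kahler_mod_exact A) + 0); rewrite scaler0 addr0.
have eL : linear (@sl2_e K A).
  by move=> k y y'; apply: (f_equal2 pair); [apply: (f_equal2 pair)|] => //;
     change (0 = k *: (0 : A) + 0); rewrite scaler0 addr0.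
have fL : linear (@sl2_f K A).
  by move=> k y y'; apply: (f_equal2 pair); [apply: (f_equal2 pair)|] => //;
     change (0 = k *: (0 : A) + 0); rewrite scaler0 addr0.
have hL : linear (@sl2_h K A).
  by move=> k y y'; apply: (f_equal2 pair); [apply: (f_equal2 pair)|] => //;
     change (0 = k *: (0 : A) + 0); rewrite scaler0 addr0.
have E (i : A -> sl2 A) : linear i ->
    (forall s m, T (i (tu s m), 0) = T' (i (tu s m), 0)) ->
    forall y, T (i y, 0) = T' (i y, 0).
  by move=> iL iT; apply: tu_ext => //; apply: lin_comp => //; exact: pairL.
rewrite (sumT _ TL) (sumT _ T'L) /ie /jf /ih (E _ eL Te) (E _ fL Tf) (E _ hL Th).
congr (_ + _).
pose F (v : kahler_mod_exact A) := T (0, v) - T' (0, v).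
have zL : linear (fun v : kahler_mod_exact A => (0, v) : djkm c).
  move=> k y y'; apply: (f_equal2 pair) => //.
  by change (0 = k *: (0 : sl2 A) + 0); rewrite scaler0 addr0.
have FL : linear F.
  by apply: lin_add; [exact: lin_comp TL zL|apply: lin_opp; exact: lin_comp T'L zL].
apply/eqP; rewrite -subr_eq0; apply/eqP; apply: (kcls_span FL) => y y'.
pose g (a a' : A) := F (kcls a a').
have gl a' : linear (g^~ a').
  by move=> k a1 a2; rewrite /g kclsDl kclsZl FL.
have gr a : linear (g a).
  by move=> k a1 a2; rewrite /g kclsDr kclsZr FL.
have gleib a a1 a2 : g a (a1 * a2) = g (a * a1) a2 + g (a * a2) a1.
  by rewrite /g kcls_leibniz (linD FL).
have g1 a : g 1 a = 0 by rewrite /g kcls1 (lin0 FL).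
have tuMf s m n : tu s m * tu false n = tu s (m + n).
  by rewrite tuM /tu_mul andbF addbF.
have tuMt m n : tu true m * tu true n =
    tu false (m + n + 4) - (2 * c) *: tu false (m + n + 2) + tu false (m + n).
  by rewrite tuM.
have g0 : g (tu false (-1)) (tu false 1) = 0 by apply/eqP; rewrite subr_eq0; exact/eqP.
have gN (k : nat) : (1 <= k <= 4)%N -> g (tu true (- k%:Z)) (tu false 1) = 0.
  by move=> /TN Tk; apply/eqP; rewrite subr_eq0; exact/eqP.
have z0 (_ : A) : linear (fun _ : A => 0 : U) by move=> k a1 a2; rewrite scaler0 addr0.
apply: (@tu_ext2 K c U g (fun _ _ => 0) gl gr z0 z0).
exact: (g_tu0 (tu1 c) tuMf tuMt gl gr gleib g1 g0 gN).
Qed.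

End Determination.

Section Realization.
Variables (K : numFieldType) (W : lmodType K) (r : bool) (c kap : K).
Variables (X D : fvar -> W -> W) (b : bool -> int -> W -> W).
Let x s n := X (xvar s n).
Let d s n := D (xvar s n).
Let chi := kap + 4 *+ ~~ r.
Local Notation tau := (@tau K W r c kap X D b).

Definition current_formulas (T : djkm c -> W -> W) : Prop :=
  [/\ forall k : nat, (1 <= k <= 4)%N -> T (omegaN c k) = 0,
      T (omega0 c) = (fun w => chi *: w),
      forall s, series1 (fun m => T (djkm_f c s m)) = - whole (afield r x d s),
      forall s, series1 (fun m => T (djkm_h c s m)) = current_h r x d (djkm_poly c) b s
    & forall s, series1 (fun m => T (djkm_e c s m)) =
        current_e r x d (djkm_poly c) chi b s].

Lemma tau_formulas : current_formulas tau.
Proof.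
have E (k : int) : - (- k - 1) - 1 = k by lia.
split.
- by move=> k _; apply/funext => w; exact: tau_omegaN.
- by apply/funext => w; exact: tau_omega0.
- move=> s; apply/funext => k; apply/funext => w; rewrite [LHS]tau_f.
  by congr (- _); rewrite whole_afield.
- by move=> s; apply/funext => k; apply/funext => w; rewrite [LHS]tau_h E.
- by move=> s; apply/funext => k; apply/funext => w; rewrite [LHS]tau_e E.
Qed.

Lemma tau_linear : linear tau.
Proof. by move=> a g g'; apply/funext => w; exact: tau_linearl. Qed.

Lemma current_formulas_unique (T T' : djkm c -> W -> W) : linear T -> linear T' ->
  current_formulas T -> current_formulas T' -> T = T'.
Proof.
move=> TL T'L [TN T0 Tf Th Te] [T'N T'0 T'f T'h T'e].
have E (G G' : int -> W -> W) : series1 G = series1 G' -> forall m, G m = G' m.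
  move=> GG m; have := congr1 (fun A => A (- m - 1)) GG.
  by rewrite /series1 (_ : - (- m - 1) - 1 = m) //; lia.
apply/funext; apply: (djkm_linear_ext TL T'L).
- by move=> s; apply: (E (fun m => T (djkm_e c s m))); rewrite Te T'e.
- by move=> s; apply: (E (fun m => T (djkm_f c s m))); rewrite Tf T'f.
- by move=> s; apply: (E (fun m => T (djkm_h c s m))); rewrite Th T'h.
- by rewrite T0 T'0.
- by move=> k k14; rewrite TN ?T'N.
Qed.

End Realization.

Section Fock.
Variables (K : numFieldType) (r : bool) (c lam mu nu vk kap : K).
Local Notation b := (beta lam kap).
Local Notation b1 := (beta1 c mu nu vk kap).
Local Notation modes := (fock_modes c lam mu nu vk kap).
Local Notation chi := (kap + 4 *+ ~~ r).

Lemma fock_fields_ok : fields_ok r b b1.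
Proof.
have WS := fock_weyl r mu nu vk.
have HS := fock_heisenberg r c lam mu nu vk kap.
split.
- exact: (a_as_ok WS).
- exact: (as_as_ok WS).
- exact: (a_as_as_ok WS).
- exact: (b_as_ok WS HS false).
- exact: (b_as_ok WS HS true).
Qed.

Lemma djkm_formulasE (T : djkm c -> fock K -> fock K) :
  djkm_formulas r chi b b1 T <->
  current_formulas r kap (@fmulX K) (@fder K) modes T.
Proof.
split.
  move=> [TN [T0 [Tf [Tf1 [Th [Th1 [Te Te1]]]]]]].
  split=> [||[]|[]|[]].
  - exact: TN.
  - exact: T0.
  - exact: Tf1.
  - exact: Tf.
  - exact: Th1.
  - exact: Th.
  - exact: Te1.
  - exact: Te.
move=> [TN T0 Tf Th Te]; split; first exact: TN.
split; first exact: T0.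
split; first exact: (Tf false).
split; first exact: (Tf true).
split; first exact: (Th false).
split; first exact: (Th true).
split; first exact: (Te false).
exact: (Te true).
Qed.

Lemma fock_realization : fields_ok r b b1 /\
  exists T : djkm c -> fock K -> fock K,
    unique (fun T' => linear T' /\ djkm_formulas r chi b b1 T') T /\
    is_representation T.
Proof.
have WS := fock_weyl r mu nu vk.
have HS := fock_heisenberg r c lam mu nu vk kap.
split; first exact: fock_fields_ok.
exists (@tau K (fock K) r c kap (@fmulX K) (@fder K) modes).
have F := @tau_formulas K (fock K) r c kap (@fmulX K) (@fder K) modes.
have L := @tau_linear K (fock K) r c kap (@fmulX K) (@fder K) modes.
split; last first.
  split; first exact: (tau_linearr WS HS).
  exact: (tau_bracket (fock_model r mu nu vk) WS HS).
split; first by split; [exact: L|exact: (djkm_formulasE _).2 F].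
by move=> T' [T'L /djkm_formulasE F']; exact: (current_formulas_unique L T'L F F').
Qed.

End Fock.

Theorem theorem8 (R : realType) (r : bool) (c : R[i])
    (hc1 : c != 1) (hcN1 : c != - 1)
    (lam mu nu vk kappa0 chi0 : R[i])
    (hchi0 : chi0 = kappa0 + 4 *+ (r == 0%N :> nat)) :
  let b := beta lam kappa0 in
  let b1 := beta1 c mu nu vk kappa0 in
  fields_ok r b b1 /\
  exists tau : djkm c -> fock R[i] -> fock R[i],
    unique (fun tau' => linear tau' /\ djkm_formulas r chi0 b b1 tau') tau /\
    is_representation tau.
Proof.
have -> : chi0 = kappa0 + 4 *+ ~~ r by rewrite hchi0; case: (r).
exact: (fock_realization r c lam mu nu vk kappa0).
Qed.
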